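(* Let $d\geq 1$, let $V:\mathbb{R}^d\to\mathbb{R}$ and $W:\mathbb{R}^d\times\mathbb{R}^d\to(-\infty,+\infty]$ satisfy (H1), (H2), (H3) below, and let $(\beta_N)_N$ be positive reals with $\beta_N/(N\log N)\to+\infty$. For $N\geq N_0$ let $P_N$, $\mu_N$, $Z_N$, $I$ be as in the context. Then: (1) $I$ has compact level sets $\{I\leq r\}$ (hence is lower semi-continuous) and $\inf_{\mathcal{M}_1(\mathbb{R}^d)}I>-\infty$. (2) For every Borel set $A\subset\mathcal{M}_1(\mathbb{R}^d)$, writing $Z_NP_N(\mu_N\in A)=\int_{(\mathbb{R}^d)^N}\mathbf{1}_{\{\mu_N\in A\}}e^{-\beta_NH_N(x)}\,dx$, $$\limsup_{N\to\infty}\frac{\log Z_NP_N(\mu_N\in A)}{\beta_N}\leq-\inf_{\mu\in\mathrm{clo}(A)}I(\mu),$$ $$\liminf_{N\to\infty}\frac{\log Z_NP_N(\mu_N\in A)}{\beta_N}\geq-\inf\{I(\mu):\mu\in\mathrm{int}(A),\ \mu\ \text{absolutely continuous w.r.t. Lebesgue measure}\}.$$ (3) If moreover (H4) holds, then with $I_\star:=I-\inf_{\mathcal{M}_1(\mathbb{R}^d)}I$, for every Borel $A\subset\mathcal{M}_1(\mathbb{R}^d)$, $$-\inf_{\mu\in\mathrm{int}(A)}I_\star(\mu)\leq\liminf_{N\to\infty}\frac{\log P_N(\mu_N\in A)}{\beta_N}\leq\limsup_{N\to\infty}\frac{\log P_N(\mu_N\in A)}{\beta_N}\leq-\inf_{\mu\in\mathrm{clo}(A)}I_\star(\mu),$$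 and in particular $\lim_{N\to\infty}\beta_N^{-1}\log Z_N=\inf_{\mathcal{M}_1(\mathbb{R}^d)}I_\star$ (as printed in the paper). (4) The set $I_{\min}:=\{\mu\in\mathcal{M}_1(\mathbb{R}^d):I_\star(\mu)=0\}$ is nonempty, and if (H4) holds and the random configurations with laws $P_N$ are all defined on the same probability space, then almost surely $\lim_{N\to\infty}d_{\mathrm{FM}}(\mu_N,I_{\min})=0$.
   Context: $|\cdot|$ is the Euclidean norm. Hypotheses: (H1) $W$ is continuous on $\mathbb{R}^d\times\mathbb{R}^d$ (as a map into $(-\infty,+\infty]$), symmetric, finite off the diagonal $\{(x,x)\}$, and for every compact $K\subset\mathbb{R}^d$ the function $z\mapsto\sup\{W(x,y):|x-y|\geq|z|,\ x,y\in K\}$ is locally Lebesgue integrable on $\mathbb{R}^d$. (H2) $V$ is continuous, $V(x)\to+\infty$ as $|x|\to\infty$, and $\int_{\mathbb{R}^d}e^{-V(x)}dx<\infty$. (H3) There are $c\in\mathbb{R}$ and $\varepsilon_o\in(0,1)$ with $W(x,y)\geq c-\varepsilon_o(V(x)+V(y))$ for all $x,y$. (H4) For every probability measure $\nu$ with $I(\nu)<\infty$ there exist probability measures $\nu_n$ absolutely continuous w.r.t. Lebesgue measure with $\nu_n\to\nu$ weakly and $I(\nu_n)\to I(\nu)$. For $x=(x_1,\dots,x_N)\in(\mathbb{R}^d)^N$, $\mu_N:=\frac1N\sum_{i=1}^N\delta_{x_i}$ and $H_N(x):=\frac1N\sum_iV(x_i)+\frac1{N^2}\sum_{i<j}W(x_i,x_j)$.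 Under (H2),(H3) there is $N_0$ such that $Z_N:=\int e^{-\beta_NH_N(x)}dx<\infty$ for $N\geq N_0$; then $P_N$ is the probability measure on $(\mathbb{R}^d)^N$ with density $e^{-\beta_NH_N}/Z_N$, and $\mu_N$ is regarded as a random element of $\mathcal{M}_1(\mathbb{R}^d)$ (probability measures on $\mathbb{R}^d$) under $P_N$. $I(\mu):=\frac12\iint(V(x)+V(y)+W(x,y))\,d\mu(x)d\mu(y)\in(-\infty,+\infty]$. $\mathcal{M}_1(\mathbb{R}^d)$ carries the weak topology (duality with bounded continuous functions), with interior $\mathrm{int}$ and closure $\mathrm{clo}$; it is metrized by the Fortet–Mourier distance $d_{\mathrm{FM}}(\mu,\nu)=\sup\{\int f\,d\mu-\int f\,d\nu:\ \sup|f|\leq1,\ \sup_{x\neq y}|f(x)-f(y)|/|x-y|\leq1\}$, and $d_{\mathrm{FM}}(\mu,S)=\inf_{\nu\in S}d_{\mathrm{FM}}(\mu,\nu)$.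
   Formalization: The printed limit of log Z_N / β_N, inf I_⋆ (which is 0), is false in general (e.g. W=0, V=|x|²+1 gives −1); it is corrected to −inf I. In (H1) local integrability is required only of the positive part of the supremum, since the set is empty for large |z|. *)

(* Defs.v *)
From HB Require Import structures.
From mathcomp Require Import all_boot all_order all_algebra.
From mathcomp Require Import all_classical all_reals all_analysis.

Set Implicit Arguments.
Unset Strict Implicit.
Unset Printing Implicit Defensive.

Import Order.TTheory GRing.Theory Num.Theory.
Import numFieldNormedType.Exports.
Local Open Scope classical_set_scope.
Local Open Scope ring_scope.

(* Iterated integral over n.-tuple T, given an integral functional on T:
   tint iT n f = iT (fun x1 => iT (fun x2 => ... f [x1; x2; ...; xn])). *)
Fixpoint tint (R : realType) (T : Type) (iT : (T -> \bar R) -> \bar R) (n : nat)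
  : (n.-tuple T -> \bar R) -> \bar R :=
  match n return (n.-tuple T -> \bar R) -> \bar R with
  | 0 => fun f => f [tuple]
  | n'.+1 => fun f => iT (fun x => tint iT (fun t => f (cons_tuple x t)))
  end.

Section Defs.
Context (R : realType) (d : nat).
Local Notation Rd := (d.-tuple R).

Definition edist (x y : Rd) : R :=
  Num.sqrt (\sum_(i < d) (tnth x i - tnth y i) ^+ 2).
Definition enorm (x : Rd) : R := Num.sqrt (\sum_(i < d) (tnth x i) ^+ 2).

Definition Ropen (U : set Rd) : Prop :=
  forall x, U x -> exists2 e : R, 0 < e & [set y | edist x y < e] `<=` U.
Definition Rcompact (K : set Rd) : Prop :=
  forall (I : Type) (U : I -> set Rd), (forall i, Ropen (U i)) ->
    K `<=` \bigcup_i U i ->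
    exists2 J : set I, finite_set J & K `<=` \bigcup_(i in J) U i.
Definition Rcontinuous (f : Rd -> R) : Prop :=
  forall x (e : R), 0 < e -> exists2 del : R, 0 < del &
    forall y, edist x y < del -> `|f y - f x| < e.
Definition nbhs2 (p : Rd * Rd) : set_system (Rd * Rd) :=
  filter_from [set e : R | 0 < e]
    (fun e => [set q | edist p.1 q.1 < e /\ edist p.2 q.2 < e]).
Definition econtinuous2 (W : Rd -> Rd -> \bar R) : Prop :=
  forall p : Rd * Rd, (fun q => W q.1 q.2) @ nbhs2 p --> W p.1 p.2.

(* Lebesgue integral on R^d (of nonnegative functions), as iterated integral
   w.r.t. the Lebesgue measure on R, and Lebesgue measure of sets of R^d *)
Definition Rd_int (f : Rd -> \bar R) : \bar R :=
  tint (fun g : R -> \bar R => (\int[lebesgue_measure]_x g x)%E) f.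
Definition lebRd (B : set Rd) : \bar R := Rd_int (fun x => (\1_B x)%:E).
Definition conf_int (N : nat) (f : N.-tuple Rd -> \bar R) : \bar R :=
  tint Rd_int f.

Definition M1 := probability Rd R.

Definition abscont (mu : M1) : Prop :=
  forall B, measurable B -> lebRd B = 0%E -> mu B = 0%E.

Definition pint (mu : M1) (f : Rd -> R) : R := fine (\int[mu]_x (f x)%:E)%E.

Definition bcont (f : Rd -> R) : Prop :=
  Rcontinuous f /\ exists M : R, forall x, `|f x| <= M.

Definition wopen (U : set M1) : Prop :=
  forall mu, U mu -> exists (n : nat) (f : 'I_n -> Rd -> R) (e : R),
    [/\ forall i, bcont (f i), 0 < e &
        [set nu | forall i, `|pint nu (f i) - pint mu (f i)| < e] `<=` U].
Definition wclosed (S : set M1) : Prop := wopen (~` S).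
Definition winterior (A : set M1) : set M1 :=
  [set mu | exists U, [/\ wopen U, U mu & U `<=` A]].
Definition wclosure (A : set M1) : set M1 :=
  [set mu | forall U, wopen U -> U mu -> U `&` A !=set0].
Definition wcompact (S : set M1) : Prop :=
  forall (I : Type) (U : I -> set M1), (forall i, wopen (U i)) ->
    S `<=` \bigcup_i U i ->
    exists2 J : set I, finite_set J & S `<=` \bigcup_(i in J) U i.
Definition wborel (A : set M1) : Prop := <<s wopen >> A.
Definition wconv (nus : nat -> M1) (nu : M1) : Prop :=
  forall f, bcont f -> (fun n => pint (nus n) f) @ \oo --> (pint nu f : R).

Definition FMclass (f : Rd -> R) : Prop :=
  (forall x, `|f x| <= 1) /\ (forall x y, `|f x - f y| <= edist x y).
Definition dFM (mu nu : M1) : R :=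
  sup [set pint mu f - pint nu f | f in FMclass].
Definition dFMset (mu : M1) (S : set M1) : R := inf [set dFM mu nu | nu in S].

(* empirical measure (1/N) sum_i delta_{x_i}  (N >= 1) *)
Definition x0 : Rd := [tuple of nseq d 0].
Definition empN (N : nat) (x : N.-tuple Rd) : M1 :=
  mnormalize (msum (fun i => @dirac _ Rd (nth x0 x i) R) N) (@dirac _ Rd x0 R).

Section Model.
Variables (V : Rd -> R) (W : Rd -> Rd -> \bar R) (beta : nat -> R).

Definition HN (N : nat) (x : N.-tuple Rd) : \bar R :=
  ((N%:R^-1 * \sum_(i < N) V (tnth x i))%:E +
   (N%:R ^- 2)%:E * \sum_(i < N) \sum_(j < N | (i < j)%N) W (tnth x i) (tnth x j))%E.
Definition weight (N : nat) (x : N.-tuple Rd) : \bar R :=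
  expeR (- ((beta N)%:E * HN x))%E.
Definition ZN (N : nat) : \bar R := conf_int (@weight N).
Definition ZPN (N : nat) (A : set M1) : \bar R :=
  conf_int (fun x => (\1_(@empN N @^-1` A) x)%:E * weight x)%E.
Definition PN (N : nat) (A : set M1) : \bar R :=
  (ZPN N A * ((fine (ZN N))^-1)%:E)%E.
Definition ZlawN (N : nat) (B : set (N.-tuple Rd)) : \bar R :=
  conf_int (fun x => (\1_B x)%:E * weight x)%E.

Definition Ifun (mu : M1) : \bar R :=
  ((2^-1)%:E * \int[mu]_x \int[mu]_y ((V x + V y)%:E + W x y))%E.
Definition Iinf : \bar R := ereal_inf (range Ifun).
Definition Istar (mu : M1) : \bar R := (Ifun mu - Iinf)%E.
Definition Imin : set M1 := [set mu | Istar mu = 0%E].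

Definition H1 : Prop :=
  [/\ econtinuous2 W,
      (forall x y, W x y = W y x),
      (forall x y, W x y != -oo%E),
      (forall x y, x != y -> W x y \is a fin_num) &
      (forall K, Rcompact K -> forall C, Rcompact C ->
         (Rd_int (fun z => (\1_C z)%:E *
            maxe (ereal_sup [set W p.1 p.2 | p in
                   [set p : Rd * Rd | [/\ K p.1, K p.2 & (enorm z <= edist p.1 p.2)%R]]])
                 0) < +oo)%E)].
Definition H2 : Prop :=
  [/\ Rcontinuous V,
      (forall M : R, exists r : R, forall x, r < enorm x -> M < V x) &
      (Rd_int (fun x => (expR (- V x))%:E) < +oo)%E].
Definition H3 : Prop :=
  exists (c eps : R), 0 < eps < 1 /\
    forall x y, ((c - eps * (V x + V y))%:E <= W x y)%E.
Definition H4 : Prop :=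
  forall nu : M1, (Ifun nu < +oo)%E -> exists nus : nat -> M1,
    [/\ forall n, abscont (nus n), wconv nus nu &
        (fun n => Ifun (nus n)) @ \oo --> Ifun nu].

End Model.
End Defs.

(* Main.v *)
(** Write [V + v0 >= 0] and [G x y = V x + V y + W x y - b].  By (H3), for suitable [v0] and [b],
    [G x y >= a (V x + v0 + (V y + v0))] with [a > 0]; the energy [E mu = \iint G dmu dmu]
    satisfies [I = (E + b) / 2], and it is lower semicontinuous since [G] is the supremum of bounded
    Lipschitz minorants (Moreau-Yosida inf-convolution).  Sublevel sets of [E] are tight, hence
    compact: the limit of an ultrafilter of tight measures is a positive linear functional
    satisfying Dini's property, which Riesz' theorem turns into a probability measure.

    Upper bound: on a closed set where [E > m], compactness gives one bounded Lipschitz minorant of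
    [G] with energy [> m] away from large values of [\int V dmu], so that
    [beta_N H_N >= beta_N (m + b) / 2 - o(beta_N)] there; a negligible fraction of the confinement
    is kept aside to integrate over the configurations, which costs only [exp (O(N))].

    Lower bound, without entropy: truncating the density of an absolutely continuous [mu] gives
    [nu] with [E nu] close to [E mu] and [nu <= K Leb].  Then integrals over configurations
    dominate [K^-N] times expectations under the product [nu^N], and [K^N = exp (o(beta_N))].  Under
    [nu^N], Chebyshev's inequality puts [mu_N] in a given weak neighbourhood of [nu], and Markov's
    inequality controls [H_N], whose expectation is asymptotically [I nu].

    The uniform law on the unit cube has finite energy, by (H1) and translation invariance, so that
    [inf I] is finite.  The almost sure convergence is Borel-Cantelli applied to the closed sets
    [d_FM(mu, I_min) >= 1 / (k + 1)], on which [I] minus its infimum is bounded away from [0]. *)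

Require Import Defs.
From HB Require Import structures.
From mathcomp Require Import all_boot all_order all_algebra.
From mathcomp Require Import all_classical all_reals all_analysis.
From mathcomp Require Import measurable_realfun ring lra.
(* [edist] would otherwise be that of MathComp-Analysis. *)
Import Defs.
Set Implicit Arguments.
Unset Strict Implicit.
Unset Printing Implicit Defensive.
Import Order.TTheory GRing.Theory Num.Theory.
Import numFieldNormedType.Exports.
Local Open Scope classical_set_scope.
Local Open Scope ring_scope.

(** * Iterated integrals as integrals against power measures *)

(** [W] may be [+oo] on the diagonal, so [H_N] cannot be read off [I(mu_N)], whose double integral
    includes the diagonal. The upper bound therefore goes through minorants of [G] bounded by [n],
    for which the diagonal costs only [n / N] after division by [N ^ 2]; the lower bound averages
    over independent points, where only pairs [i < j] occur. Making [G] nonnegative lets Tonelli and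
    monotone convergence apply with [+oo] as a harmless value.

    The event that [mu_N] lies in a Borel set [A] is not shown to be measurable, and [ZPN] is an
    iterated integral with no measure on configurations behind it. Integrals of nonnegative
    functions, being suprema over simple functions below them, are monotone on all such functions.
    Hence [A] is compared with its closure from above and with a measurable event from below, and
    power measures enter only where additivity is needed.

    Entropy is of order [N] and energy of order [beta_N], which is much larger: every factor [C ^ N]
    is negligible, so a bounded density is as good as a uniform one. *)

Section integral_basics.
Local Open Scope ereal_scope.
Context d (T : measurableType d) (R : realType).

(** A simple function below [f] is also below [g], and the integral is the supremum over such
    functions; this covers arbitrary nonnegative integrands. *)
Lemma ge0_le_integral_any (m : {measure set T -> \bar R}) (f g : T -> \bar R) :
  (forall x, 0 <= f x) -> (forall x, f x <= g x) ->
  \int[m]_x f x <= \int[m]_x g x.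
Proof.
move=> f0 fg; have g0 x : 0 <= g x by exact: le_trans (f0 x) (fg x).
rewrite !ge0_integralTE//; apply: ge_ereal_sup => _ [h /= hf <-].
by apply: ereal_sup_ubound; exists h => // x; exact: le_trans (hf x) (fg x).
Qed.

Lemma countable_base_measurable (I : countType) (B : I -> set T) (U : set T) :
  (forall i, measurable (B i)) ->
  (forall x, U x -> exists2 i, B i x & B i `<=` U) -> measurable U.
Proof.
move=> mB HU.
have -> : U = \bigcup_i (if `[< B i `<=` U >] then B i else set0).
  apply/seteqP; split => [x /HU[i ix iU]|x [i _]].
    by exists i => //; case: asboolP.
  by case: asboolP => // iU; exact: iU.
by apply: countable_bigcupT_measurable => // i; case: asboolP.
Qed.

End integral_basics.

Section tuple_power.
Local Open Scope ereal_scope.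
Context d (T : measurableType d) (R : realType).

Let tcons n (z : T * n.-tuple T) : n.+1.-tuple T := cons_tuple z.1 z.2.

Let measurable_tcons n : measurable_fun setT (@tcons n).
Proof. exact: (measurable_cons measurable_fst measurable_snd). Qed.

Lemma measurable_cons_tuple (n : nat) (x : T) :
  measurable_fun setT (fun t : n.-tuple T => cons_tuple x t).
Proof. exact: (measurable_cons (measurable_cst x) (@measurable_id _ _ setT)). Qed.

Section pushforward_cons.
Variables (n : nat) (m : {sigma_finite_measure set T -> \bar R})
  (p : {sigma_finite_measure set (n.-tuple T) -> \bar R}).

HB.instance Definition _ := isMeasurableFun.Build _ _ _ _ (@tcons n) (@measurable_tcons n).
Let q : set (n.+1.-tuple T) -> \bar R := pushforward (m \x p) (@tcons n).
HB.instance Definition _ := Measure.copy q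
  (measure_function_pushforward__canonical__measure_function_Measure (m \x p) (@measurable_tcons n)).

Let q_sigma_finite : sigma_finite setT q.
Proof.
have /sigma_finiteP[F [TF ndF Foo]] := sigma_finiteT m.
have /sigma_finiteP[G [TG ndG Goo]] := sigma_finiteT p.
pose g1 (t : n.+1.-tuple T) : T := tnth t ord0.
pose g2 (t : n.+1.-tuple T) : n.-tuple T := [tuple of behead t].
have mg1 : measurable_fun setT g1 by exact: measurable_tnth.
have mg2 : measurable_fun setT g2 by exact: measurable_behead.
(* Both exhaustions increase, so a tuple lies in the set of index [maxn i j]. *)
exists (fun k => g1 @^-1` F k `&` g2 @^-1` G k).
  apply/esym; rewrite -subTset => t _.
  have [i _ Fi] : (\bigcup_i F i) (g1 t) by rewrite -TF.
  have [j _ Gj] : (\bigcup_i G i) (g2 t) by rewrite -TG.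
  exists (maxn i j) => //; split.
    by have /subsetPset := ndF _ _ (leq_maxl i j); exact.
  by have /subsetPset := ndG _ _ (leq_maxr i j); exact.
move=> k; have [mF Fk] := Foo k; have [mG Gk] := Goo k; split.
  apply: measurableI; rewrite -[X in measurable X]setTI; [exact: mg1|exact: mg2].
rewrite /q /pushforward.
rewrite [X in (m \x p) X](_ : _ = F k `*` G k).
  by rewrite product_measure1E// lte_mul_pinfty// ge0_fin_numE.
apply/seteqP; split=> -[x t]; rewrite /g1 /g2 /tcons /preimage/= tnth0/=;
  by have -> : [tuple of behead (cons_tuple x t)] = t by exact: val_inj.
Qed.

HB.instance Definition _ := Measure_isSigmaFinite.Build _ _ _ q q_sigma_finite.

Lemma pushforward_consP : exists q : {sigma_finite_measure set (n.+1.-tuple T) -> \bar R},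
  forall f : n.+1.-tuple T -> \bar R, measurable_fun setT f -> (forall x, 0 <= f x) ->
  \int[q]_t f t = \int[m]_x \int[p]_t f (cons_tuple x t).
Proof.
exists q => f mf f0.
have f0' : {in setT, forall y, 0 <= f y} by move=> ? _.
rewrite (ge0_integral_pushforward (@measurable_tcons n) _ measurableT mf f0') preimage_setT.
rewrite fubini_tonelli1//.
  exact: (measurableT_comp mf (@measurable_tcons n)).
by move=> z; exact: f0.
Qed.

End pushforward_cons.

(** One measure has to serve every functional [iT] that agrees with [m] on nonnegative measurable
    functions: [iT] is a Lebesgue integral over another measurable type in [Rd_int], and [Rd_int]
    itself in [conf_int]. By Tonelli the inner integrals stay measurable, so [iT] only meets
    functions on which it is known. *)
Lemma tuple_power_exists (m : {sigma_finite_measure set T -> \bar R}) n :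
  exists p : {sigma_finite_measure set (n.-tuple T) -> \bar R},
  forall iT : (T -> \bar R) -> \bar R,
  (forall f : T -> \bar R, measurable_fun setT f -> (forall x, 0 <= f x) -> iT f = \int[m]_x f x) ->
  forall f : n.-tuple T -> \bar R, measurable_fun setT f -> (forall x, 0 <= f x) ->
  tint iT f = \int[p]_t f t.
Proof.
elim: n => [|n [p IH]].
  exists (@dirac _ (0.-tuple T) [tuple] R) => iT iTE f mf f0 /=.
  by rewrite integral_dirac// diracT mul1e.
have [q qE] := pushforward_consP m p.
exists q => iT iTE f mf f0 /=; rewrite qE//.
have E x : tint iT (fun t => f (cons_tuple x t)) = \int[p]_t f (cons_tuple x t).
  by apply: IH => //; apply: measurableT_comp => //; exact: measurable_cons_tuple.
rewrite (_ : (fun x => _) = fun x => \int[p]_t f (cons_tuple x t)).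
  rewrite iTE//.
    exact: (measurable_fun_fubini_tonelli_F (m2 := p) (f \o @tcons n)
      (measurableT_comp mf (@measurable_tcons n)) (fun=> f0 _)).
  by move=> x; exact: integral_ge0.
by apply/funext => x; exact: E.
Qed.

Definition tuple_power (m : {sigma_finite_measure set T -> \bar R}) n :
  {sigma_finite_measure set (n.-tuple T) -> \bar R} := sval (cid (tuple_power_exists m n)).

Lemma tint_tuple_power (m : {sigma_finite_measure set T -> \bar R})
    (iT : (T -> \bar R) -> \bar R) n (f : n.-tuple T -> \bar R) :
  (forall f : T -> \bar R, measurable_fun setT f -> (forall x, 0 <= f x) -> iT f = \int[m]_x f x) ->
  measurable_fun setT f -> (forall x, 0 <= f x) ->
  tint iT f = \int[tuple_power m n]_t f t.
Proof. by move=> h; exact: (svalP (cid (tuple_power_exists m n)) iT h). Qed.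

End tuple_power.

(** * Order and product formulas for iterated integrals *)

Section tint.
Local Open Scope ereal_scope.
Context (T : Type) (R : realType) (iT : (T -> \bar R) -> \bar R).

Lemma tint_ge0 n (f : n.-tuple T -> \bar R) :
  (forall f, (forall x, 0 <= f x) -> 0 <= iT f) -> (forall x, 0 <= f x) -> 0 <= tint iT f.
Proof. by move=> iT0; elim: n f => [|n IH] f f0 //=; apply: iT0 => x; exact: IH. Qed.

Hypothesis iT_ge0 : forall f, (forall x, 0 <= f x) -> 0 <= iT f.
Hypothesis le_iT : forall f g, (forall x, 0 <= f x) -> (forall x, f x <= g x) -> iT f <= iT g.

Lemma le_tint n (f g : n.-tuple T -> \bar R) :
  (forall x, 0 <= f x) -> (forall x, f x <= g x) -> tint iT f <= tint iT g.
Proof.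
elim: n f g => [|n IH] f g f0 fg //=; apply: le_iT => x; last exact: IH.
exact: tint_ge0.
Qed.

(** The constant [k] collects the factors of the coordinates already fixed, which is what the
    induction needs. *)
Lemma tint_prod n (u : T -> R) (k c : R) : (0 <= k)%R -> (forall x, (0 <= u x)%R) ->
  (forall k, (0 <= k)%R -> iT (fun x => (k * u x)%:E) = (k * c)%:E) ->
  tint iT (fun t : n.-tuple T => (k * \prod_(i < n) u (tnth t i))%:E) = (k * c ^+ n)%:E.
Proof.
move=> k0 u0 iTu; elim: n k k0 => [|n IH] k k0 /=; first by rewrite big_ord0 expr0.
have c0 : (0 <= c)%R.
  have := iTu _ ler01; rewrite mul1r => E; rewrite -lee_fin -E.
  by apply: iT_ge0 => x; rewrite lee_fin mul1r.
under eq_fun => x.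
  under eq_fun => t.
    rewrite big_ord_recl tnth0 mulrA.
    under eq_bigr do rewrite tnthS.
    over.
  rewrite IH ?mulr_ge0// mulrAC; over.
by rewrite iTu ?mulr_ge0 ?exprn_ge0// -mulrA -exprSr.
Qed.

End tint.

(** * Euclidean space *)

Section ultra_compactness.

Lemma ultra_fmap (T U : Type) (f : T -> U) (G : set_system T) :
  UltraFilter G -> UltraFilter (f @ G).
Proof.
move=> UG; have PG : ProperFilter G by exact: ultra_proper.
split; first exact: fmap_proper_filter.
move=> H PH GH; apply/seteqP; split => // A HA.
have [//|GnA] := in_ultra_setVsetC (f @^-1` A) UG.
have HnA : H (~` A) by exact: GH.
have : H (A `&` ~` A) by exact: filterI.
by rewrite setICr => /filter_ex[].
Qed.

(** Without a finite subcover, the sets left uncovered by finite subfamilies generate a proper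
    filter; an ultrafilter above it would contain both a member of the cover around its limit and
    the complement of that member. The family [op] is arbitrary so that the lemma serves [Ropen] and
    [wopen] alike. *)
Lemma ultra_cover_compact (T : Type) (op : set T -> Prop) (S : set T) :
  (forall G, UltraFilter G -> G S ->
     exists x, S x /\ forall U, op U -> U x -> G U) ->
  forall (I : Type) (U : I -> set T), (forall i, op (U i)) ->
    S `<=` \bigcup_i U i ->
    exists2 J : set I, finite_set J & S `<=` \bigcup_(i in J) U i.
Proof.
move=> HS I U opU SU; apply: contrapT => noJ.
pose B (J : set I) := S `\` \bigcup_(i in J) U i.
have B0 J : finite_set J -> B J !=set0.
  move=> fJ; apply: contrapT => BJ0; apply: noJ; exists J => // x Sx.
  by apply: contrapT => nx; apply: BJ0; exists x.
have FF : ProperFilter (filter_from [set J | finite_set J] B).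
  apply: filter_from_proper => [|J /= fJ]; last exact: B0.
  apply: filter_from_filter => [|J K fJ fK]; first by exists set0; exact: finite_set0.
  exists (J `|` K); first by rewrite /= finite_setU.
  move=> x [Sx nx]; split; split=> //.
    by move=> [i Ji Ui]; apply: nx; exists i => //; left.
  by move=> [i Ji Ui]; apply: nx; exists i => //; right.
have [G [UG FG]] := ultraFilterLemma FF.
have GS : G S.
  by apply: FG; exists set0; [exact: finite_set0|move=> x []].
have [x [Sx Gx]] := HS G UG GS.
have [i _ Uix] := SU x Sx.
have GUi : G (U i) by exact: Gx.
have GnUi : G (~` U i).
  apply: FG; exists [set i]; first exact: finite_set1.
  by move=> y [_]; rewrite bigcup_set1.
have PG : ProperFilter G by exact: ultra_proper.
have : G (U i `&` ~` U i) by exact: filterI.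
by rewrite setICr => /filter_ex[].
Qed.

End ultra_compactness.

(** * Open sets are measurable when balls around a countable dense set are *)

Section countable_dense.
Context dT (T : measurableType dT) (R : realType) (Q : countType)
  (q : Q -> T) (dist : T -> T -> R).
Hypothesis dense : forall x e, 0 < e -> exists i, dist (q i) x < e.
Hypothesis triangle : forall i x y, dist x y <= dist (q i) x + dist (q i) y.
Hypothesis mball : forall i e, measurable [set y | dist (q i) y < e].

(** Balls of radius [1 / (k + 1)] around the points of [q] form a countable base. A bare function
    [dist] is used since the spaces will be points, pairs of points and configurations. *)
Lemma open_measurable (U : set T) :
  (forall x, U x -> exists2 e, 0 < e & forall y, dist x y < e -> U y) -> measurable U.
Proof.
move=> oU.
apply: (@countable_base_measurable _ _ (Q * nat)%type
  (fun i => [set y | dist (q i.1) y < i.2.+1%:R^-1])) => [i|x Ux]; first exact: mball.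
have [e e0 He] := oU x Ux.
have [k ke] : exists k : nat, k.+1%:R^-1 < e / 2.
  have e20 : 0 < e / 2 by lra.
  have [k _ hk] := near_infty_natSinv_lt (PosNum e20).
  by exists k; exact: (hk k (leqnn k)).
have [i qi] := dense x (ltac:(rewrite invr_gt0 ltr0n//) : 0 < k.+1%:R^-1 :> R).
exists (i, k) => //= y /= iy; apply: He.
apply: le_lt_trans (triangle i x y) _.
by rewrite (splitr e); apply: ltrD; apply: lt_trans ke.
Qed.

End countable_dense.

Section euclidean_space.
Context (R : realType) (d : nat).
Local Notation Rd := (d.-tuple R).
Implicit Types (x y z : Rd) (e : R).

Lemma sum_sqr_ge0 (a : 'I_d -> R) : 0 <= \sum_(i < d) a i ^+ 2.
Proof. by apply: sumr_ge0 => i _; exact: sqr_ge0. Qed.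

Lemma cauchy_schwarz_sum (a b : 'I_d -> R) :
  (\sum_(i < d) a i * b i) ^+ 2 <= (\sum_(i < d) a i ^+ 2) * (\sum_(i < d) b i ^+ 2).
Proof.
set A := \sum_(i < d) a i ^+ 2; set B := \sum_(i < d) b i ^+ 2; set C := \sum_(i < d) _.
have B0 : 0 <= B by exact: sum_sqr_ge0.
have [Bgt|Ble] := ltP 0 B.
  have : 0 <= \sum_(i < d) (B * a i - C * b i) ^+ 2 by exact: sum_sqr_ge0.
  have -> : \sum_(i < d) (B * a i - C * b i) ^+ 2 = B * (A * B - C ^+ 2).
    transitivity (B ^+ 2 * A - 2 * B * C * C + C ^+ 2 * B); last by ring.
    have -> : B ^+ 2 * A = \sum_(i < d) B ^+ 2 * a i ^+ 2 by rewrite mulr_sumr.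
    have -> : 2 * B * C * C = \sum_(i < d) 2 * B * C * (a i * b i) by rewrite -mulr_sumr.
    have -> : C ^+ 2 * B = \sum_(i < d) C ^+ 2 * b i ^+ 2 by rewrite mulr_sumr.
    rewrite -sumrB -big_split/=.
    by apply: eq_bigr => i _; ring.
  by rewrite pmulr_rge0// subr_ge0.
have B00 : B = 0 by apply/eqP; rewrite eq_le Ble B0.
have b0 i : b i = 0.
  apply/eqP; rewrite -sqrf_eq0; move/eqP: B00; rewrite psumr_eq0; last by move=> *; exact: sqr_ge0.
  by move=> /allP/(_ i (mem_index_enum _)).
have -> : C = 0 by rewrite /C big1// => i _; rewrite b0 mulr0.
by rewrite expr0n/= B00 mulr0.
Qed.

Lemma minkowski_sum (a b : 'I_d -> R) :
  Num.sqrt (\sum_(i < d) (a i + b i) ^+ 2) <=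
  Num.sqrt (\sum_(i < d) a i ^+ 2) + Num.sqrt (\sum_(i < d) b i ^+ 2).
Proof.
set A := \sum_(i < d) a i ^+ 2; set B := \sum_(i < d) b i ^+ 2.
have A0 : 0 <= A by exact: sum_sqr_ge0.
have B0 : 0 <= B by exact: sum_sqr_ge0.
rewrite -[leRHS]ger0_norm ?addr_ge0// -sqrtr_sqr ler_wsqrtr// sqrrD !sqr_sqrtr//.
set C := \sum_(i < d) a i * b i.
have -> : \sum_(i < d) (a i + b i) ^+ 2 = A + C *+ 2 + B.
  rewrite /A /B /C -sumrMnl -!big_split/=; apply: eq_bigr => i _; ring.
rewrite lerD2r lerD2l lerMn2r/= -sqrtrM//.
apply: le_trans (ler_norm _) _; rewrite -sqrtr_sqr ler_wsqrtr//.
exact: cauchy_schwarz_sum.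
Qed.

Lemma edistC x y : edist x y = edist y x.
Proof. by rewrite /edist; congr Num.sqrt; apply: eq_bigr => i _; rewrite -sqrrN opprB. Qed.

Lemma edistxx x : edist x x = 0.
Proof. by rewrite /edist big1 ?sqrtr0// => i _; rewrite subrr expr0n. Qed.

Lemma edist_ge0 x y : 0 <= edist x y. Proof. exact: sqrtr_ge0. Qed.

Lemma edist_triangle y x z : edist x z <= edist x y + edist y z.
Proof.
rewrite /edist; under eq_bigr => i _ do rewrite -(subrKA (tnth y i)).
exact: minkowski_sum.
Qed.

Lemma edist_lip z x y : `|edist x z - edist y z| <= edist x y.
Proof.
rewrite ler_norml; apply/andP; split.
  by rewrite lerNl opprB lerBlDr (edistC x y); exact: edist_triangle.
by rewrite lerBlDr; exact: edist_triangle.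
Qed.

Lemma le_edist_coord i x y : `|tnth x i - tnth y i| <= edist x y.
Proof.
rewrite -sqrtr_sqr ler_wsqrtr// (bigD1 i)//= lerDl.
by apply: sumr_ge0 => j _; exact: sqr_ge0.
Qed.

Lemma edist_le_sum x y : edist x y <= \sum_(i < d) `|tnth x i - tnth y i|.
Proof.
have s0 : 0 <= \sum_(i < d) `|tnth x i - tnth y i| by exact: sumr_ge0.
rewrite -[leRHS]ger0_norm// -sqrtr_sqr ler_wsqrtr//.
have : forall n (a : 'I_n -> R), (forall i, 0 <= a i) ->
    \sum_(i < n) a i ^+ 2 <= (\sum_(i < n) a i) ^+ 2.
  elim=> [|n IH] a a0; first by rewrite !big_ord0 expr0n.
  rewrite !big_ord_recr/= sqrrD; apply: lerD => //.
  rewrite -[leLHS]addr0; apply: lerD; first exact: IH.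
  by rewrite mulrn_wge0// mulr_ge0// sumr_ge0.
move=> /(_ d (fun i => `|tnth x i - tnth y i|) (fun=> normr_ge0 _)).
by under eq_bigr do rewrite real_normK ?num_real//.
Qed.

(** Dividing by [d.+1] keeps the sum of [d] terms strictly below [e], also when there are no
    terms. *)
Lemma edist_lt_coord x y e :
  (0 < e) -> (forall i, `|tnth x i - tnth y i| < e / d.+1%:R) -> edist x y < e.
Proof.
move=> e0 He; apply: le_lt_trans (edist_le_sum x y) _.
apply: (@le_lt_trans _ _ (\sum_(i < d) e / d.+1%:R)).
  by apply: ler_sum => i _; exact: ltW.
rewrite sumr_const card_ord.
have k0 : 0 < e / d.+1%:R by rewrite divr_gt0.
rewrite -[ltRHS](@divfK _ d.+1%:R) ?pnatr_eq0// mulr_natr (mulrS (e / _)).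
by rewrite ltrDr.
Qed.

Definition ratpt (q : d.-tuple rat) : Rd := map_tuple ratr q.

Lemma ratpt_dense x e : 0 < e -> exists q, edist (ratpt q) x < e.
Proof.
move=> e0.
have h i : exists r : rat, `|ratr r - tnth x i| < e / d.+1%:R.
  have e0' : 0 < e / d.+1%:R by rewrite divr_gt0// ltr0n.
  move: (e / _) e0' => del del0.
  have [r /=] := @rat_in_itvoo R (tnth x i - del) (tnth x i + del) ltac:(lra).
  rewrite in_itv/= => /andP[r1 r2]; exists r; rewrite ltr_distl; apply/andP; split; lra.
have [f hf] := choice h.
exists [tuple f i | i < d]; apply: edist_lt_coord => // i.
by rewrite tnth_map tnth_mktuple.
Qed.

Lemma measurable_edist z : measurable_fun setT (edist z : Rd -> R).
Proof.
have msqrt : measurable_fun setT (@Num.sqrt R).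
  by apply: continuous_measurable_fun; exact: sqrt_continuous.
have msum : measurable_fun setT (fun x : Rd => \sum_(i < d) (tnth z i - tnth x i) ^+ 2).
  apply: measurable_sum => i; apply: measurable_funX; apply: measurable_funB => //.
  exact: measurable_tnth.
exact: (measurableT_comp msqrt msum).
Qed.

Lemma measurable_edist_ball z e : measurable [set y | edist z y < e].
Proof.
rewrite -[X in measurable X]setTI; apply: measurable_fun_ltr => //.
exact: measurable_edist.
Qed.

Lemma Ropen_measurable (U : set Rd) : Ropen U -> measurable U.
Proof.
apply: (@open_measurable _ _ _ _ ratpt (@edist R d)).
- exact: ratpt_dense.
- by move=> i x y; rewrite [edist (ratpt i) x]edistC; exact: edist_triangle.
- move=> i e; exact: measurable_edist_ball.
Qed.

Lemma Ropen_preimage (f : Rd -> R) (A : set R) : Rcontinuous f -> open A -> Ropen (f @^-1` A).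
Proof.
move=> cf oA x /= Ax.
have /nbhs_ballP[e /= e0 He] : nbhs (f x) A by exact: open_nbhs_nbhs.
have [del del0 Hdel] := cf x e e0.
exists del => // y /= xy; apply: He; rewrite /ball/= distrC; exact: Hdel.
Qed.

Lemma Rcontinuous_measurable (f : Rd -> R) : Rcontinuous f -> measurable_fun setT f.
Proof.
move=> cf; apply: (measurability _ (RGenOInfty.measurableE R)) => _ [_ [a ->] <-].
rewrite setTI; apply: Ropen_measurable; exact: Ropen_preimage.
Qed.

(** Along an ultrafilter each coordinate converges in the segment [[- r, r]], and finitely many
    coordinates control [edist]. *)
Lemma cube_compact (r : R) : @Rcompact R d [set x : Rd | forall i, `|tnth x i| <= r].
Proof.
apply: ultra_cover_compact => G UG GS.
have PG : ProperFilter G by exact: ultra_proper.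
have h i : exists a : R, `|a| <= r /\ (fun x : Rd => tnth x i) @ G --> a.
  have := @segment_compact R (- r) r; rewrite compact_ultra => /(_ ((fun x : Rd => tnth x i) @ G)).
  case.
  - exact: ultra_fmap.
  - rewrite /= /nbhs/=; apply: filterS GS => x /= /(_ i); by rewrite in_itv/= ler_norml.
  - move=> a [/=]; rewrite in_itv/= -ler_norml => ar aG; by exists a.
have [f hf] := choice h.
exists [tuple f i | i < d]; split; first by move=> i; rewrite tnth_mktuple; exact: (hf i).1.
move=> U oU /oU[e e0 He].
have : G (fun y => forall i, `|f i - tnth y i| < e / d.+1%:R).
  apply: filter_forall => i.
  have e0' : 0 < e / d.+1%:R by rewrite divr_gt0// ltr0n.
  have /cvgrPdist_lt/(_ _ e0') := (hf i).2.
  exact.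
apply: filterS => y Hy; apply: He => /=; apply: edist_lt_coord => // i.
by rewrite tnth_mktuple.
Qed.

End euclidean_space.

(** * Integrals of bounded functions *)

Section bounded_functions.
Context (R : realType) (d : nat).
Local Notation Rd := (d.-tuple R).
Implicit Types (f g : Rd -> R) (mu nu : M1 R d).

(** Since [pint] applies [fine], it is linear only where integrals are finite; this class ensures it
    for every probability measure and, unlike [bcont], contains indicators. *)
Definition bmeas f := measurable_fun setT f /\ exists M : R, forall x, `|f x| <= M.

Lemma bmeas_integrable mu f : bmeas f -> mu.-integrable setT (EFin \o f).
Proof.
move=> [mf [M fM]].
apply: (@le_integrable _ _ _ mu setT measurableT (EFin \o f) (EFin \o cst M)).
- exact/measurable_EFinP.
- move=> x _ /=; rewrite lee_fin; apply: le_trans (fM x) _; exact: ler_norm.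
- exact: finite_measure_integrable_cst.
Qed.

Lemma bmeas_cst (a : R) : bmeas (fun _ : Rd => a).
Proof. by split; [exact: measurable_cst|exists `|a|]. Qed.

Lemma bmeasD f g : bmeas f -> bmeas g -> bmeas (fun x => f x + g x).
Proof.
move=> [mf [M fM]] [mg [N gN]]; split; first exact: measurable_funD.
by exists (M + N) => x; apply: le_trans (ler_normD _ _) _; exact: lerD.
Qed.

Lemma bmeasZ (a : R) f : bmeas f -> bmeas (fun x => a * f x).
Proof.
move=> [mf [M fM]]; split; first exact: measurable_funM.
by exists (`|a| * M) => x; rewrite normrM ler_wpM2l.
Qed.

Lemma bmeasN f : bmeas f -> bmeas (fun x => - f x).
Proof.
move=> [mf [M fM]]; split; first exact: measurable_funN.
by exists M => x; rewrite normrN.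
Qed.

Lemma bmeasB f g : bmeas f -> bmeas g -> bmeas (fun x => f x - g x).
Proof. by move=> bf bg; apply: bmeasD => //; exact: bmeasN. Qed.

Lemma bmeas_norm f : bmeas f -> bmeas (fun x => `|f x|).
Proof.
move=> [mf [M fM]]; split; first exact: measurableT_comp.
by exists M => x; rewrite normr_id.
Qed.

Lemma bmeas_sum (I : Type) (s : seq I) (F : I -> Rd -> R) :
  (forall i, bmeas (F i)) -> bmeas (fun x => \sum_(i <- s) F i x).
Proof.
move=> bF; elim: s => [|i s IH].
  by under eq_fun do rewrite big_nil; exact: bmeas_cst.
by under eq_fun do rewrite big_cons; exact: bmeasD.
Qed.

Lemma pintE mu f : bmeas f -> (\int[mu]_x (f x)%:E)%E = (pint mu f)%:E.
Proof. by move=> bf; rewrite /pint fineK//; exact: integrable_fin_num (bmeas_integrable mu bf). Qed.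

Lemma pintD mu f g : bmeas f -> bmeas g ->
  pint mu (fun x => f x + g x) = pint mu f + pint mu g.
Proof. by move=> bf bg; apply: RintegralD => //; exact: bmeas_integrable. Qed.

Lemma pintB mu f g : bmeas f -> bmeas g ->
  pint mu (fun x => f x - g x) = pint mu f - pint mu g.
Proof. by move=> bf bg; apply: RintegralB => //; exact: bmeas_integrable. Qed.

Lemma pintZ mu (a : R) f : bmeas f -> pint mu (fun x => a * f x) = a * pint mu f.
Proof. by move=> bf; apply: RintegralZl => //; exact: bmeas_integrable. Qed.

Lemma pint_cst mu (a : R) : pint mu (fun=> a) = a.
Proof.
by rewrite /pint integral_cst//= -[RHS]mulr1 probability_setT mule1 mulr1.
Qed.

Lemma le_pint mu f g : bmeas f -> bmeas g -> (forall x, f x <= g x) -> pint mu f <= pint mu g.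
Proof. by move=> bf bg fg; apply: le_Rintegral => //; exact: bmeas_integrable. Qed.

Lemma pint_sum mu (I : Type) (s : seq I) (F : I -> Rd -> R) : (forall i, bmeas (F i)) ->
  pint mu (fun x => \sum_(i <- s) F i x) = \sum_(i <- s) pint mu (F i).
Proof.
move=> bF; elim: s => [|i s IH].
  by under eq_fun do rewrite big_nil; rewrite big_nil pint_cst.
under eq_fun do rewrite big_cons.
by rewrite big_cons pintD// ?IH//; exact: bmeas_sum.
Qed.

Lemma pint_norm_le mu f (M : R) : bmeas f -> (forall x, `|f x| <= M) -> `|pint mu f| <= M.
Proof.
move=> bf fM; rewrite ler_norml -{1}[M](pint_cst mu) -{2}[M](pint_cst mu) -[X in X <= _]mulN1r.
rewrite -pintZ; last exact: bmeas_cst.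
apply/andP; split; apply: le_pint => //; try exact: bmeas_cst.
- by move=> x; rewrite mulN1r; have := fM x; rewrite ler_norml => /andP[].
- by move=> x; have := fM x; rewrite ler_norml => /andP[].
Qed.

Lemma pint_cvg mu (F : nat -> Rd -> R) f (M : R) :
  (forall n, bmeas (F n)) -> bmeas f -> (forall n x, `|F n x| <= M) ->
  (forall x, F n x @[n --> \oo] --> f x) -> pint mu (F n) @[n --> \oo] --> pint mu f.
Proof.
move=> bF bf FM Ff.
have H : (\int[mu]_x (F n x)%:E)%E @[n --> \oo] --> (\int[mu]_x (f x)%:E)%E.
  have [] // := @dominated_convergence _ _ _ mu setT measurableT
    (fun n x => (F n x)%:E) (EFin \o f) (EFin \o cst M).
  - by move=> n; apply/measurable_EFinP; exact: (bF n).1.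
  - by apply/measurable_EFinP; exact: bf.1.
  - by apply: aeW => x _; apply: cvg_EFin; [exact: nearW|exact: Ff].
  - exact: finite_measure_integrable_cst.
  - by apply: aeW => x n _; rewrite lee_fin.
by apply: fine_cvg; move: H; rewrite (pintE mu bf).
Qed.

(** Expressing [Rcontinuous] as convergence along this filter gives access to the algebra of
    limits. *)
Definition Rnbhs (x : Rd) : set_system Rd :=
  filter_from [set e : R | 0 < e] (fun e => [set y | edist x y < e]).

Global Instance Rnbhs_filter x : Filter (Rnbhs x).
Proof.
apply: filter_from_filter; first by exists 1 => /=.
move=> e1 e2 /= e10 e20; exists (Num.min e1 e2); first by rewrite /= lt_min e10.
by move=> y /=; rewrite lt_min => /andP[].
Qed.

Lemma Rcontinuous_cvg f : Rcontinuous f <-> forall x, f y @[y --> Rnbhs x] --> f x.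
Proof.
split=> [cf x|cf x e e0].
  apply/cvgrPdist_lt => e e0; have [del del0 H] := cf x e e0.
  by exists del => // y /= xy; rewrite distrC; exact: H.
have /cvgrPdist_lt/(_ e e0)[del /= del0 H] := cf x.
by exists del => // y xy; rewrite distrC; exact: H.
Qed.

Lemma Rcontinuous_cst (a : R) : Rcontinuous (fun _ : Rd => a).
Proof. by apply/Rcontinuous_cvg => x; exact: cvg_cst. Qed.

Lemma RcontinuousD f g : Rcontinuous f -> Rcontinuous g -> Rcontinuous (fun x => f x + g x).
Proof.
by move=> /Rcontinuous_cvg cf /Rcontinuous_cvg cg; apply/Rcontinuous_cvg => x; exact: cvgD.
Qed.

Lemma RcontinuousN f : Rcontinuous f -> Rcontinuous (fun x => - f x).
Proof. by move=> /Rcontinuous_cvg cf; apply/Rcontinuous_cvg => x; exact: cvgN. Qed.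

Lemma RcontinuousM f g : Rcontinuous f -> Rcontinuous g -> Rcontinuous (fun x => f x * g x).
Proof.
by move=> /Rcontinuous_cvg cf /Rcontinuous_cvg cg; apply/Rcontinuous_cvg => x; exact: cvgM.
Qed.

Lemma Rcontinuous_norm f : Rcontinuous f -> Rcontinuous (fun x => `|f x|).
Proof. by move=> /Rcontinuous_cvg cf; apply/Rcontinuous_cvg => x; exact: cvg_norm. Qed.

Lemma bcont_bmeas f : bcont f -> bmeas f.
Proof. by move=> [cf bf]; split => //; exact: Rcontinuous_measurable. Qed.

Lemma bcont_cst (a : R) : bcont (fun _ : Rd => a).
Proof. by split; [exact: Rcontinuous_cst|exists `|a|]. Qed.

Lemma bcontD f g : bcont f -> bcont g -> bcont (fun x => f x + g x).
Proof.
move=> bf bg; split; first exact: RcontinuousD bf.1 bg.1.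
exact: (bmeasD (bcont_bmeas bf) (bcont_bmeas bg)).2.
Qed.

Lemma bcontN f : bcont f -> bcont (fun x => - f x).
Proof.
move=> bf; split; first exact: RcontinuousN bf.1.
exact: (bmeasN (bcont_bmeas bf)).2.
Qed.

Lemma bcontB f g : bcont f -> bcont g -> bcont (fun x => f x - g x).
Proof. by move=> bf bg; apply: bcontD => //; exact: bcontN. Qed.

Lemma bcontZ (a : R) f : bcont f -> bcont (fun x => a * f x).
Proof.
move=> bf; split; first by apply: RcontinuousM bf.1; exact: Rcontinuous_cst.
exact: (bmeasZ _ (bcont_bmeas bf)).2.
Qed.

Lemma bcont_norm f : bcont f -> bcont (fun x => `|f x|).
Proof.
move=> bf; split; first exact: Rcontinuous_norm bf.1.
exact: (bmeas_norm (bcont_bmeas bf)).2.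
Qed.

Lemma Rcontinuous_max f g : Rcontinuous f -> Rcontinuous g ->
  Rcontinuous (fun x => Num.max (f x) (g x)).
Proof.
move=> bf bg; under eq_fun do rewrite maxr_absE mulrC.
apply: RcontinuousM; first exact: Rcontinuous_cst.
apply: RcontinuousD; first exact: RcontinuousD.
by apply: Rcontinuous_norm; apply: RcontinuousD => //; exact: RcontinuousN.
Qed.

Lemma Rcontinuous_min f g : Rcontinuous f -> Rcontinuous g ->
  Rcontinuous (fun x => Num.min (f x) (g x)).
Proof.
move=> bf bg; under eq_fun do rewrite minr_absE mulrC.
apply: RcontinuousM; first exact: Rcontinuous_cst.
apply: RcontinuousD; first exact: RcontinuousD.
apply: RcontinuousN; apply: Rcontinuous_norm.
by apply: RcontinuousD => //; exact: RcontinuousN.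
Qed.

Lemma bcont_min f g : bcont f -> bcont g -> bcont (fun x => Num.min (f x) (g x)).
Proof.
move=> bf bg; under eq_fun do rewrite minr_absE mulrC.
by apply: bcontZ; apply: bcontB; [exact: bcontD|exact/bcont_norm/bcontB].
Qed.

Lemma bcont_sum (I : Type) (s : seq I) (F : I -> Rd -> R) :
  (forall i, bcont (F i)) -> bcont (fun x => \sum_(i <- s) F i x).
Proof.
move=> bF; elim: s => [|i s IH].
  by under eq_fun do rewrite big_nil; exact: bcont_cst.
by under eq_fun do rewrite big_cons; exact: bcontD.
Qed.

Lemma lipschitz_Rcontinuous f (L : R) :
  (forall x y, `|f x - f y| <= L * edist x y) -> Rcontinuous f.
Proof.
move=> fL x e e0.
have L1 : 0 < `|L| + 1 by apply: ltr_wpDl.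
exists (e / (`|L| + 1)); first by rewrite /= divr_gt0.
move=> y; rewrite ltr_pdivlMr// => xy.
rewrite distrC; apply: le_lt_trans (fL x y) _; apply: le_lt_trans xy.
rewrite mulrC ler_wpM2l ?edist_ge0//; apply: le_trans (ler_norm L) _; by rewrite lerDl.
Qed.

Lemma FMclass_bcont f : FMclass f -> bcont f.
Proof.
move=> [f1 fL]; split; last by exists 1.
by apply: (@lipschitz_Rcontinuous _ 1) => x y; rewrite mul1r.
Qed.

Lemma Rcontinuous_edist (z : Rd) : Rcontinuous (edist z).
Proof.
apply: (@lipschitz_Rcontinuous _ 1) => x y; rewrite mul1r.
by rewrite (edistC z x) (edistC z y); exact: edist_lip.
Qed.

(** A tent of height 2 rather than 1, so that it is still at least 1 at distance [del / 2] while
    vanishing from distance [del] on. *)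
Definition bump (z : Rd) (del : R) (x : Rd) : R := Num.max 0 (2 - 2 / del * edist z x).

Lemma bump_ge0 (z x : Rd) del : 0 <= bump z del x.
Proof. by rewrite /bump le_max lexx. Qed.

Lemma bump_bcont (z : Rd) del : 0 < del -> bcont (bump z del).
Proof.
move=> del0; split.
  apply: Rcontinuous_max; first exact: Rcontinuous_cst.
  apply: RcontinuousD; first exact: Rcontinuous_cst.
  apply: RcontinuousN; apply: RcontinuousM; first exact: Rcontinuous_cst.
  exact: Rcontinuous_edist.
exists 2 => x; rewrite ger0_norm ?bump_ge0// /bump ge_max ler0n/= gerBl.
by rewrite mulr_ge0 ?edist_ge0// divr_ge0// ltW.
Qed.

Lemma bump_ge1 (z x : Rd) del : 0 < del -> edist z x < del / 2 -> 1 <= bump z del x.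
Proof.
move=> del0 H; rewrite /bump le_max; apply/orP; right.
rewrite lerBrDl -lerBrDr; apply: (@le_trans _ _ (2 / del * (del / 2))).
  by rewrite ler_wpM2l ?divr_ge0 1?ltW.
by rewrite mulrA divfK ?gt_eqF// mulfV//; lra.
Qed.

Lemma bump_eq0 (z x : Rd) del : 0 < del -> del <= edist z x -> bump z del x = 0.
Proof.
move=> del0 H; rewrite /bump; apply/max_idPl; rewrite subr_le0.
by rewrite -{1}[2](@divfK _ del) ?gt_eqF// ler_wpM2l// divr_ge0// ltW.
Qed.

End bounded_functions.

(** * The weak topology *)

Section weak_topology.
Context (R : realType) (d : nat).
Local Notation Rd := (d.-tuple R).
Implicit Types (f g : Rd -> R) (mu nu : M1 R d) (U : set (M1 R d)).

(** The body is that of [wopen], so [wopenP] holds by conversion. *)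
Definition wnbhs mu : set_system (M1 R d) := [set U |
  exists (n : nat) (f : 'I_n -> Rd -> R) (e : R),
    [/\ forall i, bcont (f i), 0 < e &
        [set nu | forall i, `|pint nu (f i) - pint mu (f i)| < e] `<=` U]].

Global Instance wnbhs_filter mu : ProperFilter (wnbhs mu).
Proof.
split.
  move=> [n [f [e [_ e0]]]] /(_ mu) /=; apply => i.
  by rewrite subrr normr0.
split.
- exists 0, (fun=> cst 0), 1; split => // i; exact: bcont_cst.
- move=> A B [n [f [e [bf e0 fA]]]] [m [g [e' [bg e'0 gB]]]].
  exists (n + m)%N, (fun i => match fintype.split i with inl j => f j | inr k => g k end), (Num.min e e').
  split; first by move=> i; case: fintype.split => j.
    by rewrite lt_min e0.
  move=> nu /= H; split.
    apply: fA => i; have := H (lshift m i).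
    by rewrite (unsplitK (inl i)) lt_min => /andP[].
  apply: gB => i; have := H (rshift n i).
  by rewrite (unsplitK (inr i)) lt_min => /andP[].
- move=> A B AB [n [f [e [bf e0 fA]]]]; exists n, f, e; split => //.
  exact: subset_trans fA AB.
Qed.

Lemma wopenP U : wopen U <-> forall mu, U mu -> wnbhs mu U.
Proof. by []. Qed.

Lemma wclosed_wclosure (A : set (M1 R d)) : wclosed (wclosure A).
Proof.
apply/wopenP => mu /= nA.
have [U [oU [Um UA]]] : exists U, wopen U /\ U mu /\ ~ (U `&` A !=set0).
  apply: contrapT => h; apply: nA => U oU Um; apply: contrapT => UA.
  by apply: h; exists U.
apply: filterS (oU _ Um) => nu Un cn; apply: UA; exact: cn.
Qed.

Lemma subset_wclosure (A : set (M1 R d)) : A `<=` wclosure A.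
Proof. by move=> mu Am U _ Um; exists mu. Qed.

Lemma winterior_wnbhs (A : set (M1 R d)) mu : winterior A mu -> wnbhs mu A.
Proof. by move=> [U [oU Um UA]]; apply: filterS UA _; exact: oU. Qed.

Lemma wclosed_wcompact (K S : set (M1 R d)) : wcompact K -> wclosed S ->
  wcompact (K `&` S).
Proof.
move=> cK cS I U oU KSU.
(* The index [None] adds the complement of [S] to the cover, which then covers all of [K]. *)
have := cK (option I) (fun i => if i is Some j then U j else ~` S).
case.
- by case.
- move=> mu Km; have [Sm|nSm] := pselect (S mu); last by exists None.
  by have [i _ Ui] := KSU mu (conj Km Sm); exists (Some i).
- move=> J fJ KJ; exists (Some @^-1` J).
    by apply: finite_preimage fJ => ? ? _ _ [].
  move=> mu [Km Sm]; have [[i|] Ji Ui] := KJ mu Km; first by exists i.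
  by [].
Qed.

(** * Weak neighbourhoods are uniform over Fortet-Mourier functions *)

Section partition_of_unity.
Variables (q : nat -> Rd) (del : R).
Hypotheses (del0 : 0 < del) (q_dense : forall x e, 0 < e -> exists k, edist (q k) x < e).

(** Increments of partial sums of tents capped at 1 give a partition of unity without any division:
    they are nonnegative, telescope to [S n], and [phi k] vanishes at distance [del] or more from
    [q k]. *)
Let S n x := Num.min 1 (\sum_(k < n) bump (q k) del x).
Let phi k x := S k.+1 x - S k x.

Let S_bcont n : bcont (S n).
Proof.
apply: bcont_min; first exact: bcont_cst.
by apply: bcont_sum => i; exact: bump_bcont.
Qed.

Let phi_bcont k : bcont (phi k).
Proof. exact: bcontB. Qed.

Let S0 x : S 0 x = 0.
Proof. by rewrite /S big_ord0; apply/min_idPr. Qed.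

Let sum_phi n x : \sum_(k < n) phi k x = S n x.
Proof.
elim: n => [|n IH]; first by rewrite big_ord0 S0.
by rewrite big_ord_recr/= IH /phi addrC subrK.
Qed.

Let phi_ge0 k x : 0 <= phi k x.
Proof.
rewrite subr_ge0 /S big_ord_recr/= le_min; apply/andP; split.
  by rewrite ge_min lexx.
by rewrite ge_min orbC lerDl bump_ge0.
Qed.

Let S_le1 n x : S n x <= 1.
Proof. by rewrite ge_min lexx. Qed.

Let S_ge0 n x : 0 <= S n x.
Proof. by rewrite -sum_phi sumr_ge0. Qed.

Let phi_eq0 k x : del <= edist (q k) x -> phi k x = 0.
Proof. by move=> h; rewrite /phi /S big_ord_recr/= bump_eq0// addr0 subrr. Qed.

Let S_cvg1 x : S n x @[n --> \oo] --> (1 : R).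
Proof.
have [k qk] := q_dense x (divr_gt0 del0 (ltr0Sn R 1)).
apply: (@cvg_trans _ ((fun=> 1 : R) @ \oo)); last exact: cvg_cst.
apply: near_eq_cvg; exists k.+1 => // n /= kn.
apply/esym/min_idPl; rewrite (bigD1 (Ordinal kn))//= -[1]addr0.
apply: lerD; first exact: bump_ge1.
by apply: sumr_ge0 => j _; exact: bump_ge0.
Qed.

Let pintS_cvg1 mu : pint mu (S n) @[n --> \oo] --> (1 : R).
Proof.
rewrite -(pint_cst mu 1); apply: (pint_cvg (M := 1)) => //.
- by move=> n; exact: bcont_bmeas.
- exact: bmeas_cst.
- by move=> n x; rewrite ger0_norm.
Qed.

Let approx_error f n x : FMclass f ->
  `|f x - \sum_(k < n) f (q k) * phi k x| <= del + (1 - S n x).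
Proof.
move=> [f1 fL].
have -> : f x - \sum_(k < n) f (q k) * phi k x =
    \sum_(k < n) (f x - f (q k)) * phi k x + f x * (1 - S n x).
  under [in RHS]eq_bigr do rewrite mulrBl.
  by rewrite sumrB -mulr_sumr sum_phi; ring.
apply: le_trans (ler_normD _ _) _; apply: lerD; last first.
  rewrite normrM (@ger0_norm _ (1 - _)) ?subr_ge0//.
  by apply: le_trans (ler_wpM2r _ (f1 x)) _; rewrite ?subr_ge0// mul1r.
apply: le_trans (ler_norm_sum _ _ _) _.
apply: (@le_trans _ _ (\sum_(k < n) del * phi k x)); last first.
  by rewrite -mulr_sumr sum_phi -{2}[del]mulr1 ler_wpM2l// ltW.
apply: ler_sum => k _; rewrite normrM (ger0_norm (phi_ge0 _ _)).
have [h|h] := leP del (edist (q k) x); first by rewrite phi_eq0// !mulr0.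
apply: ler_wpM2r => //; apply: le_trans (fL _ _) _.
by rewrite edistC ltW.
Qed.

Let pint_approx nu f n : FMclass f ->
  `|pint nu f - \sum_(k < n) f (q k) * pint nu (phi k)| <= del + (1 - pint nu (S n)).
Proof.
move=> fF.
have bphi k : bmeas (phi k) by exact: bcont_bmeas.
have bS : bmeas (S n) by exact: bcont_bmeas.
have bf : bmeas f by exact/bcont_bmeas/FMclass_bcont.
pose h x := \sum_(k < n) f (q k) * phi k x.
have bh : bmeas h by apply: bmeas_sum => k; exact: bmeasZ.
have -> : \sum_(k < n) f (q k) * pint nu (phi k) = pint nu h.
  rewrite /h pint_sum; last by move=> k; exact: bmeasZ.
  by apply: eq_bigr => k _; rewrite pintZ.
have b1 : bmeas (fun x => 1 - S n x) by apply: bmeasB => //; exact: bmeas_cst.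
have bd : bmeas (fun x => del + (1 - S n x)) by apply: bmeasD => //; exact: bmeas_cst.
have E : pint nu (fun x => del + (1 - S n x)) = del + (1 - pint nu (S n)).
  rewrite pintD//; last exact: bmeas_cst.
  by rewrite pintB// ?pint_cst//; exact: bmeas_cst.
rewrite -pintB// -E ler_norml; apply/andP; split.
  rewrite -mulN1r -pintZ//; apply: le_pint; [exact: bmeasZ|exact: bmeasB|] => x.
  by rewrite mulN1r; have := approx_error n x fF; rewrite ler_norml => /andP[].
apply: le_pint => //; first exact: bmeasB.
by move=> x; have := approx_error n x fF; rewrite ler_norml => /andP[].
Qed.

(** Up to [del] and the mass missed by [S n], each [f] is a combination of the same finitely many
    [phi k], with coefficients bounded by 1; controlling these controls all [f] at once. The missed
    mass is at most [del] for [mu] and [2 * del] for [nu], so the approximation errors are [2 * del]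
    and [3 * del], and the combinations differ by [del]. *)
Lemma wnbhs_FM_aux mu : wnbhs mu [set nu | forall f, FMclass f -> `|pint nu f - pint mu f| <= 6 * del].
Proof.
have /cvgrPdist_lt/(_ _ del0)[n _ /(_ n (leqnn n))] := pintS_cvg1 mu.
rewrite ger0_norm; last first.
  rewrite subr_ge0 -[leRHS](pint_cst mu); apply: le_pint => //; first exact/bcont_bmeas.
  exact: bmeas_cst.
move=> Sn.
have bphi k : bmeas (phi k) by exact: bcont_bmeas.
have d0 : 0 < del / n.+1%:R by rewrite divr_gt0.
exists n, (fun k : 'I_n => phi k), (del / n.+1%:R); split => // nu /= H f fF.
have sumH : \sum_(k < n) `|pint nu (phi k) - pint mu (phi k)| <= del.
  apply: (@le_trans _ _ (\sum_(k < n) (del / n.+1%:R))).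
    by apply: ler_sum => k _; exact: ltW.
  rewrite sumr_const card_ord -[leRHS](@divfK _ n.+1%:R) ?pnatr_eq0// mulr_natr.
  by rewrite ler_wpMn2l// ltW.
have SE m : pint m (S n) = \sum_(k < n) pint m (phi k).
  rewrite -pint_sum//; congr pint; by apply/funext => x; rewrite sum_phi.
have Snu : pint mu (S n) - pint nu (S n) <= del.
  rewrite !SE -sumrB; apply: le_trans sumH; apply: le_trans (ler_norm _) _.
  apply: le_trans (ler_norm_sum _ _ _) _; apply: ler_sum => k _; by rewrite distrC.
have A1 := pint_approx nu n fF; have A2 := pint_approx mu n fF.
have A3 : `|\sum_(k < n) f (q k) * pint nu (phi k) - \sum_(k < n) f (q k) * pint mu (phi k)| <= del.
  rewrite -sumrB; apply: le_trans (ler_norm_sum _ _ _) _.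
  apply: le_trans sumH; apply: ler_sum => k _; rewrite -mulrBr normrM.
  by rewrite -[leRHS]mul1r ler_wpM2r//; exact: fF.1.
move: A1 A2 A3; rewrite !ler_norml => /andP[A1 A1'] /andP[A2 A2'] /andP[A3 A3'].
apply/andP; split; lra.
Qed.

End partition_of_unity.

Lemma wnbhs_FM mu (e : R) : 0 < e ->
  wnbhs mu [set nu | forall f, FMclass f -> `|pint nu f - pint mu f| <= e].
Proof.
move=> e0.
pose q (n : nat) : Rd := if @unpickle (d.-tuple rat) n is Some t then ratpt R t else ratpt R [tuple 0 | i < d].
have := @wnbhs_FM_aux q (e / 6) _ _ mu.
rewrite [6 * _]mulrC divfK ?pnatr_eq0//; apply; first by rewrite divr_gt0.
move=> x e' e'0; have [t ht] := ratpt_dense x e'0.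
by exists (pickle t); rewrite /q pickleK.
Qed.

(** One copy of [nu] is replaced by [mu] at a time. The outer integrand [pint nu (g x)] itself
    depends on [nu], so convergence against a fixed function is not enough: the uniformity of
    [wnbhs_FM] is what makes the first replacement possible. *)
Lemma wnbhs_pint2 mu (g : Rd -> Rd -> R) (C : R) :
  (forall x y, `|g x y| <= C) ->
  (forall x x' y, `|g x y - g x' y| <= C * edist x x') ->
  (forall x y y', `|g x y - g x y'| <= C * edist y y') ->
  pint nu (fun x => pint nu (g x)) @[nu --> wnbhs mu] --> pint mu (fun x => pint mu (g x)).
Proof.
move=> gC gLx gLy.
pose c := `|C| + 1.
have c0 : 0 < c by rewrite /c ltr_wpDl.
have Cc : C <= c by rewrite /c; apply: le_trans (ler_norm C) _; rewrite lerDl.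
have bg x : bmeas (g x).
  split; last by exists C; exact: gC.
  by apply: Rcontinuous_measurable; apply: (@lipschitz_Rcontinuous _ _ _ C); exact: gLy.
have Lnu nu x y : `|pint nu (g x) - pint nu (g y)| <= C * edist x y.
  rewrite -pintB//; apply: pint_norm_le => [|z]; [exact: bmeasB|exact: gLx].
have bnu nu x : `|pint nu (g x)| <= C by apply: pint_norm_le.
have FM1 x : FMclass (fun y => c^-1 * g x y).
  split=> [y|y z].
    by rewrite normrM gtr0_norm ?invr_gt0// mulrC ler_pdivrMr// mul1r; apply: le_trans (gC _ _) Cc.
  rewrite -mulrBr normrM gtr0_norm ?invr_gt0// mulrC ler_pdivrMr// mulrC.
  by apply: le_trans (gLy _ _ _) _; rewrite ler_wpM2r ?edist_ge0.
have FM2 nu : FMclass (fun x => c^-1 * pint nu (g x)).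
  split=> [y|y z].
    by rewrite normrM gtr0_norm ?invr_gt0// mulrC ler_pdivrMr// mul1r; apply: le_trans (bnu _ _) Cc.
  rewrite -mulrBr normrM gtr0_norm ?invr_gt0// mulrC ler_pdivrMr// mulrC.
  by apply: le_trans (Lnu _ _ _) _; rewrite ler_wpM2r ?edist_ge0.
have bpnu nu : bmeas (fun x => pint nu (g x)).
  have := bmeasZ c (bcont_bmeas (FMclass_bcont (FM2 nu))).
  by under eq_fun do rewrite mulrA mulfV ?gt_eqF// mul1r.
apply/cvgrPdist_le => e e0.
have e0' : 0 < e / (2 * c) by rewrite divr_gt0// mulr_gt0.
apply: filterS (wnbhs_FM mu e0') => nu H.
have H1 : `|pint nu (fun x => pint nu (g x)) - pint mu (fun x => pint nu (g x))| <= e / 2.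
  have := H _ (FM2 nu); rewrite !pintZ// -mulrBr normrM gtr0_norm ?invr_gt0//.
  by rewrite invfM mulrA [leRHS]mulrC ler_pM2l// invr_gt0.
have H2 : `|pint mu (fun x => pint nu (g x)) - pint mu (fun x => pint mu (g x))| <= e / 2.
  rewrite -pintB//; apply: pint_norm_le => [|x]; first exact: bmeasB.
  have := H _ (FM1 x); rewrite !pintZ// -mulrBr normrM gtr0_norm ?invr_gt0//.
  by rewrite invfM mulrA [leRHS]mulrC ler_pM2l// invr_gt0.
move: H1 H2; rewrite !ler_norml => /andP[? ?] /andP[? ?]; apply/andP; split; lra.
Qed.

End weak_topology.

(** * Energies of lower semicontinuous kernels *)

Section double_integral_of_kernel.
Context (R : realType) (d : nat).
Local Notation Rd := (d.-tuple R).
Implicit Types (mu nu : M1 R d).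

Definition lsc2 (G : Rd -> Rd -> \bar R) := forall x y (a : R), (a%:E < G x y)%E ->
  exists2 e : R, 0 < e & forall u v, edist x u < e -> edist y v < e -> (a%:E < G u v)%E.

Lemma pair_open_measurable (U : set (Rd * Rd)) :
  (forall x y, U (x, y) -> exists2 e : R, 0 < e &
     forall u v, edist x u < e -> edist y v < e -> U (u, v)) -> measurable U.
Proof.
move=> oU.
pose dist (p q : Rd * Rd) := edist p.1 q.1 + edist p.2 q.2.
apply: (@open_measurable _ _ R _ (fun q : d.-tuple rat * d.-tuple rat => (ratpt R q.1, ratpt R q.2)) dist).
- move=> [x y] e e0; have e20 : 0 < e / 2 by rewrite divr_gt0.
  have [q1 h1] := ratpt_dense x e20; have [q2 h2] := ratpt_dense y e20.
  by exists (q1, q2); rewrite /dist/= (splitr e) ltrD.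
- move=> [q1 q2] [x x'] [y y']; rewrite /dist/= addrACA; apply: lerD.
    by rewrite (edistC _ x); exact: edist_triangle.
  by rewrite (edistC _ x'); exact: edist_triangle.
- move=> [q1 q2] e; rewrite -[X in measurable X]setTI; apply: measurable_fun_ltr => //.
  apply: measurable_funD.
    exact: (measurableT_comp (measurable_edist (ratpt R q1)) measurable_fst).
  exact: (measurableT_comp (measurable_edist (ratpt R q2)) measurable_snd).
- move=> [x y] /oU[e e0 He]; exists e => // -[u v]; rewrite /dist/= => uv.
  by apply: He; apply: le_lt_trans uv; rewrite ?lerDl ?lerDr ?edist_ge0.
Qed.

Lemma lsc2_measurable G : lsc2 G -> measurable_fun setT (fun p : Rd * Rd => G p.1 p.2).
Proof.
move=> lG; apply: (measurability _ (ErealGenOInfty.measurableE R)) => _ [_ [a ->] <-].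
rewrite setTI; apply: pair_open_measurable => x y /=.
rewrite in_itv/= andbT => /lG[e e0 He]; exists e => // u v xu yv.
by rewrite /= in_itv/= andbT; exact: He.
Qed.

Variable G : Rd -> Rd -> \bar R.
Hypothesis G0 : forall x y, (0 <= G x y)%E.
Hypothesis lscG : lsc2 G.

(** Truncating at height [n] before the inf-convolution keeps it real and bounded where [G] is
    [+oo]. *)
Let t n (p : Rd * Rd) : R := fine (mine (G p.1 p.2) n%:R%:E).

Let tE n p : (t n p)%:E = mine (G p.1 p.2) n%:R%:E.
Proof.
rewrite /t fineK// ge0_fin_numE; first by rewrite gt_min ltry orbT.
by rewrite le_min G0 lee_fin ler0n.
Qed.

Let t_ge0 n p : 0 <= t n p.
Proof. by rewrite -lee_fin tE le_min G0 lee_fin ler0n. Qed.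

Let t_le n p : t n p <= n%:R.
Proof. by rewrite -lee_fin tE ge_min lexx orbT. Qed.

Let tG n p : ((t n p)%:E <= G p.1 p.2)%E.
Proof. by rewrite tE ge_min lexx. Qed.

Let tS n m p : (n <= m)%N -> t n p <= t m p.
Proof.
move=> nm; rewrite -lee_fin !tE le_min ge_min lexx/= ge_min.
by apply/orP; right; rewrite lee_fin ler_nat.
Qed.

Let S n x y := [set t n p + n%:R * (edist x p.1 + edist y p.2) | p in setT].

(* Inf-convolution of [G] with the distance, a Lipschitz minorant. *)
Definition moreau_yosida (n : nat) (x y : Rd) : R := inf (S n x y).
Local Notation my := moreau_yosida.

Let S_ge0 n x y : lbound (S n x y) 0.
Proof. by move=> _ [p _ <-]; rewrite addr_ge0// mulr_ge0// addr_ge0// edist_ge0. Qed.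

Let S_neq0 n x y : S n x y !=set0.
Proof. by eexists; exists (x, y). Qed.

Let my_le n x y p : my n x y <= t n p + n%:R * (edist x p.1 + edist y p.2).
Proof. by apply: ge_inf; [exists 0; exact: S_ge0|exists p]. Qed.

Lemma moreau_yosida_ge0 n x y : 0 <= my n x y.
Proof. exact: lb_le_inf. Qed.

Let my_le_t n x y : my n x y <= t n (x, y).
Proof. by apply: le_trans (my_le n x y (x, y)) _; rewrite !edistxx addr0 mulr0 addr0. Qed.

Lemma moreau_yosida_le_nat n x y : my n x y <= n%:R.
Proof. exact: le_trans (my_le_t n x y) (t_le _ _). Qed.

Lemma moreau_yosida_le n x y : ((my n x y)%:E <= G x y)%E.
Proof. by apply: le_trans (tG n (x, y)); rewrite lee_fin. Qed.

Lemma moreau_yosida_norm n x y : `|my n x y| <= n%:R.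
Proof. by rewrite ger0_norm ?moreau_yosida_ge0// moreau_yosida_le_nat. Qed.

Lemma nondecreasing_moreau_yosida n m x y : (n <= m)%N -> my n x y <= my m x y.
Proof.
move=> nm; apply: lb_le_inf => // _ [p _ <-].
apply: le_trans (my_le n x y p) _; apply: lerD; first exact: tS.
by rewrite ler_wpM2r ?ler_nat// addr_ge0 ?edist_ge0.
Qed.

Let my_lip n x y x' y' : my n x y <= my n x' y' + n%:R * (edist x x' + edist y y').
Proof.
rewrite -lerBlDr; apply: lb_le_inf => // _ [p _ <-].
rewrite lerBlDr; apply: le_trans (my_le n x y p) _.
rewrite -addrA lerD2l -mulrDr ler_wpM2l// addrACA; apply: lerD.
  by rewrite addrC; exact: edist_triangle.
by rewrite addrC; exact: edist_triangle.
Qed.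

Lemma moreau_yosida_lipl n x x' y : `|my n x y - my n x' y| <= n%:R * edist x x'.
Proof.
rewrite ler_norml lerNl opprB !lerBlDr; apply/andP; split.
  by rewrite addrC; apply: le_trans (my_lip n x' y x y) _; rewrite edistxx addr0 edistC.
by rewrite addrC; apply: le_trans (my_lip n x y x' y) _; rewrite edistxx addr0.
Qed.

Lemma moreau_yosida_lipr n x y y' : `|my n x y - my n x y'| <= n%:R * edist y y'.
Proof.
rewrite ler_norml lerNl opprB !lerBlDr; apply/andP; split.
  by rewrite addrC; apply: le_trans (my_lip n x y' x y) _; rewrite edistxx add0r edistC.
by rewrite addrC; apply: le_trans (my_lip n x y x y') _; rewrite edistxx add0r.
Qed.

Let my_sup x y (a : R) : (a%:E < G x y)%E -> exists n, a <= my n x y.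
Proof.
move=> aG; have [a0|a0] := leP a 0; first by exists 0; exact: le_trans a0 (moreau_yosida_ge0 _ _ _).
have [e e0 He] := lscG aG.
(* With [n >= a] the truncation stays above [a] near [(x, y)]; with [n >= a / e] the penalty alone
   exceeds [a] farther away. *)
have [n Hn] : exists n : nat, Num.max a (a / e) <= n%:R.
  by exists (Num.bound (Num.max a (a / e))); rewrite ltW// archi_boundP// le_max ltW.
move: Hn; rewrite ge_max => /andP[an aen].
exists n; apply: lb_le_inf => // _ [[u v] _ <-] /=.
have [/andP[xu yv]|] := boolP ((edist x u < e) && (edist y v < e)).
  rewrite -[a]addr0; apply: lerD; last by rewrite mulr_ge0// addr_ge0 ?edist_ge0.
  by rewrite -lee_fin tE/= le_min ltW ?He//= lee_fin.
rewrite negb_and -!leNgt => H.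
rewrite -[a]add0r; apply: lerD; first exact: t_ge0.
rewrite -[a](@divfK _ e) ?gt_eqF//; apply: ler_pM => //; first by rewrite divr_ge0 ?ltW.
  exact: ltW.
by case/orP: H => H; apply: le_trans H _; rewrite ?lerDl ?lerDr edist_ge0.
Qed.

Lemma moreau_yosida_cvg x y : (my n x y)%:E @[n --> \oo] --> G x y.
Proof.
have -> : G x y = ereal_sup (range (fun n => (my n x y)%:E)).
  apply/eqP; rewrite eq_le; apply/andP; split; last first.
    by apply: ge_ereal_sup => _ [n _ <-]; exact: moreau_yosida_le.
  rewrite leNgt; apply/negP => H.
  have [a /andP[a1 a2]] : exists a : R, (ereal_sup (range (fun n => (my n x y)%:E)) < a%:E < G x y)%E.
    move: H; set s := ereal_sup _ => H.
    have s0 : (0 <= s)%E.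
      by apply: ereal_sup_ge; exists (my 0 x y)%:E; [exists 0%N|rewrite lee_fin moreau_yosida_ge0].
    case: s H s0 => [s| |] /= H s0; last 2 first.
      by move: H; rewrite ltNge leey.
      by move: s0; rewrite leNgt ltNyr.
    move: H; case: (G x y) => [g| |] H; last by move: H; rewrite ltNge leNye.
      by exists ((s + g) / 2); rewrite !lte_fin in H *; apply/andP; split; lra.
    by exists (s + 1); rewrite lte_fin ltrDl ltr01/= ltry.
  have [n an] := my_sup a2.
  move: a1; rewrite ltNge => /negP; apply.
  by apply: ereal_sup_ge; exists (my n x y)%:E; [exists n|rewrite lee_fin].
apply: ereal_nondecreasing_cvgn => n m nm.
by rewrite lee_fin nondecreasing_moreau_yosida.
Qed.

Lemma moreau_yosida_bmeas n x : bmeas (my n x).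
Proof.
split; last by exists n%:R => y; exact: moreau_yosida_norm.
apply: Rcontinuous_measurable; apply: (@lipschitz_Rcontinuous _ _ _ n%:R) => y y'.
exact: moreau_yosida_lipr.
Qed.

Lemma kernel_measurable x : measurable_fun setT (G x).
Proof.
rewrite (_ : G x = (fun p : Rd * Rd => G p.1 p.2) \o pair x)//.
apply: measurableT_comp; last exact: pair1_measurable.
exact: lsc2_measurable.
Qed.

Lemma pint_moreau_yosida_bmeas mu n : bmeas (fun x => pint mu (my n x)).
Proof.
split; last first.
  exists n%:R => x; apply: pint_norm_le; first exact: moreau_yosida_bmeas.
  by move=> y; exact: moreau_yosida_norm.
apply: Rcontinuous_measurable; apply: (@lipschitz_Rcontinuous _ _ _ n%:R) => x x'.
rewrite -pintB; [|exact: moreau_yosida_bmeas..].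
apply: pint_norm_le => [|y]; last exact: moreau_yosida_lipl.
by apply: bmeasB; exact: moreau_yosida_bmeas.
Qed.

Local Open Scope ereal_scope.

Lemma pint_moreau_yosida_cvg mu x :
  (pint mu (my n x))%:E @[n --> \oo] --> \int[mu]_y G x y.
Proof.
under eq_fun => n do rewrite -(pintE mu (moreau_yosida_bmeas n x)).
rewrite (_ : \int[mu]_y G x y = \int[mu]_y limn (fun n => (my n x y)%:E)); last first.
  by apply: eq_integral => y _; apply/esym/cvg_lim => //; exact: moreau_yosida_cvg.
apply: cvg_monotone_convergence => //.
- by move=> n; apply/measurable_EFinP; exact: (moreau_yosida_bmeas n x).1.
- by move=> n y _; rewrite lee_fin moreau_yosida_ge0.
- by move=> y _ n m nm; rewrite lee_fin nondecreasing_moreau_yosida.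
Qed.

Definition energy mu : \bar R := \int[mu]_x \int[mu]_y G x y.
Definition energy_approx (n : nat) mu : R := pint mu (fun x => pint mu (my n x)).

Lemma kernel_section_measurable mu : measurable_fun setT (fun x => \int[mu]_y G x y).
Proof.
exact: (measurable_fun_fubini_tonelli_F (m2 := mu) _ (lsc2_measurable lscG) (fun=> G0 _ _)).
Qed.

Lemma le_pint_moreau_yosida mu n m x : (n <= m)%N -> (pint mu (my n x) <= pint mu (my m x))%R.
Proof.
move=> nm; apply: le_pint; [exact: moreau_yosida_bmeas..|] => y.
exact: nondecreasing_moreau_yosida.
Qed.

Lemma energy_approx_cvg mu : (energy_approx n mu)%:E @[n --> \oo] --> energy mu.
Proof.
rewrite /energy_approx.
under eq_fun => n do rewrite -(pintE mu (pint_moreau_yosida_bmeas mu n)).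
rewrite /energy (_ : \int[mu]_x _ =
    \int[mu]_x limn (fun n => (pint mu (my n x))%:E)); last first.
  by apply: eq_integral => x _; apply/esym/cvg_lim => //; exact: pint_moreau_yosida_cvg.
apply: cvg_monotone_convergence => //.
- by move=> n; apply/measurable_EFinP; exact: (pint_moreau_yosida_bmeas mu n).1.
- move=> n x _; rewrite lee_fin -(pint_cst mu 0%R); apply: le_pint => [||y].
  + exact: bmeas_cst.
  + exact: moreau_yosida_bmeas.
  + exact: moreau_yosida_ge0.
- by move=> x _ n m nm; rewrite lee_fin; exact: le_pint_moreau_yosida.
Qed.

Lemma energy_approx_nondecreasing mu n m : (n <= m)%N -> (energy_approx n mu <= energy_approx m mu)%R.
Proof.
move=> nm; apply: le_pint; [exact: pint_moreau_yosida_bmeas..|] => x.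
exact: le_pint_moreau_yosida.
Qed.

Lemma energy_approx_le mu n : (energy_approx n mu)%:E <= energy mu.
Proof.
have /cvg_lim <- // := @energy_approx_cvg mu; apply: lime_ge.
  by apply/cvg_ex; eexists; exact: energy_approx_cvg.
near=> m; rewrite lee_fin; apply: energy_approx_nondecreasing; near: m.
exact: nbhs_infty_ge.
Unshelve. all: by end_near.
Qed.

Lemma energy_approx_gt mu (a : R) : a%:E < energy mu -> exists n, (a < energy_approx n mu)%R.
Proof.
move=> aJ; apply: contrapT => H; move: aJ; rewrite ltNge => /negP; apply.
have /cvg_lim <- // := @energy_approx_cvg mu; apply: lime_le.
  by apply/cvg_ex; eexists; exact: energy_approx_cvg.
apply: nearW => n; rewrite lee_fin leNgt; apply/negP => h; apply: H; by exists n.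
Qed.

Lemma energy_approx_continuous mu n :
  energy_approx n nu @[nu --> wnbhs mu] --> energy_approx n mu.
Proof.
apply: (wnbhs_pint2 (C := n%:R)) => *.
- exact: moreau_yosida_norm.
- exact: moreau_yosida_lipl.
- exact: moreau_yosida_lipr.
Qed.

Lemma wopen_energy_approx_gt n (a : R) : wopen [set mu | (a < energy_approx n mu)%R].
Proof.
apply/wopenP => mu /= aJ.
by have /cvgr_gt/(_ a aJ) := @energy_approx_continuous mu n; apply.
Qed.

Lemma wclosed_energy_le (a : R) : wclosed [set mu | energy mu <= a%:E].
Proof.
apply/wopenP => mu /= /negP; rewrite -ltNge => /energy_approx_gt[n an].
apply: filterS (wopen_energy_approx_gt an) => nu /= H.
by apply/negP; rewrite -ltNge; apply: lt_le_trans (energy_approx_le nu n); rewrite lte_fin.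
Qed.

End double_integral_of_kernel.

(** * Riesz representation and tightness *)

Section open_indicator.
Context (R : realType) (d : nat).
Local Notation Rd := (d.-tuple R).

Lemma lsc2_open_indic (U : set Rd) : Ropen U -> lsc2 (fun x _ => (\1_U x : R)%:E).
Proof.
move=> oU x y a; rewrite lte_fin indicE; have [xU|xU] := boolP (x \in U).
  move=> a1; have [e e0 He] := oU x (set_mem xU); exists e => // u v xu _.
  by rewrite lte_fin indicE mem_set//; exact: He.
move=> a0; exists 1 => // u v _ _; rewrite lte_fin; apply: lt_le_trans a0 _.
by rewrite indicE.
Qed.

Lemma open_indic_ge0 (U : set Rd) (x y : Rd) : (0 <= (\1_U x : R)%:E)%E.
Proof. by rewrite lee_fin indicE. Qed.

(** The indicator is viewed as a kernel constant in its second variable, frozen at the origin, so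
    that the results on kernels apply. *)
Definition indic_approx (U : set Rd) (k : nat) (x : Rd) : R :=
  moreau_yosida (fun x _ => (\1_U x : R)%:E) k x (Defs.x0 R d).

Lemma indic_approx_bcont U k : bcont (indic_approx U k).
Proof.
split.
  apply: (@lipschitz_Rcontinuous _ _ _ k%:R) => x y.
  exact: (moreau_yosida_lipl (open_indic_ge0 U)).
by exists k%:R => x; exact: (moreau_yosida_norm (open_indic_ge0 U)).
Qed.

Lemma indic_approx_ge0 U k x : 0 <= indic_approx U k x.
Proof. exact: (moreau_yosida_ge0 (open_indic_ge0 U)). Qed.

Lemma indic_approx_le U k x : indic_approx U k x <= \1_U x.
Proof. by rewrite -lee_fin; exact: (moreau_yosida_le (open_indic_ge0 U)). Qed.

Lemma nondecreasing_indic_approx U k l x : (k <= l)%N ->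
  indic_approx U k x <= indic_approx U l x.
Proof. exact: (nondecreasing_moreau_yosida (open_indic_ge0 U)). Qed.

Lemma indic_approx_cvg U x : Ropen U -> indic_approx U k x @[k --> \oo] --> (\1_U x : R).
Proof.
move=> oU.
have := @moreau_yosida_cvg _ _ _ (open_indic_ge0 U) (lsc2_open_indic oU) x (Defs.x0 R d).
by move/fine_cvg.
Qed.

End open_indicator.

(** * From an outer measure to a Borel probability *)

Section caratheodory_probability.
Context (R : realType) (d : nat).
Local Notation Rd := (d.-tuple R).
Variable mu : {outer_measure set Rd -> \bar R}.
Hypothesis opens : forall U : set Rd, Ropen U -> mu.-caratheodory U.
Hypothesis total : mu setT = 1%E.

Let C : measurableType _ := caratheodory_type mu.
Let idC : C -> Rd := fun x => x.

Let measurable_idC : measurable_fun setT idC.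
Proof.
apply/measurable_fun_tnthP => i.
apply: (measurability _ (RGenOInfty.measurableE R)) => _ [_ [a ->] <-].
rewrite setTI; apply: opens.
apply: (@Ropen_preimage R d (fun x => tnth x i)); last exact: interval_open.
apply: (@lipschitz_Rcontinuous _ _ _ 1) => x y; rewrite mul1r.
exact: le_edist_coord.
Qed.

Let p : set Rd -> \bar R := pushforward (mu : set C -> \bar R) idC.
HB.instance Definition _ := Measure.copy p
  (measure_function_pushforward__canonical__measure_function_Measure
    (mu : {measure set C -> \bar R}) measurable_idC).

Let p_setT : p setT = 1%E. Proof. exact: total. Qed.

HB.instance Definition _ := Measure_isProbability.Build _ _ _ p p_setT.

(** The Caratheodory sigma-algebra lives on its own type. The identity from it to [Rd] is measurable
    because the coordinates generate the sigma-algebra of tuples and their open half-spaces are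
    among [opens]; the probability is the push-forward. *)
Lemma caratheodory_probability_exists : exists P : M1 R d, forall A, P A = mu A.
Proof. by exists p. Qed.

End caratheodory_probability.

(** * Riesz representation of a positive functional with Dini's property *)

Section riesz.
Context (R : realType) (d : nat).
Local Notation Rd := (d.-tuple R).
Implicit Types (f g : Rd -> R) (U O : set Rd).
Variable L : (Rd -> R) -> R.
Hypothesis LD : forall f g, bcont f -> bcont g -> L (fun x => f x + g x) = L f + L g.
Hypothesis LZ : forall (a : R) f, bcont f -> L (fun x => a * f x) = a * L f.
Hypothesis le_L : forall f g, bcont f -> bcont g -> (forall x, f x <= g x) -> L f <= L g.
Hypothesis L1 : L (fun=> 1) = 1.
Hypothesis L_dini : forall F : nat -> Rd -> R, (forall n, bcont (F n)) ->
  (forall n m x, (n <= m)%N -> F m x <= F n x) ->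
  (forall x, F n x @[n --> \oo] --> (0 : R)) ->
  forall e, 0 < e -> exists n, L (F n) <= e.

Let L_cst a : L (fun=> a) = a.
Proof.
rewrite (_ : (fun=> a) = (fun x : Rd => a * (fun=> 1) x)).
  by rewrite LZ ?L1 ?mulr1//; exact: bcont_cst.
by apply/funext => x; rewrite mulr1.
Qed.

Let LN f : bcont f -> L (fun x => - f x) = - L f.
Proof.
move=> bf; under eq_fun do rewrite -mulN1r.
by rewrite LZ// mulN1r.
Qed.

Let LB f g : bcont f -> bcont g -> L (fun x => f x - g x) = L f - L g.
Proof. by move=> bf bg; rewrite LD ?LN//; exact: bcontN. Qed.

Let L_sum n (F : nat -> Rd -> R) : (forall i, bcont (F i)) ->
  L (fun x => \sum_(i < n) F i x) = \sum_(i < n) L (F i).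
Proof.
move=> bF; elim: n => [|n IH].
  by under eq_fun do rewrite big_ord0; rewrite big_ord0 L_cst.
under eq_fun do rewrite big_ord_recr.
by rewrite big_ord_recr/= LD ?IH//; exact: bcont_sum.
Qed.

(** Open sets are measured from inside by continuous functions, through [lam]; general sets are then
    measured from outside by open sets, through [mu]. *)
Let test U := [set f | bcont f /\ forall x, 0 <= f x <= \1_U x].
Let lam U : R := sup (L @` test U).

Let test0 U : test U (fun=> 0).
Proof. by split; [exact: bcont_cst|move=> x; rewrite lexx indicE ler0n]. Qed.

Let lam_has_sup U : has_sup (L @` test U).
Proof.
split; first by exists (L (fun=> 0)), (fun=> 0).
exists 1 => _ [f [bf fU] <-]; rewrite -L1; apply: le_L => //; first exact: bcont_cst.
move=> x; have /andP[_ h] := fU x; apply: le_trans h _.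
by rewrite indicE; case: (_ \in _).
Qed.

Let L_lam U f : test U f -> L f <= lam U.
Proof. by move=> tf; apply: sup_upper_bound => //; exists f. Qed.

Let lam_le U (a : R) : (forall f, test U f -> L f <= a) -> lam U <= a.
Proof.
move=> h; apply: ge_sup; first exact: (lam_has_sup U).1.
by move=> _ [f tf <-]; exact: h.
Qed.

Let lam_ge0 U : 0 <= lam U.
Proof. by rewrite -(L_cst 0); exact: L_lam. Qed.

Let le_lam U O : U `<=` O -> lam U <= lam O.
Proof.
move=> UO; apply: lam_le => f [bf fU]; apply: L_lam; split => // x.
have /andP[-> h] /= := fU x; apply: le_trans h _; rewrite !indicE ler_nat.
by have [xU|//] := boolP (x \in U); rewrite mem_set//; apply: UO; exact: set_mem.
Qed.

Let lam_setT : lam setT = 1.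
Proof.
apply/eqP; rewrite eq_le; apply/andP; split.
  apply: lam_le => f [bf fU]; rewrite -L1; apply: le_L => //; first exact: bcont_cst.
  by move=> x; have /andP[_] := fU x; rewrite indicT.
rewrite -{1}L1; apply: L_lam; split; first exact: bcont_cst.
by move=> x; rewrite indicT ler01 lexx.
Qed.

(** This is where Dini's property replaces compact supports: cutting a test function [f] of the
    union by the sum of the first [k] approximate indicators leaves a remainder that decreases to 0
    pointwise, hence has small [L]. *)
Let lam_bigcup (U : nat -> set Rd) : (forall n, Ropen (U n)) ->
  ((lam (\bigcup_n U n))%:E <= \sum_(n <oo) (lam (U n))%:E)%E.
Proof.
move=> oU; apply/lee_addgt0Pr => e e0.
have [|Sfin] := eqVneq (\sum_(n <oo) (lam (U n))%:E)%E +oo%E.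
  by move=> ->; rewrite addye// leey.
have S0 : (0 <= \sum_(n <oo) (lam (U n))%:E)%E by apply: nneseries_ge0 => n _ _; rewrite lee_fin.
have SE : (\sum_(n <oo) (lam (U n))%:E)%E = (fine (\sum_(n <oo) (lam (U n))%:E)%E)%:E.
  by rewrite fineK// ge0_fin_numE// lt_neqAle Sfin leey.
rewrite SE -EFinD lee_fin; apply: lam_le => f [bf fU].
pose g k x := Num.min (f x) (\sum_(n < k) indic_approx (U n) k x).
have bg k : bcont (g k).
  by apply: bcont_min => //; apply: bcont_sum => i; exact: indic_approx_bcont.
have bh n k : bcont (indic_approx (U n) k) by exact: indic_approx_bcont.
have [k Hk] : exists k, L (fun x => f x - g k x) <= e.
  apply: L_dini => //.
  - by move=> k; exact: bcontB.
  - move=> k l x kl; rewrite lerD2l lerN2 /g le_min ge_min lexx/= ge_min; apply/orP; right.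
    rewrite -(subnKC kl) big_split_ord/= -[leLHS]addr0; apply: lerD.
      by apply: ler_sum => i _; apply: nondecreasing_indic_approx; rewrite subnKC.
    by apply: sumr_ge0 => i _; exact: indic_approx_ge0.
  - move=> x; have /andP[f0 f1] := fU x.
    have [xU|xU] := pselect ((\bigcup_n U n) x); last first.
      have fx0 : f x = 0.
        by apply/eqP; rewrite eq_le f0 andbT; move: f1; rewrite indicE memNset.
      rewrite (_ : (fun n => _) = fun=> 0); first exact: cvg_cst.
      apply/funext => k; rewrite /g fx0 sub0r; apply/eqP; rewrite oppr_eq0; apply/eqP/min_idPl.
      by apply: sumr_ge0 => i _; exact: indic_approx_ge0.
    have [n _ Unx] := xU.
    have hc := @indic_approx_cvg _ _ _ x (oU n).
    rewrite indicE mem_set//= in hc.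
    apply: (@squeeze_cvgr _ _ _ _ (fun=> 0) (fun k => 1 - indic_approx (U n) k x)).
    + exists n.+1 => // k /= nk; apply/andP; split; first by rewrite subr_ge0 ge_min lexx.
      have fx1 : f x <= 1 by apply: le_trans f1 _; rewrite indicE; case: (_ \in _).
      have h1 : indic_approx (U n) k x <= 1.
        by apply: le_trans (indic_approx_le _ _ _) _; rewrite indicE; case: (_ \in _).
      have hs : indic_approx (U n) k x <= \sum_(n < k) indic_approx (U n) k x.
        rewrite (bigD1 (Ordinal nk))//= lerDl.
        by apply: sumr_ge0 => i _; exact: indic_approx_ge0.
      rewrite /g; have [h|h] := leP (f x) (\sum_(n < k) indic_approx (U n) k x).
        by rewrite subrr subr_ge0.
      by apply: lerB => //.
    + exact: cvg_cst.
    + rewrite -[X in _ --> X](subrr (1 : R)); apply: cvgB => //; exact: cvg_cst.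
have Lf : L f <= L (g k) + e by rewrite -lerBlDl -LB.
apply: le_trans Lf _; rewrite lerD2r.
apply: (@le_trans _ _ (\sum_(n < k) lam (U n))).
  apply: (@le_trans _ _ (L (fun x => \sum_(n < k) indic_approx (U n) k x))).
    apply: le_L => //; first by apply: bcont_sum.
    by move=> x; rewrite ge_min lexx orbT.
  rewrite (L_sum _ (F := fun n => indic_approx (U n) k))//; apply: ler_sum => n _.
  apply: L_lam; split => // x; by rewrite indic_approx_ge0 indic_approx_le.
rewrite -lee_fin -SE -sumEFin -(big_mkord xpredT (fun n => (lam (U n))%:E)).
by apply: nneseries_lim_ge => n _ _; rewrite lee_fin.
Qed.

Let mu (A : set Rd) : \bar R := ereal_inf [set (lam U)%:E | U in [set U | Ropen U /\ A `<=` U]].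

Let RopenT : Ropen (setT : set Rd).
Proof. by move=> x _; exists 1. Qed.

Let Ropen_bigcup (U : nat -> set Rd) : (forall n, Ropen (U n)) -> Ropen (\bigcup_n U n).
Proof.
move=> oU x [n _ Unx]; have [e e0 He] := oU n x Unx; exists e => // y xy.
by exists n => //; exact: He.
Qed.

Let RopenI U O : Ropen U -> Ropen O -> Ropen (U `&` O).
Proof.
move=> oU oO x [/oU[e e0 He] /oO[e' e'0 He']]; exists (Num.min e e'); first by rewrite lt_min e0.
by move=> y /=; rewrite lt_min => /andP[? ?]; split; [exact: He|exact: He'].
Qed.

Let mu_open U : Ropen U -> mu U = (lam U)%:E.
Proof.
move=> oU; apply/eqP; rewrite eq_le; apply/andP; split.
  by apply: ereal_inf_lbound; exists U; [split|].
by apply: le_ereal_inf_tmp => _ [W [oW UO] <-]; rewrite lee_fin le_lam.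
Qed.

Let mu_le A U : Ropen U -> A `<=` U -> (mu A <= (lam U)%:E)%E.
Proof. by move=> oU AU; apply: ereal_inf_lbound; exists U. Qed.

Let mu_ge0 A : (0 <= mu A)%E.
Proof. by apply: le_ereal_inf_tmp => _ [U _ <-]; rewrite lee_fin. Qed.

Let mu_fin A : mu A \is a fin_num.
Proof.
by rewrite ge0_fin_numE//; apply: le_lt_trans (mu_le RopenT (@subsetT _ A)) _; rewrite ltry.
Qed.

Let mu0 : mu set0 = 0%E.
Proof.
rewrite mu_open; last by move=> x.
congr EFin; apply/eqP; rewrite eq_le lam_ge0 andbT; apply: lam_le => f [bf f0].
rewrite -(L_cst 0); apply: le_L => //; first exact: bcont_cst.
by move=> x; have /andP[_] := f0 x; rewrite indic0.
Qed.

Let le_mu : {homo mu : A B / A `<=` B >-> (A <= B)%E}.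
Proof.
move=> A B AB; apply: le_ereal_inf_tmp => _ [U [oU BU] <-].
by apply: mu_le => //; exact: subset_trans BU.
Qed.

Let mu_adherent A e : 0 < e -> exists U, [/\ Ropen U, A `<=` U & ((lam U)%:E <= mu A + e%:E)%E].
Proof.
move=> e0; have [_ [U [oU AU] <-] h] := lb_ereal_inf_adherent e0 (mu_fin A).
by exists U; split => //; exact: ltW.
Qed.

Let mu_sigma_subadditive : sigma_subadditive mu.
Proof.
move=> A; apply/lee_addgt0Pr => _/posnumP[e].
apply: le_trans (epsilon_trick xpredT (fun n => mu_ge0 (A n)) (ltW [gt0 of e%:num])).
have [U HU] := choice (fun n => mu_adherent (A n)
  (divr_gt0 [gt0 of e%:num] (ltac:(rewrite ltr0n expn_gt0//) : 0 < (2 ^ n.+1)%:R :> R))).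
apply: (@le_trans _ _ (lam (\bigcup_n U n))%:E).
  apply: mu_le; first by apply: Ropen_bigcup => n; have [] := HU n.
  by apply: subset_bigcup => n _; have [] := HU n.
apply: le_trans (lam_bigcup _) _; first by move=> n; have [] := HU n.
apply: lee_nneseries => n _; first by rewrite lee_fin.
by have [] := HU n.
Qed.

HB.instance Definition _ := isOuterMeasure.Build R Rd mu mu0 mu_ge0 le_mu mu_sigma_subadditive.

(** It suffices to split open sets [O]. A test function [f] of [O] meeting [U] nearly realizes one
    part, and the rest of [O] is inside the open set [O'] where [f < e]; a test function [g] of [O']
    then satisfies [f + g <= 1 + e], so [f + g] is, up to the factor [1 + e], a test function of
    [O]. *)
Let open_caratheodory U : Ropen U -> mu.-caratheodory U.
Proof.
move=> oU; apply: le_caratheodory_measurable => X.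
apply: le_ereal_inf_tmp => _ [W [oW XO] <-].
move: W oW XO => O oO XO.
apply: (@le_trans _ _ ((lam (O `&` U))%:E + mu (O `&` ~` U))%E).
  apply: leeD; last by apply: le_mu => x [/XO].
  by apply: mu_le; [exact: RopenI|move=> x [/XO]].
rewrite -(fineK (mu_fin (O `&` ~` U))) -EFinD lee_fin -lerBrDr.
apply: lam_le => f [bf fOU]; rewrite lerBrDr.
apply/ler_addgt0Pr => e e0.
pose O' := O `&` [set x | f x < e].
have oO' : Ropen O'.
  apply: RopenI => //; have := @Ropen_preimage R d f `]-oo, e[%classic bf.1 (@interval_open _ _ _ _ _).
  rewrite (_ : f @^-1` _ = [set x | f x < e]); last by apply/seteqP; split=> x /=; rewrite in_itv.
  by apply.
have fO x : ~ (O `&` U) x -> f x = 0.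
  move=> nx; have /andP[f0] := fOU x; rewrite indicE memNset//= => f1.
  by apply/eqP; rewrite eq_le f0 f1.
have O'O : O `&` ~` U `<=` O'.
  by move=> x [Ox nUx]; split => //=; rewrite fO//; case.
rewrite addrC -lerBrDr.
apply: (@le_trans _ _ (lam O')); first by rewrite -lee_fin fineK; [exact: mu_le|exact: mu_fin].
apply: lam_le => g [bg gO']; rewrite lerBrDr.
have e1 : 0 < 1 + e by rewrite addr_gt0.
have H : L g + L f <= (1 + e) * lam O.
  have -> : L g + L f = (1 + e) * L (fun x => (1 + e)^-1 * (g x + f x)).
    rewrite LZ; last exact: bcontD.
    by rewrite mulrA mulfV ?gt_eqF// mul1r LD.
  rewrite ler_wpM2l ?(ltW e1)//.
  apply: (@L_lam O (fun x => (1 + e)^-1 * (g x + f x))).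
  split; first by apply: bcontZ; exact: bcontD.
  move=> x; have /andP[f0 f1] := fOU x; have /andP[g0 g1] := gO' x.
  apply/andP; split; first by rewrite mulr_ge0 ?invr_ge0 ?addr_ge0// ltW.
  rewrite mulrC ler_pdivrMr//.
  have [Ox|nOx] := pselect (O x); last first.
    rewrite indicE memNset//= mul0r fO; last by case.
    by rewrite addr0; move: g1; rewrite indicE memNset//=; case.
  rewrite indicE mem_set//= mul1r.
  have f11 : f x <= 1 by apply: le_trans f1 _; rewrite indicE; case: (_ \in _).
  have g11 : g x <= 1 by apply: le_trans g1 _; rewrite indicE; case: (_ \in _).
  have [fe|fe] := ltP (f x) e; first by apply: lerD => //; exact: ltW.
  have -> : g x = 0.
    by apply/eqP; rewrite eq_le g0 andbT; move: g1; rewrite indicE memNset//=; case=> _ /=; rewrite ltNge fe.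
  by rewrite add0r; apply: le_trans f11 _; rewrite lerDl ltW.
apply: le_trans H _; rewrite mulrDl mul1r lerD2l.
rewrite -[leRHS]mulr1 ler_wpM2l// ?(ltW e0)//.
by rewrite -lam_setT; apply: le_lam.
Qed.

(** A function with values in [[0, 1]] is sliced into [k] layers [s j] of height [1 / k], each
    between the indicators of [O j.+1] and [O j] divided by [k]. Comparing [L] of a layer with
    [pint P] of the previous one loses only the bottom layer, at most [1 / k]. The resulting
    inequality, applied to [f] and to [1 - f], is an equality, which extends to [bcont] by affine
    rescaling. *)
Lemma riesz_representation : exists P : M1 R d, forall f, bcont f -> pint P f = L f.
Proof.
have [|P PE] := caratheodory_probability_exists open_caratheodory.
  by rewrite /= mu_open ?lam_setT.
have PO U : Ropen U -> P U = (lam U)%:E by move=> oU; rewrite PE; exact: mu_open.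
exists P.
have key f : bcont f -> (forall x, 0 <= f x <= 1) -> L f <= pint P f.
  move=> bf f01; apply/ler_addgt0Pr => e e0.
  pose k := (Num.bound e^-1).+1.
  have k0 : 0 < k%:R :> R by rewrite ltr0n.
  have ke : k%:R^-1 <= e.
    rewrite -[e]invrK lef_pV2 ?posrE ?invr_gt0//.
    by apply/ltW/(lt_le_trans (archi_boundP _)); rewrite ?invr_ge0 ?ltW// ltr_nat.
  apply: (@le_trans _ _ (pint P f + k%:R^-1)); last by rewrite lerD2l.
  pose c j x := Num.min (f x) (j%:R / k%:R).
  have bc j : bcont (c j) by apply: bcont_min => //; exact: bcont_cst.
  pose s j x := c j.+1 x - c j x.
  have bs j : bcont (s j) by exact: bcontB.
  have c_le j x : c j x <= c j.+1 x.
    rewrite le_min ge_min lexx/= ge_min; apply/orP; right.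
    by rewrite ler_wpM2r ?invr_ge0 ?ltW// ltr_nat.
  have sum_s n x : \sum_(j < n) s j x = c n x - c 0 x.
    elim: n => [|n IH]; first by rewrite big_ord0 subrr.
    by rewrite big_ord_recr/= IH /s; ring.
  have c0 x : c 0 x = 0.
    by rewrite /c mul0r; apply/min_idPr; have /andP[] := f01 x.
  have fE x : f x = \sum_(j < k) s j x.
    rewrite sum_s c0 subr0; apply/esym/min_idPl.
    by rewrite divff ?gt_eqF//; have /andP[] := f01 x.
  pose O j := [set x | j%:R / k%:R < f x].
  have oO j : Ropen (O j).
    have := @Ropen_preimage R d f `]j%:R / k%:R, +oo[%classic bf.1 (@interval_open _ _ _ _ _).
    rewrite (_ : f @^-1` _ = O j); last by apply/seteqP; split=> x /=; rewrite in_itv/= andbT.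
    by apply.
  have mO j : measurable (O j) by exact: Ropen_measurable.
  have jS j : j.+1%:R / k%:R = j%:R / k%:R + k%:R^-1 :> R by rewrite -natr1 mulrDl mul1r.
  have sO j x : k%:R * s j x <= \1_(O j) x.
    rewrite indicE; have [xO|xO] := boolP (x \in O j); last first.
      have fj : f x <= j%:R / k%:R by move: xO; rewrite notin_setE /= => /negP; rewrite -leNgt.
      rewrite /s /c (min_idPl fj); have /min_idPl-> : f x <= j.+1%:R / k%:R.
        by rewrite jS; apply: le_trans fj _; rewrite lerDl invr_ge0 ltW.
      by rewrite subrr mulr0.
    move/set_mem : xO => /= fj.
    rewrite /s {2}/c (min_idPr (ltW fj)) -ler_pdivlMl// mulr1 lerBlDl -jS.
    by rewrite ge_min lexx orbT.
  have Os j x : \1_(O j.+1) x <= k%:R * s j x.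
    rewrite indicE; have [xO|xO] := boolP (x \in O j.+1); last first.
      by rewrite mulr_ge0 ?ler0n// subr_ge0.
    move/set_mem : xO => /= fj.
    have fj' : j%:R / k%:R <= f x.
      by apply: le_trans (ltW fj); rewrite jS lerDl invr_ge0 ltW.
    by rewrite /s /c (min_idPr (ltW fj)) (min_idPr fj') jS addrAC subrr add0r mulfV// gt_eqF.
  have LO j : L (s j) <= k%:R^-1 * lam (O j).
    rewrite ler_pdivlMl// -LZ//.
    apply: (@L_lam (O j) (fun x => k%:R * s j x)); split; first exact: bcontZ.
    by move=> x; rewrite sO andbT mulr_ge0 ?ler0n// subr_ge0.
  have bs' j : bmeas (s j) by exact: bcont_bmeas.
  have b1 j : bmeas (\1_(O j) : Rd -> R).
    split; first exact: measurable_indic.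
    by exists 1 => x; rewrite indicE normr_nat; case: (_ \in _).
  have Olam j : lam (O j) = pint P (\1_(O j)).
    transitivity (fine (P (O j))); first by rewrite PO.
    by rewrite /pint integral_indic// setIT.
  have Ls j : L (s j.+1) <= pint P (s j).
    apply: le_trans (LO _) _; rewrite ler_pdivrMl// Olam -pintZ//.
    by apply: le_pint => //; exact: bmeasZ.
  have L0 : L (s 0) <= k%:R^-1.
    apply: le_trans (LO _) _; rewrite -[leRHS]mulr1 ler_wpM2l ?invr_ge0 ?(ltW k0)//.
    by rewrite -lam_setT; exact: le_lam.
  have -> : L f = \sum_(j < k) L (s j).
    by rewrite -L_sum//; congr L; apply/funext.
  have -> : pint P f = \sum_(j < k) pint P (s j).
    by rewrite -pint_sum//; congr pint; apply/funext.
  rewrite /k big_ord_recl/= addrC; apply: lerD => //.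
  rewrite [leRHS]big_ord_recr/= -[leLHS]addr0; apply: lerD.
    by apply: ler_sum => j _; exact: Ls.
  rewrite -(pint_cst P 0); apply: le_pint => //; first exact: bmeas_cst.
  by move=> x; rewrite subr_ge0.
have key2 f : bcont f -> (forall x, 0 <= f x <= 1) -> pint P f = L f.
  move=> bf f01; apply/eqP; rewrite eq_le key// andbT.
  have bf1 : bcont (fun x => 1 - f x) by apply: bcontB => //; exact: bcont_cst.
  have := key (fun x => 1 - f x) bf1.
  rewrite LB//; last exact: bcont_cst.
  rewrite pintB; [|exact: bmeas_cst|exact: bcont_bmeas].
  rewrite pint_cst L1 lerD2l lerN2; apply => x.
  by have /andP[f0 f1] := f01 x; rewrite subr_ge0 f1 gerBl.
move=> f bf; have [_ [M fM]] := bf.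
pose B := `|M| + 1.
have B0 : 0 < B by rewrite ltr_wpDl.
have fB x : `|f x| <= B.
  by apply: le_trans (fM x) _; apply: le_trans (ler_norm _) _; rewrite lerDl.
have B20 : 0 < 2 * B by rewrite mulr_gt0.
pose g x := (2 * B)^-1 * (f x + B).
have bfB : bcont (fun x => f x + B) by apply: bcontD => //; exact: bcont_cst.
have bg : bcont g by exact: bcontZ.
have : pint P g = L g.
  apply: key2 => // x; have := fB x; rewrite ler_norml => /andP[h1 h2].
  apply/andP; split; first by rewrite mulr_ge0 ?invr_ge0 ?(ltW B20)//; lra.
  by rewrite ler_pdivrMl//; lra.
rewrite LZ// pintZ; last exact: bcont_bmeas.
move/mulfI => /(_ (invr_neq0 (lt0r_neq0 B20)))/=.
rewrite LD//; last exact: bcont_cst.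
rewrite pintD; [|exact: bcont_bmeas|exact: bmeas_cst].
by rewrite pint_cst L_cst => /addIr.
Qed.

End riesz.

(** * Weak compactness from a bound on a coercive moment *)

Section coercive_compactness.
Context (R : realType) (d : nat).
Local Notation Rd := (d.-tuple R).
Variable V : Rd -> R.
Hypothesis V_cont : Rcontinuous V.
Hypothesis V_coercive : forall M : R, exists r : R, forall x, r < enorm x -> M < V x.

Lemma edist0 (x : Rd) : edist x (Defs.x0 R d) = enorm x.
Proof.
rewrite /edist /enorm; congr Num.sqrt; apply: eq_bigr => i _.
by rewrite /Defs.x0 tnth_nseq subr0.
Qed.

Lemma sublevel_cube (T : R) : exists r : R, forall x, V x <= T -> forall i, `|tnth x i| <= r.
Proof.
have [r Hr] := V_coercive T.
exists r => x VT i.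
have xr : enorm x <= r by rewrite leNgt; apply/negP => /Hr; rewrite ltNge VT.
apply: le_trans xr; rewrite -edist0.
by have := le_edist_coord i x (Defs.x0 R d); rewrite /Defs.x0 tnth_nseq subr0.
Qed.

Lemma coercive_lower_bound : exists v : R, forall x, - v <= V x.
Proof.
have [r Hr] := sublevel_cube 0.
have := @cube_compact R d r nat (fun n => [set x | - n%:R < V x]).
case.
- move=> n; have := @Ropen_preimage R d V `]- n%:R, +oo[%classic V_cont (@interval_open _ _ _ _ _).
  rewrite (_ : V @^-1` _ = [set x | - n%:R < V x]).
    by apply.
  by apply/seteqP; split=> x /=; rewrite in_itv/= andbT.
- move=> x _; exists (Num.bound (- V x)) => //=.
  rewrite ltrNl; have [h|h] := leP 0 (- V x); first exact: archi_boundP.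
  by apply: lt_le_trans h _.
- move=> J fJ HJ.
  have [m Hm] : exists m : nat, forall j, J j -> (j <= m)%N.
    have [s sJ] := (finite_seqP J).1 fJ; exists (\max_(i <- s) i)%N => j.
    by rewrite sJ /= => js; exact: leq_bigmax_seq.
  exists m%:R => x; have [V0|V0] := leP (V x) 0; last first.
    by apply: ltW; apply: le_lt_trans V0; rewrite oppr_le0.
  have [j Jj /= h] := HJ x (Hr x V0).
  by apply: le_trans (ltW h); rewrite lerN2 ler_nat; exact: Hm.
Qed.

Hypothesis V_ge0 : forall x, 0 <= V x.
Variables (M : R) (M0 : 0 <= M).

Let K := [set mu : M1 R d | (\int[mu]_x (V x)%:E <= M%:E)%E].

Let mV : measurable_fun setT (fun x => (V x)%:E).
Proof. by apply/measurable_EFinP; exact: Rcontinuous_measurable. Qed.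

(** Where [V <= T], a set inside a compact cube, Dini's theorem makes [F n] uniformly small;
    elsewhere [F n <= B <= B / T * V], whose integral is bounded over [K]. *)
Lemma dini_tight (F : nat -> Rd -> R) : (forall n, bcont (F n)) ->
  (forall n m x, (n <= m)%N -> F m x <= F n x) ->
  (forall x, F n x @[n --> \oo] --> (0 : R)) ->
  forall e, 0 < e -> exists n, forall mu, K mu -> pint mu (F n) <= e.
Proof.
move=> bF ndF F0 e e0.
have F_ge0 n x : 0 <= F n x.
  rewrite leNgt; apply/negP => Fn.
  have /cvgrPdist_lt/(_ (- F n x))[] := F0 x; first by rewrite oppr_gt0.
  move=> k _ /(_ (maxn n k) (leq_maxr _ _)) /=.
  have h := ndF n (maxn n k) x (leq_maxl _ _).
  by rewrite sub0r normrN ltr0_norm ?(le_lt_trans h)// ltrN2 ltNge h.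
have [_ [B FB]] := bF 0%N.
have B0 : 0 <= B by apply: le_trans (FB (Defs.x0 R d)).
have FnB n x : F n x <= B.
  by apply: le_trans (ndF 0%N n x (leq0n _)) _; apply: le_trans (ler_norm _) (FB x).
have e20 : 0 < e / 2 by rewrite divr_gt0.
(* Makes the tail [B * M / T] at most [e / 2]; adding 1 keeps [T] positive. *)
pose T := 2 * (B * M) / e + 1.
have T0 : 0 < T by rewrite ltr_wpDl// divr_ge0 ?mulr_ge0// ltW.
have BMT : B * M / T <= e / 2.
  rewrite ler_pdivrMr// /T mulrDr mulr1.
  rewrite (_ : e / 2 * (2 * (B * M) / e) = B * M); first by rewrite lerDl ltW.
  by field; rewrite gt_eqF.
have [r Hr] := sublevel_cube T.
have [|x _|J fJ HJ] := @cube_compact R d r nat (fun n => [set x | F n x < e / 2]).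
- move=> n; have := @Ropen_preimage R d (F n) `]-oo, e / 2[%classic (bF n).1 (@interval_open _ _ _ _ _).
  rewrite (_ : F n @^-1` _ = [set x | F n x < e / 2]).
    by apply.
  by apply/seteqP; split=> x /=; rewrite in_itv.
- have /cvgrPdist_lt/(_ _ e20)[k _ /(_ k (leqnn k)) /=] := F0 x.
  by rewrite sub0r normrN ger0_norm// => h; exists k.
have [n Hn] : exists m : nat, forall j, J j -> (j <= m)%N.
  have [s sJ] := (finite_seqP J).1 fJ; exists (\max_(i <- s) i)%N => j.
  by rewrite sJ /= => js; exact: leq_bigmax_seq.
exists n => mu Kmu.
have FV x : F n x <= e / 2 + B / T * V x.
  have [VT|VT] := leP (V x) T.
    have [j Jj /= h] := HJ x (Hr x VT).
    apply: le_trans (le_trans (ndF _ _ x (Hn j Jj)) (ltW h)) _.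
    by rewrite lerDl mulr_ge0// divr_ge0// ltW.
  apply: le_trans (FnB n x) _; rewrite -[leLHS]add0r; apply: lerD; first exact: ltW.
  by rewrite mulrAC ler_pdivlMr// ler_wpM2l// ltW.
rewrite -lee_fin -pintE; last exact: bcont_bmeas.
apply: (@le_trans _ _ (\int[mu]_x ((e / 2)%:E + (B / T)%:E * (V x)%:E)%E)%E).
  by apply: ge0_le_integral_any => x; rewrite lee_fin.
have BT0 : 0 <= B / T by rewrite divr_ge0// ltW.
rewrite ge0_integralD//; last 3 first.
- by move=> x _; rewrite lee_fin ltW.
- by move=> x _; rewrite -EFinM lee_fin mulr_ge0.
- exact: measurable_funeM.
rewrite integral_cst//= probability_setT mule1 ge0_integralZl_EFin//; last by move=> x _; rewrite lee_fin.
apply: (@le_trans _ _ ((e / 2)%:E + (B / T)%:E * M%:E)%E).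
  by apply: leeD => //; apply: lee_wpmul2l => //; rewrite lee_fin.
rewrite -EFinM -EFinD lee_fin mulrAC [leRHS]splitr; exact: lerD.
Qed.

Let pint_ultra_cvg (G : set_system (M1 R d)) : UltraFilter G ->
  forall f, bcont f -> exists l : R, pint nu f @[nu --> G] --> l.
Proof.
move=> UG f bf; have PG : ProperFilter G by exact: ultra_proper.
have [_ [B fB]] := bf.
have := @segment_compact R (- B) B; rewrite compact_ultra => /(_ ((fun nu => pint nu f) @ G)).
case.
- exact: ultra_fmap.
- suff : G ((fun nu => pint nu f) @^-1` `[- B, B]) by [].
  apply: filterE => nu /=; rewrite in_itv/= -ler_norml.
  exact: (pint_norm_le nu (bcont_bmeas bf) fB).
- by move=> l [_ lG]; exists l.
Qed.

Lemma coercive_wcompact : wcompact K.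
Proof.
apply: ultra_cover_compact => G UG GK.
have PG : ProperFilter G by exact: ultra_proper.
have [L HL] : exists L : (Rd -> R) -> R, forall f, bcont f -> pint nu f @[nu --> G] --> L f.
  have h f : exists l : R, bcont f -> pint nu f @[nu --> G] --> l.
    (* A dummy value outside [bcont], so that [choice] yields a total functional. *)
    have [bf|nbf] := pselect (bcont f); last by exists 0 => /nbf.
    by have [l hl] := pint_ultra_cvg UG bf; exists l.
  by have [L HL] := choice h; exists L.
have Leq f l : bcont f -> pint nu f @[nu --> G] --> l -> L f = l.
  by move=> bf hl; apply: (cvg_unique (@norm_hausdorff _ R) (HL f bf) hl).
have Lle f (a : R) : bcont f -> G [set nu | pint nu f <= a] -> L f <= a.
  by move=> bf Ga; exact: (cvgr_to_le (HL f bf)).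
have Lge f g : bcont f -> bcont g -> (forall x, f x <= g x) -> L f <= L g.
  move=> bf bg fg; rewrite -subr_ge0.
  apply: (cvgr_to_ge (cvgB (HL g bg) (HL f bf))).
  by apply: (@filterE _ G) => nu; rewrite subr_ge0; apply: le_pint => //; exact: bcont_bmeas.
have [P PE] : exists P : M1 R d, forall f, bcont f -> pint P f = L f.
  apply: riesz_representation => //.
  - move=> f g bf bg; apply: Leq; first exact: bcontD.
    under eq_fun => nu do rewrite (pintD nu (bcont_bmeas bf) (bcont_bmeas bg)).
    by apply: cvgD; exact: HL.
  - move=> a f bf; apply: Leq; first exact: bcontZ.
    under eq_fun => nu do rewrite (pintZ nu a (bcont_bmeas bf)).
    by apply: cvgM; [exact: cvg_cst|exact: HL].
  - apply: Leq; first exact: bcont_cst.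
    under eq_fun => nu do rewrite pint_cst.
    exact: cvg_cst.
  - move=> F bF ndF F0 e e0; have [n Hn] := dini_tight bF ndF F0 e0.
    by exists n; apply: Lle => //; apply: filterS GK => nu; exact: Hn.
exists P; split; last first.
  move=> U oU /oU [n [f [e [bf e0 HU]]]].
  apply: (filterS HU); apply: filter_forall => i.
  have /cvgrPdist_lt/(_ _ e0) := HL _ (bf i).
  by apply: filterS => nu /=; rewrite PE// distrC.
(* [V] is not a test function: the moment bound passes to the limit for each truncation, and then to
   [V] by monotone convergence. *)
pose Vn n x := Num.min (V x) n%:R.
have bVn n : bcont (Vn n).
  split; first by apply: Rcontinuous_min => //; exact: Rcontinuous_cst.
  by exists n%:R => x; rewrite ger0_norm ?le_min ?V_ge0 ?ler0n// ge_min lexx orbT.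
have Vn_cvg x : (Vn n x)%:E @[n --> \oo] --> (V x)%:E.
  apply: (@cvg_trans _ ((fun=> (V x)%:E) @ \oo)); last exact: cvg_cst.
  apply: near_eq_cvg; exists (Num.bound (V x)) => // n /= Vxn.
  rewrite /Vn; congr EFin; apply/esym/min_idPl/ltW.
  by apply: (lt_le_trans (archi_boundP (V_ge0 x))); rewrite ler_nat.
rewrite /K /=.
have -> : (\int[P]_x (V x)%:E = \int[P]_x (limn (fun n => (Vn n x)%:E)))%E.
  by apply: eq_integral => x _; apply/esym/cvg_lim => //; exact: Vn_cvg.
have mVn n : measurable_fun setT (fun x => (Vn n x)%:E).
  by apply/measurable_EFinP; exact: (bcont_bmeas (bVn n)).1.
have Vn0 n x : (0 <= (Vn n x)%:E)%E by rewrite lee_fin le_min V_ge0 ler0n.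
have ndVn x n m : (n <= m)%N -> ((Vn n x)%:E <= (Vn m x)%:E)%E.
  move=> nm; rewrite lee_fin le_min ge_min lexx/= ge_min; apply/orP; right.
  by rewrite ler_nat.
rewrite monotone_convergence//; last by move=> x _ n m; exact: ndVn.
apply: lime_le.
  by apply: ereal_nondecreasing_is_cvgn => n m nm; apply: ge0_le_integral_any => // x; exact: ndVn.
apply: nearW => n; rewrite pintE; last exact: bcont_bmeas.
rewrite lee_fin PE//; apply: Lle => //.
apply: filterS GK => nu Knu /=; rewrite -lee_fin -pintE; last exact: bcont_bmeas.
apply: le_trans Knu; apply: ge0_le_integral_any => x.
  by rewrite lee_fin le_min V_ge0 ler0n.
by rewrite lee_fin ge_min lexx.
Qed.

End coercive_compactness.

(** * Empirical measures and the energy kernel *)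

Lemma ereal_dense_lt (R : realType) (a : R) (x : \bar R) : (a%:E < x)%E ->
  exists w : R, a < w /\ (w%:E < x)%E.
Proof.
case: x => [x| |] //.
  by rewrite lte_fin => ax; exists ((a + x) / 2); rewrite lte_fin; split; lra.
by move=> _; exists (a + 1); rewrite ltrDl ltr01 ltry.
Qed.

Lemma sum_offdiagonal (R : comNzRingType) n (g : 'I_n -> 'I_n -> R) :
  \sum_(i < n) \sum_(j < n | (i < j)%N) (g i j + g j i) + \sum_(i < n) g i i =
  \sum_(i < n) \sum_(j < n) g i j.
Proof.
have E : \sum_(i < n) \sum_(j < n | (i < j)%N) g j i =
    \sum_(i < n) \sum_(j < n | (j < i)%N) g i j.
  rewrite (exchange_big_dep xpredT)//=.
under eq_bigr do rewrite big_split/=.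
rewrite big_split/= E -!big_split/=; apply: eq_bigr => i _.
rewrite [RHS](bigD1 i)//= addrC; congr (_ + _).
rewrite [RHS](bigID (fun j : 'I_n => (i < j)%N))/=; congr (_ + _); apply: eq_bigl => j.
  by rewrite andbC; case: ltnP => //= ij; apply/esym/negP => /eqP ji; rewrite ji ltnn in ij.
by rewrite -leqNgt [RHS]andbC -val_eqE/= ltn_neqAle andbC.
Qed.

(** For [b < 0] the integrand [F] changes sign while the integral of [f] may be infinite. The
    identity between the positive part of [F] plus [- b] and [f] plus the negative part of [F] has
    nonnegative terms only, and the negative part has integral at most [- b], so it can be
    subtracted. *)
Lemma integral_ge0D_cst d (T : measurableType d) (R : realType) (mu : probability T R)
    (f : T -> \bar R) (b : R) : measurable_fun setT f -> (forall x, (0 <= f x)%E) ->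
  (\int[mu]_x (f x + b%:E) = \int[mu]_x f x + b%:E)%E.
Proof.
move=> mf f0.
have mu1 (r : R) : (\int[mu]_x r%:E = r%:E)%E.
  by rewrite integral_cst//= probability_setT mule1.
have [b0|b0] := leP 0 b.
  by rewrite ge0_integralD// mu1.
pose F (x : T) : \bar R := (f x + b%:E)%E.
have mF : measurable_fun setT F by apply: emeasurable_funD.
have E : (\int[mu]_x (F^\+ x + (- b)%:E) = \int[mu]_x (f x + F^\- x))%E.
  apply: eq_integral => x _; rewrite funeposE funenegE /F.
  have := f0 x; case: (f x) => [r| |]//= r0.
    rewrite lee_fin in r0; rewrite /= -!EFin_max -!EFinD; congr EFin.
    rewrite !maxEle; case: ifPn => h1; case: ifPn => h2; lra.
  by rewrite /= maxye maxNye.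
have nb : (0 <= \int[mu]_x F^\- x)%E by apply: integral_ge0.
have nfin : (\int[mu]_x F^\- x)%E \is a fin_num.
  rewrite ge0_fin_numE//; apply: (@le_lt_trans _ _ (- b)%:E); last exact: ltry.
  rewrite -(mu1 (- b)); apply: ge0_le_integral_any => // x.
  rewrite funenegE /F ge_max; apply/andP; split; last by rewrite lee_fin oppr_ge0 ltW.
  have := f0 x; case: (f x) => [r| |]//= r0.
    by rewrite /= lee_fin; rewrite lee_fin in r0; lra.
  by rewrite leNye.
have mp : measurable_fun setT (F^\+)%E by exact: measurable_funepos.
have mn : measurable_fun setT (F^\-)%E by exact: measurable_funeneg.
have b'0 (x : T) : setT x -> (0 <= (- b)%:E)%E by rewrite lee_fin oppr_ge0 ltW.
have Fp x : setT x -> (0 <= F^\+ x)%E by rewrite funeposE le_max lexx orbT.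
have Fn x : setT x -> (0 <= F^\- x)%E by rewrite funenegE le_max lexx orbT.
rewrite (ge0_integralD mu measurableT Fp mp b'0)// mu1 in E.
rewrite (ge0_integralD mu measurableT (fun x _ => f0 x) mf Fn mn) in E.
rewrite -/F integralE.
move: E nfin nb; set p := (\int[mu]_x F^\+ x)%E; set n := (\int[mu]_x F^\- x)%E.
have p0 : (0 <= p)%E by apply: integral_ge0.
have i0 : (0 <= \int[mu]_x f x)%E by apply: integral_ge0.
move: p0 i0; set i := (\int[mu]_x f x)%E.
case: n => [n| |]//; case: p => [p| |]//; case: i => [i| |]//= _ _.
by rewrite -!EFinD => -[E] _ _; congr EFin; lra.
Qed.

(** * Integrals against empirical measures *)

Section empirical_measure.
Context (R : realType) (d : nat).
Local Notation Rd := (d.-tuple R).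
Variables (N : nat) (N0 : (0 < N)%N) (x : N.-tuple Rd).

Lemma integral_empN (f : Rd -> \bar R) : measurable_fun setT f -> (forall y, (0 <= f y)%E) ->
  (\int[empN x]_y f y = (N%:R^-1)%:E * \sum_(i < N) f (tnth x i))%E.
Proof.
move=> mf f0.
have NR0 : 0 < N%:R :> R by rewrite ltr0n.
have N'0 : 0 <= N%:R^-1 :> R by rewrite invr_ge0 ltW.
pose ds (i : nat) : {measure set Rd -> \bar R} := @dirac _ Rd (nth (Defs.x0 R d) x i) R.
rewrite (@eq_measure_integral _ _ _ _ (mscale (NngNum N'0) (msum ds N))); last first.
  move=> A mA _; rewrite /empN /= /mnormalize /mscale/=.
  have -> : msum ds N setT = N%:R%:E.
    rewrite /msum/=; under eq_bigr do rewrite diracT.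
    by rewrite sumEFin sumr_const card_ord.
  (* The total mass [N] is neither 0 nor [+oo], so [mnormalize] divides by it instead of returning
     its default. *)
  by rewrite eqe gt_eqF//= muleC.
rewrite ge0_integral_mscale// ge0_integral_measure_sum//; congr (_ * _)%E.
apply: eq_bigr => i _.
by rewrite integral_dirac// diracT mul1e (tnth_nth (Defs.x0 R d)).
Qed.

Lemma pint_empN (f : Rd -> R) : bmeas f -> pint (empN x) f = N%:R^-1 * \sum_(i < N) f (tnth x i).
Proof.
move=> bf; have [mf [M fM]] := bf.
have bM : bmeas (fun _ : Rd => `|M|) by exact: bmeas_cst.
(* A shift makes the integrand nonnegative, as [integral_empN] requires. *)
have bfM : bmeas (fun y => f y + `|M|) by exact: bmeasD.
have : (pint (empN x) (fun y => f y + `|M|))%:E =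
    (N%:R^-1 * \sum_(i < N) (f (tnth x i) + `|M|))%:E.
  rewrite -pintE// integral_empN; first by rewrite sumEFin.
    by apply/measurable_EFinP; exact: bfM.1.
  move=> y; rewrite lee_fin -lerBlDr sub0r; have := le_trans (fM y) (ler_norm M).
  by rewrite ler_norml => /andP[].
rewrite pintD// pint_cst big_split/= sumr_const card_ord => -[].
by rewrite mulrDr -(mulr_natl `|M|) mulrA mulVf ?pnatr_eq0 -?lt0n// mul1r => /addIr.
Qed.

End empirical_measure.

(** The pointwise consequences of (H1), (H2) and (H3), with the constants made explicit: [a] is the
    fraction of the confinement that the interaction cannot cancel. *)
Record admissible (R : realType) (d : nat) (V : d.-tuple R -> R)
    (W : d.-tuple R -> d.-tuple R -> \bar R) (v0 a b : R) : Prop := Admissible {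
  adm_V_cont : Rcontinuous V;
  adm_V_coercive : forall M : R, exists r : R, forall x, r < enorm x -> M < V x;
  adm_W_cont : econtinuous2 W;
  adm_W_sym : forall x y, W x y = W y x;
  adm_W_ninfty : forall x y, W x y != -oo%E;
  adm_V_lb : forall x, - v0 <= V x;
  adm_a_gt0 : 0 < a;
  adm_W_lb : forall x y,
    ((a * (V x + v0 + (V y + v0)) + b)%:E <= (V x + V y)%:E + W x y)%E }.

(** * The Hamiltonian in terms of the nonnegative kernel *)

Section model.
Context (R : realType) (d : nat).
Local Notation Rd := (d.-tuple R).
Variables (V : Rd -> R) (W : Rd -> Rd -> \bar R).
Variables (v0 a b : R).
Hypothesis adm : admissible V W v0 a b.
Let V_cont := adm_V_cont adm.
Let W_cont := adm_W_cont adm.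
Let W_sym := adm_W_sym adm.
Let W_ninfty := adm_W_ninfty adm.
Let V_lb := adm_V_lb adm.
Let a0 := adm_a_gt0 adm.
Let W_lb := adm_W_lb adm.

Definition shiftV (x : Rd) : R := V x + v0.
Local Notation Vt := shiftV.
Definition kernel (x y : Rd) : \bar R := ((V x + V y - b)%:E + W x y)%E.
Local Notation G := kernel.

Lemma shiftV_ge0 x : 0 <= Vt x.
Proof. by rewrite /shiftV -lerBlDr sub0r. Qed.

Lemma shiftV_cont : Rcontinuous Vt.
Proof. by apply: RcontinuousD => //; exact: Rcontinuous_cst. Qed.

Lemma kernelE x y : ((V x + V y)%:E + W x y = G x y + b%:E)%E.
Proof.
rewrite /kernel addeAC -EFinD subrK.
by have := W_ninfty x y; case: (W x y).
Qed.

Lemma kernel_lb x y : ((a * (Vt x + Vt y))%:E <= G x y)%E.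
Proof.
have := W_lb x y; rewrite kernelE EFinD -/(Vt x) -/(Vt y).
by rewrite leeD2rE.
Qed.

Lemma kernel_ge0 x y : (0 <= G x y)%E.
Proof.
apply: le_trans (kernel_lb x y); rewrite lee_fin mulr_ge0 ?(ltW a0)//.
by rewrite addr_ge0 ?shiftV_ge0.
Qed.

Lemma kernel_sym x y : G x y = G y x.
Proof. by rewrite /kernel W_sym (addrC (V x)). Qed.

Lemma kernel_lsc : lsc2 G.
Proof.
move=> x y r rG.
have rW : ((r - (V x + V y - b))%:E < W x y)%E.
  by rewrite EFinB lteBlDl.
have [w [rw wW]] := ereal_dense_lt rW.
(* A real [w] is placed strictly between so that the margin is finite even where [W] is [+oo]; each
   of the two values of [V] may use half of it. *)
have dl0 : 0 < (w - (r - (V x + V y - b))) / 2 by rewrite divr_gt0// subr_gt0.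
set dl := _ / 2 in dl0.
have [e1 e10 H1] := V_cont x dl0; have [e2 e20 H2] := V_cont y dl0.
have [e3 /= e30 H3] : nbhs2 (x, y) [set q | (w%:E < W q.1 q.2)%E].
  have h : nbhs (W x y) [set u | (w%:E < u)%E] by exact: (open_ereal_gt' wW).
  by have /(_ _ h) := @W_cont (x, y).
exists (Num.min e1 (Num.min e2 e3)); first by rewrite !lt_min e10 e20.
move=> u v; rewrite !lt_min => /and3P[u1 u2 u3] /and3P[v1 v2 v3].
have := H3 (u, v) (conj u3 v3) => /= wuv.
have := H1 u u1; have := H2 v v2; rewrite !ltr_norml => /andP[A1 _] /andP[A2 _].
rewrite /kernel; apply: (@le_lt_trans _ _ ((V u + V v - b)%:E + w%:E)%E).
  rewrite -EFinD lee_fin; move: A1 A2; rewrite /dl; lra.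
by rewrite lteD2lE.
Qed.

Lemma Ifun_energy mu : Ifun V W mu = ((2^-1)%:E * (energy G mu + b%:E))%E.
Proof.
rewrite /Ifun /energy; congr (_ * _)%E.
have key (f : Rd -> \bar R) : measurable_fun setT f -> (forall x, 0 <= f x)%E ->
    (\int[mu]_x (f x + b%:E) = \int[mu]_x f x + b%:E)%E.
  exact: integral_ge0D_cst.
transitivity (\int[mu]_x (\int[mu]_y G x y + b%:E))%E.
  apply: eq_integral => x _; rewrite -key; first by apply: eq_integral => y _; rewrite kernelE.
    exact: (kernel_measurable kernel_lsc).
  exact: kernel_ge0.
rewrite key//; first exact: (kernel_section_measurable kernel_ge0 kernel_lsc).
by move=> x; apply: integral_ge0 => y _; exact: kernel_ge0.
Qed.

(** Equal to [N ^ 2 H_N] up to an explicit constant: each point occurs in [N - 1] pairs, and the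
    first sum supplies the missing copy of its potential. *)
Definition pair_energy N (x : N.-tuple Rd) : \bar R :=
  (\sum_(i < N) (Vt (tnth x i))%:E +
   \sum_(i < N) \sum_(j < N | (i < j)%N) G (tnth x i) (tnth x j))%E.

Let sum_pairs N (x : N.-tuple Rd) (f : Rd -> R) :
  \sum_(i < N) \sum_(j < N | (i < j)%N) (f (tnth x i) + f (tnth x j)) =
  (N%:R - 1) * \sum_(i < N) f (tnth x i).
Proof.
have := sum_offdiagonal (fun i j : 'I_N => f (tnth x i)).
under [X in _ = X -> _]eq_bigr do rewrite sumr_const card_ord.
by move=> E; rewrite mulrBl mul1r mulr_natl -sumrMnl -E addrK.
Qed.

Let sum_pairs_cst N (c : R) :
  \sum_(i < N) \sum_(j < N | (i < j)%N) c = c * (N%:R ^+ 2 - N%:R) / 2.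
Proof.
have := sum_offdiagonal (fun i j : 'I_N => c / 2).
rewrite !sumr_const !card_ord.
under eq_bigr do under eq_bigr do rewrite -splitr.
rewrite -[X in _ + X = _]mulr_natr -[RHS]mulr_natr -[X in _ = X * _]mulr_natr => E.
have -> : c * (N%:R ^+ 2 - N%:R) / 2 = c / 2 * N%:R * N%:R - c / 2 * N%:R by field.
by rewrite -E addrK.
Qed.

Lemma HN_pair_energy N (x : N.-tuple Rd) : (0 < N)%N ->
  HN V W x = ((N%:R ^- 2)%:E * pair_energy x +
    (b * (N%:R - 1) / (2 * N%:R) - v0 / N%:R)%:E)%E.
Proof.
move=> N0; have NR : N%:R != 0 :> R by rewrite pnatr_eq0 -lt0n.
rewrite /HN /pair_energy /G.
under [X in (_ * (_ + X))%E]eq_bigr do rewrite big_split/= sumEFin.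
rewrite big_split/= !sumEFin addeA -EFinD.
set SW := (\sum_(i < N) _)%E.
rewrite muleDr//.
rewrite addeAC; congr (_ + _)%E; rewrite -EFinM -EFinD; congr EFin.
have -> : \sum_(i < N) \sum_(j < N | (i < j)%N) (V (tnth x i) + V (tnth x j) - b) =
    (N%:R - 1) * \sum_(i < N) V (tnth x i) - b * (N%:R ^+ 2 - N%:R) / 2.
  by rewrite -sum_pairs -sum_pairs_cst -sumrB; apply: eq_bigr => i _; rewrite sumrB.
rewrite /shiftV big_split/= sumr_const card_ord -(mulr_natl v0).
by field.
Qed.

Lemma pair_energy_lbV N (x : N.-tuple Rd) :
  ((a * (N%:R - 1) * \sum_(i < N) Vt (tnth x i))%:E <= pair_energy x)%E.
Proof.
rewrite /pair_energy -mulrA -sum_pairs -[X in (X <= _)%E]add0e; apply: leeD.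
  by rewrite sumEFin lee_fin; apply: sumr_ge0 => i _; exact: shiftV_ge0.
rewrite mulr_sumr -sumEFin; apply: lee_sum => i _.
by rewrite mulr_sumr -sumEFin; apply: lee_sum => j _; exact: kernel_lb.
Qed.

Lemma pair_energy_ge0 N (x : N.-tuple Rd) : (0 <= pair_energy x)%E.
Proof.
apply: adde_ge0; first by apply: sume_ge0 => i _; rewrite lee_fin shiftV_ge0.
by apply: sume_ge0 => i _; apply: sume_ge0 => j _; exact: kernel_ge0.
Qed.

(** The approximate energy of [empN x] includes the diagonal, where the minorant is at most [n]:
    this is the loss [N * n]. The two orders of a pair are averaged, both minorants being below the
    symmetric [G]. *)
Lemma pair_energy_lb N (x : N.-tuple Rd) n : (0 < N)%N ->
  (((N%:R ^+ 2 * energy_approx G n (empN x) - N%:R * n%:R) / 2)%:E <= pair_energy x)%E.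
Proof.
move=> N0; have NR : N%:R != 0 :> R by rewrite pnatr_eq0 -lt0n.
pose g (i j : 'I_N) := moreau_yosida G n (tnth x i) (tnth x j).
have E : N%:R ^+ 2 * energy_approx G n (empN x) = \sum_(i < N) \sum_(j < N) g i j.
  rewrite /energy_approx pint_empN//; last exact: (pint_moreau_yosida_bmeas kernel_ge0).
  under eq_bigr => i _ do rewrite (pint_empN N0 x (moreau_yosida_bmeas kernel_ge0 n (tnth x i))).
  by rewrite -mulr_sumr /g; field.
rewrite E -sum_offdiagonal.
apply: (@le_trans _ _ (\sum_(i < N) \sum_(j < N | (i < j)%N) (g i j + g j i) / 2)%:E).
  rewrite lee_fin; under [leRHS]eq_bigr do rewrite -mulr_suml.
  rewrite -mulr_suml ler_pM2r ?invr_gt0// -addrA gerDl subr_le0.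
  apply: le_trans (ler_sum _ (fun i _ => moreau_yosida_le_nat kernel_ge0 n (tnth x i) (tnth x i))) _.
  by rewrite sumr_const card_ord mulr_natl.
rewrite /pair_energy -[X in (X <= _)%E]add0e; apply: leeD.
  by rewrite sumEFin lee_fin; apply: sumr_ge0 => i _; exact: shiftV_ge0.
rewrite -sumEFin; apply: lee_sum => i _; rewrite -sumEFin; apply: lee_sum => j _.
have h1 : ((g i j)%:E <= G (tnth x i) (tnth x j))%E := moreau_yosida_le kernel_ge0 n _ _.
have h2 : ((g j i)%:E <= G (tnth x i) (tnth x j))%E.
  by rewrite kernel_sym; exact: (moreau_yosida_le kernel_ge0).
case: (G (tnth x i) (tnth x j)) h1 h2 => [r| |]//.
- by rewrite !lee_fin => h1 h2; lra.
- by move=> _ _; exact: leey.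
Qed.

Lemma measurable_pair_energy N : measurable_fun setT (@pair_energy N).
Proof.
apply: emeasurable_funD.
  apply: emeasurable_sum => i; apply/measurable_EFinP.
  apply: (measurableT_comp (Rcontinuous_measurable shiftV_cont)).
  exact: measurable_tnth.
apply: emeasurable_sum => i; under eq_fun do rewrite big_mkcond.
apply: emeasurable_sum => j; case: (i < j)%N => //.
have mij : measurable_fun setT (fun x : N.-tuple Rd => (tnth x i, tnth x j)).
  by apply: measurable_fun_pair; exact: measurable_tnth.
exact: (measurableT_comp (lsc2_measurable kernel_lsc) mij).
Qed.

End model.

(** * Upper bound *)

Section log_scale.
Context (R : realType).
Implicit Types (beta c l : R) (z : \bar R) (u : nat -> \bar R).
Local Open Scope ereal_scope.

Let mem_ge0 z : 0 <= z -> z \in `[0, +oo].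
Proof. by move=> z0; rewrite in_itv/= z0 leey. Qed.

Lemma scaled_lne_le beta c z : (0 < beta)%R -> 0 <= z -> z <= (expR (beta * c))%:E ->
  (beta^-1)%:E * lne z <= c%:E.
Proof.
move=> b0 z0 zc.
have h : lne z <= (beta * c)%:E.
  by rewrite -[X in _ <= X]expeRK lee_lne//; apply: mem_ge0; rewrite ?expeR_ge0.
rewrite (_ : c%:E = (beta^-1)%:E * (beta * c)%:E); last first.
  by rewrite -EFinM mulrA mulVf ?gt_eqF// mul1r.
by apply: lee_wpmul2l => //; rewrite lee_fin invr_ge0 ltW.
Qed.

Lemma le_scaled_lne beta c z : (0 < beta)%R -> (expR (beta * c))%:E <= z ->
  c%:E <= (beta^-1)%:E * lne z.
Proof.
move=> b0 zc.
have z0 : 0 <= z by apply: le_trans zc; rewrite lee_fin expR_ge0.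
have h : (beta * c)%:E <= lne z.
  by rewrite -[X in X <= _]expeRK lee_lne//; apply: mem_ge0; rewrite ?expeR_ge0.
rewrite (_ : c%:E = (beta^-1)%:E * (beta * c)%:E); last first.
  by rewrite -EFinM mulrA mulVf ?gt_eqF// mul1r.
by apply: lee_wpmul2l => //; rewrite lee_fin invr_ge0 ltW.
Qed.

Lemma limn_esup_le_near u z : (\forall n \near \oo, u n <= z) -> limn_esup u <= z.
Proof.
move=> [n _ Hn]; rewrite limn_esup_lim; apply: lime_le; first exact: is_cvg_esups.
exists n => // m /= nm; apply: ge_ereal_sup => _ [k /= mk <-].
by apply: Hn; exact: leq_trans nm mk.
Qed.

Lemma limn_einf_ge_near u z : (\forall n \near \oo, z <= u n) -> z <= limn_einf u.
Proof.
move=> [n _ Hn]; rewrite limn_einf_lim; apply: lime_ge; first exact: is_cvg_einfs.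
exists n => // m /= nm; apply: le_ereal_inf_tmp => _ [k /= mk <-].
by apply: Hn; exact: leq_trans nm mk.
Qed.

(** Treats finite and infinite infima of the rate function alike, including the value [+oo] over an
    empty set. *)
Lemma lee_oppr_dense (x y : \bar R) : (forall l : R, l%:E < y -> x <= (- l)%:E) -> x <= - y.
Proof.
move=> h; case: y h => [y| |] h.
- apply/lee_addgt0Pr => e e0; rewrite -EFinN -EFinD.
  rewrite addrC -opprB; apply: h.
  by rewrite lte_fin gtrBl.
- case: x h => [x| |] h; last by rewrite leNye.
    have := h (1 - x)%R (ltry _); rewrite lee_fin => ?; exfalso; lra.
  by have := h 0%R (ltry _); rewrite leye_eq.
- by rewrite leey.
Qed.

Lemma near_ge_nat (c : R) : \forall N \near \oo, (c <= N%:R)%R.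
Proof.
exists (Num.bound `|c|%R) => // N /= cN; apply: (le_trans (ler_norm c)).
by apply: (le_trans (ltW (archi_boundP (normr_ge0 c)))); rewrite ler_nat.
Qed.

End log_scale.

(** * Compact sublevels, minimizers and uniform lower bounds of the energy *)

Section energy_landscape.
Context (R : realType) (d : nat).
Local Notation Rd := (d.-tuple R).
Variables (V : Rd -> R) (W : Rd -> Rd -> \bar R) (v0 a b : R).
Hypothesis adm : admissible V W v0 a b.
Local Notation Vt := (shiftV V v0).
Local Notation G := (kernel V W b).
Local Notation E := (energy G).
Implicit Types (mu nu : M1 R d) (S : set (M1 R d)).

Let a0 := adm_a_gt0 adm.
Let G0 := kernel_ge0 adm.
Let lscG := kernel_lsc adm.

Lemma shiftV_coercive (M : R) : exists r : R, forall x, r < enorm x -> M < Vt x.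
Proof.
have [r Hr] := adm_V_coercive adm (M - v0).
by exists r => x /Hr; rewrite /shiftV ltrBlDr.
Qed.

Lemma shiftV_wcompact (T : R) : 0 <= T -> wcompact [set mu : M1 R d | (\int[mu]_x (Vt x)%:E <= T%:E)%E].
Proof.
exact: (coercive_wcompact (shiftV_cont adm) shiftV_coercive (shiftV_ge0 adm)).
Qed.

Lemma measurable_shiftV : measurable_fun setT (fun x => (Vt x)%:E).
Proof. by apply/measurable_EFinP; exact: (Rcontinuous_measurable (shiftV_cont adm)). Qed.

Lemma energy_lbV mu : (a%:E * \int[mu]_x (Vt x)%:E <= E mu)%E.
Proof.
have V0 x : (0 <= (Vt x)%:E)%E by rewrite lee_fin (shiftV_ge0 adm).
rewrite -ge0_integralZl_EFin//; [|exact: measurable_shiftV|exact: ltW].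
apply: ge0_le_integral_any => x; first by rewrite mule_ge0// lee_fin ltW.
apply: (@le_trans _ _ (\int[mu]_y ((a * Vt x)%:E))%E).
  by rewrite integral_cst//= probability_setT mule1 EFinM.
apply: ge0_le_integral_any => y.
  by rewrite lee_fin mulr_ge0 ?(shiftV_ge0 adm) ?ltW.
apply: le_trans (kernel_lb adm x y); rewrite lee_fin ler_pM2l// lerDl.
exact: shiftV_ge0 adm y.
Qed.

Lemma energy_ge0 mu : (0 <= E mu)%E.
Proof. by apply: integral_ge0 => x _; apply: integral_ge0 => y _; exact: G0. Qed.

Lemma energy_wcompact (r : R) S : wclosed S -> wcompact ([set mu : M1 R d | (E mu <= r%:E)%E] `&` S).
Proof.
move=> cS.
have cK : wclosed [set mu : M1 R d | (E mu <= r%:E)%E] by exact: (wclosed_energy_le G0 lscG).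
have K0 : 0 <= `|r| / a by rewrite divr_ge0// ltW.
have sub : [set mu : M1 R d | (E mu <= r%:E)%E] `<=` [set mu : M1 R d | (\int[mu]_x (Vt x)%:E <= (`|r| / a)%:E)%E].
  move=> mu /= Er; have h := le_trans (energy_lbV mu) Er.
  have i0 : (0 <= \int[mu]_x (Vt x)%:E)%E.
    by apply: integral_ge0 => x _; rewrite lee_fin (shiftV_ge0 adm).
  move: h i0; case: (\int[mu]_x (Vt x)%:E)%E => [i| |]//.
    rewrite -EFinM !lee_fin => h i0; rewrite ler_pdivlMr// mulrC.
    exact: le_trans h (ler_norm r).
  by rewrite gt0_muley ?lte_fin.
have -> : [set mu : M1 R d | (E mu <= r%:E)%E] `&` S =
    [set mu : M1 R d | (\int[mu]_x (Vt x)%:E <= (`|r| / a)%:E)%E] `&` ([set mu : M1 R d | (E mu <= r%:E)%E] `&` S).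
  by rewrite setIA; congr (_ `&` _); apply/esym/setIidPr.
apply: (wclosed_wcompact (shiftV_wcompact K0)).
apply/wopenP => mu; rewrite setCI => -[h|h].
  by apply: filterS (cK mu h) => nu h'; left.
by apply: filterS (cS mu h) => nu h'; right.
Qed.

Lemma wopen_energy_gt (r : R) : wopen [set mu : M1 R d | (r%:E < E mu)%E].
Proof.
have : wclosed [set mu : M1 R d | (E mu <= r%:E)%E] by exact: (wclosed_energy_le G0 lscG).
rewrite /wclosed; suff -> : ~` [set mu : M1 R d | (E mu <= r%:E)%E] = [set mu : M1 R d | (r%:E < E mu)%E] by [].
by apply/seteqP; split=> mu /=; rewrite ltNge => /negP.
Qed.

Lemma finite_index_bound (J : set nat) : finite_set J ->
  exists m : nat, forall j, J j -> (j <= m)%N.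
Proof.
move=> /finite_seqP[s sJ]; exists (\max_(i <- s) i)%N => j.
by rewrite sJ /= => js; exact: leq_bigmax_seq.
Qed.

(** Otherwise the open sets where the energy exceeds the infimum by more than [1 / (n + 1)] would
    cover a compact sublevel of [S], and finitely many of them would keep the energy away from its
    infimum. *)
Lemma energy_min_attained S : wclosed S -> S !=set0 ->
  exists2 mu, S mu & forall nu, S nu -> (E mu <= E nu)%E.
Proof.
move=> cS [nu0 Snu0].
have [Efin|] := eqVneq (ereal_inf (E @` S)) +oo%E.
  exists nu0 => // nu Snu; suff -> : E nu = +oo%E by rewrite leey.
  by apply/eqP; rewrite -leye_eq -Efin; apply: ereal_inf_lbound; exists nu.
set m := ereal_inf _ => mfin.
have m0 : (0 <= m)%E by apply: le_ereal_inf_tmp => _ [mu _ <-]; exact: energy_ge0.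
have [r mr] : exists r : R, m = r%:E.
  by move: m0 mfin; case: m => [r| |]// _ _; exists r.
apply: contrapT => noatt.
have := @energy_wcompact (r + 1) S cS nat (fun n => [set mu : M1 R d | ((r + n.+1%:R^-1)%:E < E mu)%E]).
case.
- by move=> n; exact: wopen_energy_gt.
- move=> mu [_ Smu].
  have rE : (r%:E < E mu)%E.
    rewrite ltNge; apply/negP => h; apply: noatt; exists mu => // nu Snu.
    by apply: le_trans h _; rewrite -mr; apply: ereal_inf_lbound; exists nu.
  have [w [rw wE]] := ereal_dense_lt rE.
  have wr0 : 0 < w - r by rewrite subr_gt0.
  have [n _ /(_ n (leqnn n)) /= Hn] := near_infty_natSinv_lt (PosNum wr0).
  exists n => //=; apply: lt_trans wE; rewrite lte_fin -ltrBrDl; exact: Hn.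
- move=> J /finite_index_bound[n Jn] HJ.
  have n0 : 0 < n.+1%:R^-1 :> R by rewrite invr_gt0.
  have mfn : ereal_inf (E @` S) \is a fin_num by rewrite -/m mr.
  have [_ [mu Smu <-] hmu] := lb_ereal_inf_adherent n0 mfn.
  rewrite -/m mr -EFinD in hmu.
  have [|j Jj /=] := HJ mu.
    split => //=; apply: le_trans (ltW hmu) _; rewrite lee_fin lerD2l invf_le1//.
    by rewrite ler1n.
  rewrite ltNge => /negP; apply; apply: le_trans (ltW hmu) _.
  by rewrite lee_fin lerD2l lef_pV2 ?posrE ?ltr0n// ler_nat ltnS; exact: Jn.
Qed.

Lemma energy_approx_uniform S (T m : R) : 0 <= T -> wclosed S ->
  (forall mu, S mu -> (m%:E < E mu)%E) ->
  exists n, forall mu, S mu -> (\int[mu]_x (Vt x)%:E <= T%:E)%E -> m < energy_approx G n mu.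
Proof.
move=> T0 cS Sm.
have := wclosed_wcompact (shiftV_wcompact T0) cS (I := nat)
  (U := fun n => [set mu : M1 R d | m < energy_approx G n mu]).
case.
- by move=> n; exact: (wopen_energy_approx_gt G0).
- by move=> mu [_ /Sm /(energy_approx_gt G0 lscG)[n mn]]; exists n.
- move=> J /finite_index_bound[n Jn] HJ; exists n => mu Smu VT.
  have [j Jj /= mj] := HJ mu (conj VT Smu).
  apply: lt_le_trans mj _; apply: (energy_approx_nondecreasing G0); exact: Jn.
Qed.

(** Compactness handles empirical measures whose moment of [Vt] is at most [|m| / a]. Above this
    threshold the confinement alone gives [N * (N - 1) * |m|], which is at least [N ^ 2 * m / 2] as
    soon as [N >= 2]. *)
Lemma pair_energy_uniform S (m : R) : wclosed S -> (forall mu, S mu -> (m%:E < E mu)%E) ->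
  exists n : nat, forall N (x : N.-tuple Rd), (1 < N)%N -> S (empN x) ->
    (((N%:R ^+ 2 * m - N%:R * n%:R) / 2)%:E <= pair_energy V W v0 b x)%E.
Proof.
move=> cS Sm.
have T0 : 0 <= `|m| / a by rewrite divr_ge0// ltW.
have [n Hn] := energy_approx_uniform T0 cS Sm.
exists n => N x N1 Sx; have N0 : (0 < N)%N by exact: ltnW.
have NR : 0 < N%:R :> R by rewrite ltr0n.
have [VT|VT] := leP (\int[empN x]_y (Vt y)%:E)%E (`|m| / a)%:E.
  apply: le_trans (pair_energy_lb adm x n N0); rewrite lee_fin ler_pM2r ?invr_gt0//.
  by rewrite lerD2r ler_pM2l ?exprn_gt0// ltW// Hn.
apply: le_trans (pair_energy_lbV adm x); rewrite lee_fin.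
move: VT; rewrite integral_empN//; [|exact: measurable_shiftV|by move=> y; rewrite lee_fin (shiftV_ge0 adm)].
rewrite sumEFin -EFinM lte_fin; set s := \sum_(i < N) _ => h.
have h' : N%:R * `|m| < a * s.
  move: h; rewrite ltr_pdivrMr// -(ltr_pM2l NR) !mulrA mulfV ?gt_eqF// mul1r.
  by rewrite (mulrC s).
have N2 : 2 <= N%:R :> R by rewrite ler_nat.
have n0 : 0 <= n%:R :> R by [].
have m0 := ler_norm m.
have m00 := normr_ge0 m.
have NN : 0 <= N%:R - 1 :> R by lra.
apply: (@le_trans _ _ ((N%:R - 1) * (N%:R * `|m|))); last first.
  by rewrite mulrAC (mulrC (a * s)) ler_wpM2l// ltW.
have nn : 0 <= N%:R * n%:R :> R by rewrite mulr_ge0// ltW.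
move: (`|m|) m0 m00 (N%:R : R) (N%:R * n%:R) NR N2 NN nn => p m0 m00 k q NR N2 NN nn.
have h1 : k ^+ 2 * m <= k ^+ 2 * p by rewrite ler_pM2l// exprn_gt0.
have h2 : 0 <= k * p * (k - 2) by rewrite !mulr_ge0// ?subr_ge0// ltW.
rewrite ler_pdivrMr//; nra.
Qed.

End energy_landscape.

(** * Lebesgue measure on [Rd] and on configurations *)

Section lebesgue_Rd.
Context (R : realType) (d : nat).
Local Notation Rd := (d.-tuple R).
Local Open Scope ereal_scope.

(* [lebesgue_measure] lives on [measurableTypeR R], whose display differs from the one of [R]. *)
Let idR : measurableTypeR R -> R := fun x => x.

Let measurable_idR : measurable_fun setT idR. Proof. by move=> _ A; rewrite setTI. Qed.

Definition leb1 : set R -> \bar R := pushforward lebesgue_measure idR.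

HB.instance Definition _ := Measure.copy leb1
  (measure_function_pushforward__canonical__measure_function_Measure
    lebesgue_measure measurable_idR).

Let leb1_sigma_finite : sigma_finite setT leb1.
Proof. exact: (sigma_finiteT (@lebesgue_measure R)). Qed.

HB.instance Definition _ := Measure_isSigmaFinite.Build _ _ _ leb1 leb1_sigma_finite.

Lemma integral_leb1 (f : R -> \bar R) : measurable_fun setT f -> (forall x, 0 <= f x) ->
  \int[lebesgue_measure]_x f x = \int[leb1]_x f x.
Proof.
move=> mf f0; have f0' : {in setT, forall y, 0 <= f y} by move=> ? _.
by rewrite (ge0_integral_pushforward measurable_idR _ measurableT mf f0') preimage_setT.
Qed.

Definition leb_d : {sigma_finite_measure set Rd -> \bar R} := tuple_power leb1 d.

Lemma Rd_intE (f : Rd -> \bar R) : measurable_fun setT f -> (forall x, 0 <= f x) ->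
  Rd_int f = \int[leb_d]_x f x.
Proof. by move=> mf f0; apply: tint_tuple_power => //; exact: integral_leb1. Qed.

Lemma lebRdE (B : set Rd) : measurable B -> lebRd B = leb_d B.
Proof.
move=> mB; rewrite /lebRd Rd_intE.
- by rewrite integral_indic// setIT.
- by apply/measurable_EFinP; exact: measurable_indic.
- by move=> x; rewrite lee_fin indicE.
Qed.

Lemma Rd_int_ge0 (f : Rd -> \bar R) : (forall x, 0 <= f x) -> 0 <= Rd_int f.
Proof. by move=> f0; apply: tint_ge0 => // g g0; exact: integral_ge0. Qed.

Lemma le_Rd_int (f g : Rd -> \bar R) : (forall x, 0 <= f x) -> (forall x, f x <= g x) ->
  Rd_int f <= Rd_int g.
Proof.
move=> f0 fg; apply: le_tint => //.
- by move=> h h0; exact: integral_ge0.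
- by move=> h k h0 hk; exact: (@ge0_le_integral_any _ (measurableTypeR R) R lebesgue_measure h k h0 hk).
Qed.

Lemma conf_int_ge0 N (f : N.-tuple Rd -> \bar R) : (forall x, 0 <= f x) -> 0 <= conf_int f.
Proof. by move=> f0; apply: tint_ge0 => // g g0; exact: Rd_int_ge0. Qed.

Lemma le_conf_int N (f g : N.-tuple Rd -> \bar R) : (forall x, 0 <= f x) ->
  (forall x, f x <= g x) -> conf_int f <= conf_int g.
Proof.
move=> f0 fg; apply: le_tint => //; [exact: Rd_int_ge0|exact: le_Rd_int].
Qed.

Lemma conf_intE N (f : N.-tuple Rd -> \bar R) : measurable_fun setT f -> (forall x, 0 <= f x) ->
  conf_int f = \int[tuple_power leb_d N]_x f x.
Proof. by move=> mf f0; apply: tint_tuple_power => //; exact: Rd_intE. Qed.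

End lebesgue_Rd.

(** * Exponential upper bound for closed sets *)

Section upper_bound.
Context (R : realType) (d : nat).
Local Notation Rd := (d.-tuple R).
Variables (V : Rd -> R) (W : Rd -> Rd -> \bar R) (v0 a b : R) (beta : nat -> R).
Hypothesis adm : admissible V W v0 a b.
Hypothesis V_int : (Rd_int (fun x => (expR (- V x))%:E) < +oo)%E.
Hypothesis beta_gt0 : forall N, 0 < beta N.
Hypothesis beta_large : forall A : R, \forall N \near \oo, A * N%:R <= beta N.
Local Notation Vt := (shiftV V v0).
Local Notation G := (kernel V W b).
Local Notation E := (energy G).

Lemma ZPN_ge0 N A : (0 <= ZPN V W beta N A)%E.
Proof.
by apply: conf_int_ge0 => x; apply: mule_ge0; [rewrite lee_fin indicE|exact: expeR_ge0].
Qed.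

(** The volume factor of the upper bound, a product over the points; [1 <= C] makes [ln C]
    nonnegative. *)
Let Vint : exists C : R, 1 <= C /\ forall N (k : R), 0 <= k ->
  (conf_int (fun x : N.-tuple Rd => (k * \prod_(i < N) expR (- Vt (tnth x i)))%:E) <= (k * C ^+ N)%:E)%E.
Proof.
have mV : measurable_fun setT (fun x : Rd => (expR (- V x))%:E).
  apply/measurable_EFinP; apply: (measurableT_comp (@measurable_expR R)).
  by apply: measurable_funN; exact: (Rcontinuous_measurable (adm_V_cont adm)).
have V0 (x : Rd) : (0 <= (expR (- V x))%:E)%E by rewrite lee_fin expR_ge0.
have [c cE] : exists c : R, (\int[leb_d R d]_x (expR (- V x))%:E)%E = c%:E.
  have i0 : (0 <= \int[leb_d R d]_x (expR (- V x))%:E)%E by exact: integral_ge0.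
  move: V_int; rewrite Rd_intE//; move: i0.
  by case: (\int[leb_d R d]_x _)%E => // c _ _; exists c.
have iT k : 0 <= k -> Rd_int (fun x : Rd => (k * expR (- Vt x))%:E) = (k * (expR (- v0) * c))%:E.
  move=> k0.
  have -> : (fun x : Rd => (k * expR (- Vt x))%:E) =
      (fun x => (k * expR (- v0))%:E * (expR (- V x))%:E)%E.
    by apply/funext => x; rewrite -EFinM /shiftV opprD addrC expRD mulrA.
  have kv0 : 0 <= k * expR (- v0) by rewrite mulr_ge0// expR_ge0.
  rewrite Rd_intE; last first.
  - by move=> x; rewrite mule_ge0// lee_fin.
  - exact: measurable_funeM.
  - by rewrite ge0_integralZl_EFin// cE -EFinM mulrA.
have c0 : 0 <= expR (- v0) * c.
  by rewrite mulr_ge0 ?expR_ge0// -lee_fin -cE; exact: integral_ge0.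
exists (Num.max 1 (expR (- v0) * c)); split; first by rewrite le_max lexx.
move=> N k k0; rewrite /conf_int.
have u0 (x : Rd) : 0 <= expR (- Vt x) by exact: expR_ge0.
rewrite (tint_prod (@Rd_int_ge0 R d) N k0 u0 iT).
rewrite lee_fin ler_wpM2l//; apply: lerXn2r; rewrite ?nnegrE ?le_max ?c0 ?ler01 ?orbT//.
by rewrite lexx orbT.
Qed.

Lemma ZPN_upper (S : set (M1 R d)) (m e : R) : wclosed S ->
  (forall mu, S mu -> (m%:E < E mu)%E) -> 0 < e ->
  \forall N \near \oo, (ZPN V W beta N S <= (expR (beta N * - ((m + b) / 2 - e)))%:E)%E.
Proof.
move=> cS Sm e0.
have [n Hn] := pair_energy_uniform adm cS Sm.
have [C [C1 HC]] := Vint.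
have a0 := adm_a_gt0 adm.
(* The fraction of the energy given up for integrability: at most one half, and such that
   [eta * |m| <= e / 2]. *)
pose eta := Num.min (2^-1) (e / (2 * (`|m| + 1))).
have m1 : 0 < `|m| + 1 by rewrite ltr_wpDl.
have eta0 : 0 < eta by rewrite lt_min invr_gt0 ltr0n divr_gt0// mulr_gt0.
have eta1 : eta <= 2^-1 by rewrite ge_min lexx.
have etam : eta * `|m| <= e / 2.
  apply: (@le_trans _ _ (e / (2 * (`|m| + 1)) * `|m|)).
    by rewrite ler_wpM2r// ge_min lexx orbT.
  rewrite invfM mulrA -mulrA; rewrite -[leRHS]mulr1 ler_wpM2l ?divr_ge0 ?(ltW e0)//.
  by rewrite mulrC ler_pdivrMr// mul1r lerDl.
have C0 : 0 < C by exact: lt_le_trans C1.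
have lnC0 : 0 <= ln C by exact: ln_ge0.
(* These thresholds make the fraction [eta] of the energy dominate the sum of [Vt], the factor
   [C ^+ N] cost at most [e / 4] on the scale [beta N], and the terms in [1 / N] cost at most
   [e / 4]. *)
have near1 := beta_large (2 / (eta * a)).
have near2 := beta_large (4 * ln C / e).
have near3 := near_ge_nat (4 * (n%:R + `|b| + `|v0|) / e).
near=> N.
have N1 : (1 < N)%N by near: N; exists 2%N.
have N0 : (0 < N)%N by exact: ltnW.
have NR : 0 < N%:R :> R by rewrite ltr0n.
have N2 : 2 <= N%:R :> R by rewrite ler_nat.
have b1 : 2 / (eta * a) * N%:R <= beta N by near: N.
have b2 : 4 * ln C / e * N%:R <= beta N by near: N.
have b3 : 4 * (n%:R + `|b| + `|v0|) / e <= N%:R by near: N.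
have bN := beta_gt0 N.
pose c := (1 - eta) * (m - n%:R / N%:R) / 2 + (b * (N%:R - 1) / (2 * N%:R) - v0 / N%:R).
have key x : ((\1_(@empN R d N @^-1` S) x)%:E * weight V W beta x <=
    (expR (- (beta N * c)) * \prod_(i < N) expR (- Vt (tnth x i)))%:E)%E.
  have R0 : 0 <= expR (- (beta N * c)) * \prod_(i < N) expR (- Vt (tnth x i)).
    by rewrite mulr_ge0 ?expR_ge0// prodr_ge0// => i _; exact: expR_ge0.
  rewrite indicE; have [xS|_] := boolP (x \in _); last by rewrite mul0e lee_fin.
  rewrite mul1e -expR_sum -expRD.
  have Sx : S (empN x) by move/set_mem : xS.
  rewrite /weight (_ : (expR _)%:E = expeR (- (beta N * c + \sum_(i < N) Vt (tnth x i))%:E)); last first.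
    by rewrite /= opprD -sumrN.
  rewrite lee_expeR leeN2.
  have P1 := Hn N x N1 Sx.
  have P2 := pair_energy_lbV adm x.
  rewrite (HN_pair_energy V W v0 b x N0).
  have s0 : 0 <= \sum_(i < N) Vt (tnth x i).
    by apply: sumr_ge0 => i _; exact: (shiftV_ge0 adm).
  move: P1 P2; set s := \sum_(i < N) Vt (tnth x i) in s0 *.
  case: (pair_energy V W v0 b x) => [p| |]//.
    move=> P1 P2; rewrite !lee_fin in P1 P2.
    rewrite -[X in (_ <= X)%E]/((beta N * (N%:R ^- 2 * p +
      (b * (N%:R - 1) / (2 * N%:R) - v0 / N%:R)))%:E) lee_fin.
    rewrite /c; set K := (b * _ / _ - _).
    have A : (m - n%:R / N%:R) / 2 <= N%:R ^- 2 * p.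
      rewrite -[leLHS](@mulKf _ (N%:R ^+ 2)) ?expf_neq0 ?gt_eqF// ler_pM2l ?invr_gt0 ?exprn_gt0//.
      apply: le_trans P1; rewrite le_eqVlt; apply/orP; left; apply/eqP; field; exact: lt0r_neq0.
    (* Here [pair_energy_lbV] is used with [N - 1 >= N / 2] and the first threshold. *)
    have B : s <= eta * beta N * (N%:R ^- 2 * p).
      have h1 : a * (N%:R - 1) * s * (N%:R ^- 2) <= N%:R ^- 2 * p.
        by rewrite mulrC ler_pM2l// invr_gt0 exprn_gt0.
      apply: le_trans (ler_wpM2l (ltW (mulr_gt0 eta0 bN)) h1).
      have h2 : 2 * N%:R <= eta * a * beta N.
        by move: b1; rewrite mulrAC ler_pdivrMr ?mulr_gt0// (mulrC (beta N)).
      rewrite -[leLHS]mul1r.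
      have -> : eta * beta N * (a * (N%:R - 1) * s * N%:R ^- 2) =
          (eta * a * beta N) * ((N%:R - 1) * N%:R ^- 2) * s by ring.
      apply: ler_wpM2r => //.
      have N10 : 0 <= (N%:R - 1) * N%:R ^- 2 :> R.
        by rewrite mulr_ge0 ?invr_ge0 ?exprn_ge0// ?(ltW NR)// subr_ge0 (le_trans _ N2)// ler1n.
      apply: le_trans (ler_wpM2r N10 h2).
      have -> : 2 * N%:R * ((N%:R - 1) * N%:R ^- 2) = 2 * (N%:R - 1) / N%:R :> R.
        field; exact: lt0r_neq0.
      by rewrite ler_pdivlMr// mul1r; lra.
    have A' : (1 - eta) * ((m - n%:R / N%:R) / 2) <= (1 - eta) * (N%:R ^- 2 * p).
      by apply: ler_wpM2l => //; lra.
    have A'' := ler_wpM2l (ltW bN) A'.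
    move: A'' B; set q := _ * p; move: (m - _) => w A'' B.
    have -> : beta N * ((1 - eta) * w / 2 + K) = beta N * ((1 - eta) * (w / 2)) + beta N * K by ring.
    have -> : beta N * (q + K) = beta N * ((1 - eta) * q) + eta * beta N * q + beta N * K by ring.
    by rewrite addrAC lerD2r lerD.
  (* Infinite pair energy: the weight vanishes. *)
  move=> _ _.
  rewrite gt0_muley ?lte_fin ?invr_gt0 ?exprn_gt0//.
  by rewrite gt0_muley ?leey ?lte_fin.
apply: le_trans (le_conf_int _ key) _.
  by move=> x; apply: mule_ge0; [rewrite lee_fin indicE|exact: expeR_ge0].
apply: le_trans (HC N _ (expR_ge0 _)) _.
have CE : C ^+ N = expR (N%:R * ln C) by rewrite expRM_natl lnK ?posrE.
rewrite CE -expRD lee_fin ler_expR.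
have h1 : N%:R * ln C <= beta N * (e / 4).
  move: b2; rewrite mulrAC ler_pdivrMr// => h.
  by rewrite mulrA ler_pdivlMr// mulrC mulrA (mulrAC 4).
suff h2 : (m + b) / 2 - e + e / 4 <= c.
  have := ler_wpM2l (ltW bN) h2; rewrite mulrDr mulrN; lra.
have h3 : (n%:R + `|b| + `|v0|) / N%:R <= e / 4.
  move: b3; rewrite ler_pdivrMr// => h.
  by rewrite ler_pdivrMr// mulrAC ler_pdivlMr// mulrC (mulrC e).
have Ni : 0 < N%:R^-1 :> R by rewrite invr_gt0.
rewrite /c.
have -> : b * (N%:R - 1) / (2 * N%:R) - v0 / N%:R = b / 2 - b / 2 * N%:R^-1 - v0 * N%:R^-1.
  field; exact: lt0r_neq0.
move: h3; move: (N%:R^-1 : R) Ni => r r0.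
have n0 : 0 <= n%:R :> R by [].
move: (n%:R : R) n0 => k k0 h3.
have {}h3 : k * r + `|b| * r + `|v0| * r <= e / 4 by rewrite -!mulrDl.
have q1 : 0 <= k * r by rewrite mulr_ge0// ltW.
have q2 : b * r <= `|b| * r by rewrite ler_wpM2r ?ler_norm// ltW.
have q3 : v0 * r <= `|v0| * r by rewrite ler_wpM2r ?ler_norm// ltW.
have q4 : eta * m <= eta * `|m| by rewrite ler_wpM2l ?ler_norm// ltW.
have q5 : 0 <= eta * (k * r) by rewrite mulr_ge0// ltW.
have q6 : 0 <= `|b| * r by rewrite mulr_ge0// ltW.
have q7 : 0 <= `|v0| * r by rewrite mulr_ge0// ltW.
have -> : (1 - eta) * (m - k * r) / 2 = m / 2 - eta * m / 2 - k * r / 2 + eta * (k * r) / 2 by field.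
rewrite (_ : b / 2 * r = b * r / 2); last by field.
lra.
Unshelve. all: by end_near.
Qed.

End upper_bound.

(** * Lower bound *)

Section truncation.
Context (R : realType) (d : nat).
Local Notation Rd := (d.-tuple R).
Implicit Types (mu nu : M1 R d).

(** [nu] is [mu] conditioned on [h <= k], where [h] is the Radon-Nikodym density and [k] is so large
    that this event has mass above [p]. Its density is then at most [k / p]; [k.+1] in [K] ensures
    [1 <= K]. *)
Lemma abscont_truncation mu (p : R) : abscont mu -> 0 < p < 1 ->
  exists (nu : M1 R d) (K : R), [/\ 1 <= K,
    forall A, measurable A -> (nu A <= (p^-1)%:E * mu A)%E &
    forall A, measurable A -> (nu A <= K%:E * leb_d R d A)%E].
Proof.
move=> ac /andP[p0 p1].
have dom : mu `<< leb_d R d.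
  apply/null_content_dominatesP => A mA A0; apply: ac => //; by rewrite lebRdE.
have [h [h0 hfin hint hE]] := radon_nikodym_sigma_finite dom.
have mh : measurable_fun setT h := measurable_int _ hint.
pose B k := [set x | (h x <= k%:R%:E)%E].
have mB k : measurable (B k).
  by rewrite -[B k]setTI; apply: measurable_lee => //; exact: measurable_cst.
have BT : \bigcup_k B k = setT.
  rewrite -subTset => x _; have := hfin x; have := h0 x; rewrite /B.
  case E : (h x) => [r| |]// r0 _; exists (Num.bound r) => //=; rewrite E lee_fin ltW//.
  by apply: archi_boundP; rewrite -lee_fin.
have ndB : {homo B : n m / (n <= m)%N >-> (n <= m)%O}.
  move=> n m nm; apply/subsetPset => x /= hx; apply: le_trans hx _.
  by rewrite lee_fin ler_nat.
have : (mu \o B) @ \oo --> mu (\bigcup_k B k).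
  by apply: nondecreasing_cvg_mu => //; rewrite BT; exact: measurableT.
rewrite BT probability_setT => cB.
have [k pk] : exists k, (p%:E < mu (B k))%E.
  have [k _ /(_ k (leqnn k)) H] : \forall k \near \oo, (p%:E < mu (B k))%E.
    have : nbhs (1%:E : \bar R) [set y | (p%:E < y)%E] by apply: open_ereal_gt'; rewrite lte_fin.
    by move/cB.
  by exists k.
pose nu : M1 R d := mnormalize (mrestr mu (mB k)) mu.
have mBfin : mu (B k) \is a fin_num by exact: fin_num_measure.
have mBp : p < fine (mu (B k)) by rewrite -lte_fin fineK.
have m0 : 0 < fine (mu (B k)) := lt_trans p0 mBp.
have nuE A : nu A = (mu (A `&` B k) * ((fine (mu (B k)))^-1)%:E)%E.
  have E0 : mrestr mu (mB k) setT = mu (B k) by rewrite /mrestr setTI.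
  rewrite /nu /= /mnormalize /= (_ : mrestr mu (mB k) _ = mu (B k)); last exact: E0.
  by rewrite -(fineK mBfin) eqe gt_eqF.
exists nu, (k.+1%:R * p^-1); split.
- have : 1 <= p^-1 by rewrite invf_ge1// ltW.
  have : 1 <= k.+1%:R :> R by rewrite ler1n.
  move=> k1 pp; rewrite -[leLHS]mulr1; apply: ler_pM => //.
- move=> A mA; rewrite nuE muleC; apply: lee_pmul => //.
  + by rewrite lee_fin invr_ge0 ltW.
  + by rewrite lee_fin lef_pV2 ?posrE// ltW.
  + by apply: le_measure; rewrite ?inE//; exact: measurableI.
- move=> A mA; rewrite nuE.
  have mAB : measurable (A `&` B k) by exact: measurableI.
  have h1 : (mu (A `&` B k) <= k.+1%:R%:E * leb_d R d A)%E.
    rewrite hE//; apply: (@le_trans _ _ (\int[leb_d R d]_(x in A `&` B k) k.+1%:R%:E)%E).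
      apply: ge0_le_integral => //.
      + exact: measurable_funS mh.
      + move=> x [_ /= hx]; apply: le_trans hx _; by rewrite lee_fin ler_nat.
    rewrite integral_cst//; apply: lee_pmul => //.
    by apply: le_measure; rewrite ?inE.
  rewrite EFinM [X in (_ <= X)%E]muleAC; apply: lee_pmul => //.
    by rewrite lee_fin invr_ge0 ltW.
  by rewrite lee_fin lef_pV2 ?posrE// ltW.
Qed.

(** Domination compares integrals of nonnegative functions only; [M + f] and [M - f] give the two
    sides. *)
Lemma pint_domination mu nu (p M : R) f : 0 < p <= 1 ->
  (forall A, measurable A -> (nu A <= (p^-1)%:E * mu A)%E) ->
  bmeas f -> (forall x, `|f x| <= M) ->
  `|pint nu f - pint mu f| <= 2 * M * (p^-1 - 1).
Proof.
move=> /andP[p0 p1] dom bf fM.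
have p'0 : 0 <= p^-1 by rewrite invr_ge0 ltW.
have key (g : Rd -> R) : bmeas g -> (forall x, 0 <= g x) -> pint nu g <= p^-1 * pint mu g.
  move=> bg g0; rewrite -lee_fin EFinM -!pintE//.
  have mg : measurable_fun setT (fun x => (g x)%:E) by apply/measurable_EFinP; exact: bg.1.
  have g0' x : (0 <= (g x)%:E)%E by rewrite lee_fin.
  rewrite -[X in (_ <= X)%E](@ge0_integral_mscale _ _ _ mu setT measurableT (NngNum p'0) _ mg (fun x _ => g0' x)).
  by apply: ge0_le_measure_integral => //= A mA; exact: dom.
have bM (c : R) : bmeas (fun _ : Rd => c) by exact: bmeas_cst.
have bfM : bmeas (fun x => f x + M) by exact: bmeasD.
have bMf : bmeas (fun x => M - f x) by exact: bmeasB.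
have := key _ bfM; have := key _ bMf.
have eD m : pint m (fun x => f x + M) = pint m f + M by rewrite pintD// pint_cst.
have eB m : pint m (fun x => M - f x) = M - pint m f by rewrite pintB// pint_cst.
rewrite !eD !eB.
have f1 x : 0 <= M - f x by have := fM x; rewrite ler_norml subr_ge0 => /andP[].
have f2 x : 0 <= f x + M by have := fM x; rewrite ler_norml -subr_ge0 opprK => /andP[].
move=> /(_ f1) k1 /(_ f2) k2.
have M0 : 0 <= M by apply: le_trans (fM (Defs.x0 R d)).
have m1 := pint_norm_le mu bf fM.
move: m1; rewrite !ler_norml => /andP[m1 m2].
have q1 : 0 <= p^-1 - 1 by rewrite subr_ge0 invf_ge1.
have h1 : (p^-1 - 1) * (M - pint mu f) <= (p^-1 - 1) * (2 * M) by apply: ler_wpM2l => //; lra.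
have h2 : (p^-1 - 1) * (pint mu f + M) <= (p^-1 - 1) * (2 * M) by apply: ler_wpM2l => //; lra.
move: k1 k2 h1 h2; move: (p^-1) (pint mu f) (pint nu f) => q u v k1 k2 h1 h2.
apply/andP; split; lra.
Qed.

Lemma energy_domination (G : Rd -> Rd -> \bar R) mu nu (p : R) : 0 < p ->
  (forall x y, (0 <= G x y)%E) -> lsc2 G ->
  (forall A, measurable A -> (nu A <= (p^-1)%:E * mu A)%E) ->
  (energy G nu <= (p^-1 ^+ 2)%:E * energy G mu)%E.
Proof.
move=> p0 G0 lG dom.
have p'0 : 0 <= p^-1 by rewrite invr_ge0 ltW.
have key (g : Rd -> \bar R) : measurable_fun setT g -> (forall x, (0 <= g x)%E) ->
    (\int[nu]_x g x <= (p^-1)%:E * \int[mu]_x g x)%E.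
  move=> mg g0.
  rewrite -(@ge0_integral_mscale _ _ _ mu setT measurableT (NngNum p'0) _ mg (fun x _ => g0 x)).
  by apply: ge0_le_measure_integral => //= A mA; exact: dom.
have mG x : measurable_fun setT (G x) := kernel_measurable lG x.
rewrite /energy.
have i0 m x : (0 <= \int[m : M1 R d]_y G x y)%E by apply: integral_ge0.
apply: (@le_trans _ _ (\int[nu]_x ((p^-1)%:E * \int[mu]_y G x y))%E).
  by apply: ge0_le_integral_any => // x; exact: key.
rewrite ge0_integralZl_EFin//; last exact: (kernel_section_measurable G0 lG).
rewrite expr2 EFinM -muleA; apply: lee_wpmul2l; first by rewrite lee_fin.
by apply: key => //; exact: (kernel_section_measurable G0 lG).
Qed.

End truncation.

(** * Moments under product laws *)

Section product_moments.
Context (R : realType) (d : nat).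
Local Notation Rd := (d.-tuple R).
Variable nu : M1 R d.
Local Notation iT := (fun g : Rd -> \bar R => (\int[nu]_x g x)%E).

(** The constant [c] absorbs the coordinates already fixed; centering kills the cross term. *)
Lemma tint_second_moment n (g : Rd -> R) (c : R) : bmeas g -> pint nu g = 0 ->
  tint iT (fun t : n.-tuple Rd => ((c + \sum_(i < n) g (tnth t i)) ^+ 2)%:E) =
  (c ^+ 2 + n%:R * pint nu (fun x => g x ^+ 2))%:E.
Proof.
move=> bg g0; have bg2 : bmeas (fun x => g x ^+ 2).
  have [mg [M gM]] := bg; split; first exact: measurable_funX.
  exists (M ^+ 2) => x; rewrite normrX; apply: lerXn2r; rewrite ?nnegrE//.
  by apply: le_trans (gM x).
elim: n c => [|n IH] c /=; first by rewrite big_ord0 addr0 mul0r addr0.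
set s := pint nu (fun x => g x ^+ 2).
transitivity (\int[nu]_x ((c + g x) ^+ 2 + n%:R * s)%:E)%E.
  apply: eq_integral => x _; rewrite -IH; congr (tint _ _); apply/funext => t.
  congr ((_ ^+ 2)%:E); rewrite big_ord_recl tnth0 addrA; congr (_ + _).
  by apply: eq_bigr => i _; rewrite tnthS.
have bc (r : R) : bmeas (fun _ : Rd => r) by exact: bmeas_cst.
have b1 : bmeas (fun x => 2 * c * g x) by exact: bmeasZ.
have b2 : bmeas (fun x => c ^+ 2 + n%:R * s + 2 * c * g x) by exact: bmeasD.
have -> : (fun x => ((c + g x) ^+ 2 + n%:R * s)%:E) =
    (fun x => ((c ^+ 2 + n%:R * s + 2 * c * g x) + g x ^+ 2)%:E).
  by apply/funext => x; congr EFin; ring.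
rewrite pintE; last exact: bmeasD.
by rewrite pintD// pintD// pint_cst pintZ// g0 -/s mulr0 addr0 -natr1; congr EFin; ring.
Qed.

Local Open Scope ereal_scope.

(** General [h] and [c] make the induction close: fixing a first point [x] turns its interaction
    with the others into a one-body term, so [h] becomes [h + G x] and [c] becomes [c + h x]. *)
Lemma tint_pair_moment n (G : Rd -> Rd -> \bar R) (h : Rd -> \bar R) (c : \bar R) :
  lsc2 G -> (forall x y, 0 <= G x y) -> measurable_fun setT h -> (forall x, 0 <= h x) -> 0 <= c ->
  tint iT (fun t : n.-tuple Rd => c + (\sum_(i < n) h (tnth t i) +
     \sum_(i < n) \sum_(j < n | (i < j)%N) G (tnth t i) (tnth t j))) =
  c + (n%:R%:E * \int[nu]_x h x + ('C(n, 2))%:R%:E * energy G nu).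
Proof.
move=> lG G0 mh h0 c0.
elim: n h mh h0 c c0 => [|n IH] h mh h0 c c0 /=.
  by rewrite !big_ord0 bin0n !mul0e.
have mG x : measurable_fun setT (G x) := kernel_measurable lG x.
have J0 : 0 <= energy G nu by apply: integral_ge0 => x _; apply: integral_ge0.
have i0 x : 0 <= \int[nu]_y G x y by apply: integral_ge0.
have ih0 : 0 <= \int[nu]_x h x by apply: integral_ge0.
have mi : measurable_fun setT (fun x => \int[nu]_y G x y) := kernel_section_measurable G0 lG nu.
have n0 : (0 <= n%:R :> R)%R by [].
have C0 : (0 <= ('C(n, 2))%:R :> R)%R by [].
transitivity (\int[nu]_x (c + h x + (n%:R%:E * (\int[nu]_y h y + \int[nu]_y G x y) +
    ('C(n, 2))%:R%:E * energy G nu))).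
  apply: eq_integral => x _.
  rewrite (_ : (fun t : n.-tuple Rd => _) = (fun t : n.-tuple Rd => (c + h x) +
     (\sum_(i < n) (h (tnth t i) + G x (tnth t i)) +
      \sum_(i < n) \sum_(j < n | (i < j)%N) G (tnth t i) (tnth t j)))).
    rewrite (IH (fun y => h y + G x y))//.
    - by rewrite ge0_integralD.
    - exact: emeasurable_funD.
    - by move=> y; exact: adde_ge0.
    - exact: adde_ge0.
  apply/funext => t.
  rewrite !big_ord_recl tnth0 big_split/=.
  rewrite [X in _ + (_ + (X + _))](_ : _ = \sum_(i < n) G x (tnth t i)); last first.
    by rewrite big_mkcond big_ord_recl/= add0e; apply: eq_bigr => i _; rewrite tnthS.
  under [X in _ + (h x + X + _)]eq_bigr do rewrite tnthS.
  rewrite [X in _ + (_ + (_ + X))](_ : _ =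
      \sum_(i < n) \sum_(j < n | (i < j)%N) G (tnth t i) (tnth t j)); last first.
    apply: eq_bigr => i _; rewrite big_mkcond big_ord_recl/= add0e [RHS]big_mkcond/=.
    by apply: eq_bigr => j _; rewrite !tnthS.
  by rewrite !addeA.
set H := \int[nu]_x h x; set J := energy G nu; set C := ('C(n, 2))%:R%:E.
have nH0 : 0 <= n%:R%:E * H by rewrite mule_ge0.
have CJ0 : 0 <= C * J by rewrite mule_ge0.
have k0 : 0 <= c + n%:R%:E * H + C * J by rewrite !adde_ge0.
transitivity (\int[nu]_x ((c + n%:R%:E * H + C * J) + (h x + n%:R%:E * \int[nu]_y G x y))).
  apply: eq_integral => x _; rewrite ge0_muleDr//.
  by rewrite (GRing.add.[AC (2*(2*1)) (1*3*5*(2*4))]).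
have mni : measurable_fun setT (fun x => n%:R%:E * \int[nu]_y G x y) by exact: measurable_funeM.
have ni0 x : 0 <= n%:R%:E * \int[nu]_y G x y by rewrite mule_ge0.
rewrite ge0_integralD//; last 2 first.
- by move=> x _; exact: adde_ge0.
- exact: emeasurable_funD.
rewrite integral_cst//= probability_setT mule1 ge0_integralD// ge0_integralZl_EFin//.
rewrite -/(energy G nu) -/J -/H -natr1 binS bin1 natrD 2!EFinD.
rewrite !ge0_muleDl// mul1e -/C.
by rewrite (GRing.add.[AC (3*2) (1*((2*4)*(3*5)))]).
Qed.

End product_moments.

(** * Product laws against Lebesgue integrals *)

Section tint_domination.
Context (R : realType) (d : nat).
Local Notation Rd := (d.-tuple R).
Local Open Scope ereal_scope.
Variables (nu : M1 R d) (K : R).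
Hypotheses (K0 : (0 <= K)%R)
  (dom : forall A, measurable A -> nu A <= K%:E * leb_d R d A).

Lemma tint_le_conf_int n (f : n.-tuple Rd -> \bar R) :
  measurable_fun setT f -> (forall x, 0 <= f x) ->
  tint (fun g : Rd -> \bar R => \int[nu]_x g x) f <= (K ^+ n)%:E * conf_int f.
Proof.
elim: n f => [|n IH] f mf f0 /=; first by rewrite expr0 mul1e.
have mfx x : measurable_fun setT (fun t : n.-tuple Rd => f (cons_tuple x t)).
  exact: (measurableT_comp mf (@measurable_cons_tuple _ Rd n x)).
pose phi x := conf_int (fun t : n.-tuple Rd => f (cons_tuple x t)).
have phi0 x : 0 <= phi x by exact: conf_int_ge0.
have mphi : measurable_fun setT phi.
  rewrite (_ : phi = fun x => \int[tuple_power (leb_d R d) n]_t f (cons_tuple x t)); last first.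
    by apply/funext => x; rewrite /phi conf_intE.
  have mc : measurable_fun setT (fun z : Rd * n.-tuple Rd => f (cons_tuple z.1 z.2)).
    exact: (measurableT_comp mf (measurable_cons measurable_fst measurable_snd)).
  exact: (measurable_fun_fubini_tonelli_F (m2 := tuple_power (leb_d R d) n) _ mc (fun=> f0 _)).
apply: (@le_trans _ _ (\int[nu]_x ((K ^+ n)%:E * phi x))).
  apply: ge0_le_integral_any => x; last exact: IH.
  by apply: tint_ge0 => // g g0; exact: integral_ge0.
have Kn0 : (0 <= K ^+ n)%R by exact: exprn_ge0.
rewrite ge0_integralZl_EFin// exprSr EFinM -muleA; apply: lee_wpmul2l; first by rewrite lee_fin.
have -> : conf_int f = \int[leb_d R d]_x phi x by rewrite -Rd_intE.
rewrite -(@ge0_integral_mscale _ _ _ (leb_d R d) setT measurableT (NngNum K0) _ mphi (fun x _ => phi0 x)).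
by apply: ge0_le_measure_integral => //= A mA; exact: dom.
Qed.

End tint_domination.

(** * Typical configurations under a product law *)

Section law_of_large_numbers.
Context (R : realType) (d : nat).
Local Notation Rd := (d.-tuple R).
Variables (V : Rd -> R) (W : Rd -> Rd -> \bar R) (v0 a b : R).
Hypothesis adm : admissible V W v0 a b.
Local Notation Vt := (shiftV V v0).
Local Notation G := (kernel V W b).
Local Notation E := (energy G).
Local Notation iT nu := (fun g : Rd -> \bar R => (\int[nu : M1 R d]_x g x)%E).

Lemma tint_probability_cst (nu : M1 R d) n : tint (iT nu) (fun _ : n.-tuple Rd => 1%E) = 1%E.
Proof.
by elim: n => [|n IH] //=; rewrite IH integral_cst//= probability_setT mule1.
Qed.

(** A probability bounded below independently of [N] is enough at the scale [beta_N], so Markov's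
    inequality suffices for the energy, without any bound on its variance. The event [B] is a
    measurable substitute for membership in [A]. *)
Lemma typical_configurations (nu : M1 R d) (A : set (M1 R d)) (r dl : R) :
  wnbhs nu A -> E nu = r%:E -> 0 < dl ->
  exists2 th : R, 0 < th & \forall N \near \oo, exists B : set (N.-tuple Rd),
    [/\ measurable B,
        forall x, B x -> A (empN x),
        forall x, B x -> (pair_energy V W v0 b x <= (N%:R ^+ 2 * (r / 2 + dl))%:E)%E &
        (th%:E <= tint (iT nu) (fun x => (\1_B x)%:E))%E].
Proof.
move=> [n [f [e [bf e0 fA]]]] Er dl0.
have r0 : 0 <= r by rewrite -lee_fin -Er; exact: (energy_ge0 adm).
pose s := r / 2 + dl.
have s0 : 0 < s by rewrite /s ltr_wpDl// divr_ge0.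
have a0 := adm_a_gt0 adm.
have mV := measurable_shiftV adm.
have V0 x : (0 <= (Vt x)%:E)%E by rewrite lee_fin (shiftV_ge0 adm).
have [v vE] : exists v, (\int[nu]_x (Vt x)%:E)%E = v%:E.
  have := energy_lbV adm nu; rewrite Er.
  have i0 : (0 <= \int[nu]_x (Vt x)%:E)%E by exact: integral_ge0.
  move: i0; case: (\int[nu]_x (Vt x)%:E)%E => [v| |]// _; first by exists v.
  by rewrite gt0_muley ?lte_fin.
have v00 : 0 <= v by rewrite -lee_fin -vE; exact: integral_ge0.
pose g i x := f i x - pint nu (f i).
have bfm i : bmeas (f i) by exact: bcont_bmeas.
have bg i : bmeas (g i) by apply: bmeasB => //; exact: bmeas_cst.
have g0 i : pint nu (g i) = 0.
  by rewrite /g pintB ?pint_cst ?subrr//; exact: bmeas_cst.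
pose sg i := pint nu (fun x => g i x ^+ 2).
pose S := \sum_(i < n) sg i.
(* Since [r / 2 = s - dl], Markov's bound for the pair interactions is [1 - 4 * th]. Chebyshev's
   bound and the one-body term cost at most [th] each for large [N], so that [B] keeps at least
   [2 * th]. *)
pose th := dl / (4 * s).
have th0 : 0 < th by rewrite divr_gt0// mulr_gt0.
have near1 := near_ge_nat (S / (e ^+ 2 * th)).
have near2 := near_ge_nat (v / (s * th)).
exists th => //; near=> N.
have N0 : (0 < N)%N by near: N; exists 1%N.
have NR : 0 < N%:R :> R by rewrite ltr0n.
have b1 : S / (e ^+ 2 * th) <= N%:R by near: N.
have b2 : v / (s * th) <= N%:R by near: N.
pose B1 i := [set x : N.-tuple Rd | `|\sum_(j < N) g i (tnth x j)| < N%:R * e].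
pose B2 := [set x : N.-tuple Rd | (pair_energy V W v0 b x <= (N%:R ^+ 2 * s)%:E)%E].
pose B := (\bigcap_i B1 i) `&` B2.
have msum i : measurable_fun setT (fun x : N.-tuple Rd => \sum_(j < N) g i (tnth x j)).
  apply: measurable_sum => j; apply: (measurableT_comp (bg i).1); exact: measurable_tnth.
have mB1 i : measurable (B1 i).
  rewrite -[B1 i]setTI; apply: measurable_fun_ltr => //.
  exact: measurableT_comp.
have mB2 : measurable B2.
  rewrite -[B2]setTI; apply: measurable_lee => //.
  exact: (measurable_pair_energy adm).
have mB : measurable B.
  by apply: measurableI => //; apply: fin_bigcap_measurable => //; exact: finite_finset.
exists B; split => //.
- move=> x [H _]; apply: fA => i /=.
  have : `|\sum_(j < N) g i (tnth x j)| < N%:R * e by exact: (H i Logic.I).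
  have -> : \sum_(j < N) g i (tnth x j) = \sum_(j < N) f i (tnth x j) - pint nu (f i) *+ N.
    by rewrite sumrB sumr_const card_ord.
  rewrite pint_empN// => h.
  rewrite -(ltr_pM2l NR) -[X in X * _](gtr0_norm NR) -normrM mulrBr mulrA mulfV ?gt_eqF// mul1r.
  by rewrite mulr_natl.
- by move=> x [].
pose Q := tuple_power nu N.
have QE (h : N.-tuple Rd -> \bar R) : measurable_fun setT h -> (forall x, 0 <= h x)%E ->
    tint (iT nu) h = (\int[Q]_x h x)%E.
  by move=> mh h0; apply: tint_tuple_power.
pose F2 (x : N.-tuple Rd) : \bar R :=
  (((N%:R * e) ^- 2)%:E * \sum_(i < n) ((\sum_(j < N) g i (tnth x j)) ^+ 2)%:E)%E.
pose F3 (x : N.-tuple Rd) : \bar R := (((N%:R ^+ 2 * s)^-1)%:E * pair_energy V W v0 b x)%E.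
have Ne0 : 0 < N%:R * e by rewrite mulr_gt0.
have Ns0 : 0 < N%:R ^+ 2 * s by rewrite mulr_gt0// exprn_gt0.
have sq0 x i : (0 <= ((\sum_(j < N) g i (tnth x j)) ^+ 2)%:E)%E by rewrite lee_fin sqr_ge0.
have F20 x : (0 <= F2 x)%E.
  by apply: mule_ge0; [rewrite lee_fin invr_ge0 sqr_ge0|exact: sume_ge0].
have F30 x : (0 <= F3 x)%E.
  by apply: mule_ge0; [rewrite lee_fin invr_ge0 ltW|exact: (pair_energy_ge0 adm)].
(* Chebyshev's and Markov's inequalities together, in pointwise form: off [B], one of [F2] and [F3]
   is at least 1. *)
have key x : (1 <= (\1_B x)%:E + (F2 x + F3 x))%E.
  have [xB|nB] := pselect (B x).
    by rewrite indicE mem_set//= leeDl// adde_ge0.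
  rewrite indicE memNset//= add0e.
  have [h2|h2] := pselect (B2 x); last first.
    apply: (@le_trans _ _ (F3 x)); last by rewrite leeDr.
    move: h2 => /= /negP; rewrite -ltNge => h2.
    apply: (@le_trans _ _ (((N%:R ^+ 2 * s)^-1)%:E * (N%:R ^+ 2 * s)%:E)%E).
      by rewrite -EFinM mulVf// gt_eqF.
    apply: lee_wpmul2l; last exact: ltW.
    by rewrite lee_fin invr_ge0 ltW.
  apply: (@le_trans _ _ (F2 x)); last by rewrite leeDl.
  have [i hi] : exists i, ~ B1 i x.
    apply: contrapT => H; apply: nB; split => // i _.
    by apply: contrapT => h; apply: H; exists i.
  move: hi => /= /negP; rewrite -leNgt => hi.
  apply: (@le_trans _ _ (((N%:R * e) ^- 2)%:E * ((N%:R * e) ^+ 2)%:E)%E).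
    by rewrite -EFinM mulVf// expf_neq0// gt_eqF.
  apply: lee_wpmul2l.
    by rewrite lee_fin invr_ge0 sqr_ge0.
  rewrite (bigD1 i)//= -[X in (X <= _)%E]adde0; apply: leeD; last exact: sume_ge0.
  rewrite lee_fin -[leRHS]real_normK ?num_real//; apply: lerXn2r => //; rewrite nnegrE.
  exact: ltW.
have msq i : measurable_fun setT (fun x : N.-tuple Rd => ((\sum_(j < N) g i (tnth x j)) ^+ 2)%:E).
  by apply/measurable_EFinP; exact: measurable_funX.
have IF2 : (\int[Q]_x F2 x <= th%:E)%E.
  rewrite ge0_integralZl_EFin//; last 3 first.
  - by move=> x _; exact: sume_ge0.
  - exact: emeasurable_sum.
  - by rewrite invr_ge0 sqr_ge0.
  rewrite ge0_integral_sum//.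
  have E2 i : (\int[Q]_x ((\sum_(j < N) g i (tnth x j)) ^+ 2)%:E = (N%:R * sg i)%:E)%E.
    rewrite -QE//; have := tint_second_moment N 0 (bg i) (g0 i).
    rewrite expr0n add0r => <-; congr (tint _ _); apply/funext => x; by rewrite add0r.
  under eq_bigr do rewrite E2.
  rewrite sumEFin -mulr_sumr -/S -EFinM lee_fin.
  have -> : (N%:R * e) ^- 2 * (N%:R * S) = S / e ^+ 2 / N%:R.
    by field; rewrite !gt_eqF.
  rewrite ler_pdivrMr//; move: b1; rewrite invfM mulrA ler_pdivrMr//.
  by rewrite (mulrC th).
have IF3 : (\int[Q]_x F3 x <= (th + (1 - 4 * th))%:E)%E.
  rewrite ge0_integralZl_EFin//; last 3 first.
  - by move=> x _; exact: (pair_energy_ge0 adm).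
  - exact: (measurable_pair_energy adm).
  - by rewrite invr_ge0 ltW.
  rewrite -QE//; last 2 first.
  - exact: (measurable_pair_energy adm).
  - exact: (pair_energy_ge0 adm).
  have := tint_pair_moment nu N (kernel_lsc adm) (kernel_ge0 adm) mV V0 (lexx 0%E).
  rewrite add0e vE Er -!EFinM -EFinD => H.
  rewrite (_ : tint _ _ = (N%:R * v + 'C(N, 2)%:R * r)%:E); last first.
    by rewrite -H; congr (tint _ _); apply/funext => x; rewrite add0e.
  rewrite -EFinM lee_fin.
  have C2 : 'C(N, 2)%:R <= N%:R ^+ 2 / 2 :> R.
    rewrite ler_pdivlMr// -natrX -natrM ler_nat.
    by have := bin_ffact N 2; rewrite -[2`!]/2%N => ->; rewrite ffactnSr ffactn1 -mulnn leq_mul2l leq_subr orbT.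
  apply: (@le_trans _ _ ((N%:R ^+ 2 * s)^-1 * (N%:R * v + N%:R ^+ 2 / 2 * r))).
    by rewrite ler_wpM2l ?invr_ge0 ?(ltW Ns0)// lerD2l ler_wpM2r.
  have -> : (N%:R ^+ 2 * s)^-1 * (N%:R * v + N%:R ^+ 2 / 2 * r) = v / s / N%:R + r / 2 / s.
    by field; rewrite !gt_eqF.
  apply: lerD.
    rewrite ler_pdivrMr//; move: b2; rewrite invfM mulrA ler_pdivrMr//.
    by rewrite (mulrC th).
  rewrite /th le_eqVlt; apply/orP; left; apply/eqP.
  have -> : r / 2 = s - dl by rewrite /s addrK.
  by field; rewrite gt_eqF.
have I1 : (\int[Q]_x (1 : \bar R) = 1)%E by rewrite -QE ?tint_probability_cst.
have mI : measurable_fun setT (fun x => (\1_B x : R)%:E).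
  by apply/measurable_EFinP; exact: measurable_indic.
have I0 x : (0 <= (\1_B x : R)%:E)%E by rewrite lee_fin indicE.
have mF2 : measurable_fun setT F2 by apply: measurable_funeM; exact: emeasurable_sum.
have mF3 : measurable_fun setT F3 by apply: measurable_funeM; exact: (measurable_pair_energy adm).
have : (1 <= \int[Q]_x (\1_B x)%:E + (th%:E + (th + (1 - 4 * th))%:E))%E.
  rewrite -[X in (X <= _)%E]I1; apply: le_trans (ge0_le_integral_any Q _ key) _ => //.
  rewrite ge0_integralD//; last 2 first.
  - by move=> x _; exact: adde_ge0.
  - exact: emeasurable_funD.
  by apply: leeD => //; rewrite ge0_integralD//; exact: leeD.
rewrite QE// -EFinD -leeBlDr// -EFinB => H; apply: le_trans H; rewrite lee_fin; lra.
Unshelve. all: by end_near.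
Qed.

End law_of_large_numbers.

(** * Exponential lower bound near absolutely continuous measures *)

Section lower_bound.
Context (R : realType) (d : nat).
Local Notation Rd := (d.-tuple R).
Variables (V : Rd -> R) (W : Rd -> Rd -> \bar R) (v0 a b : R) (beta : nat -> R).
Hypothesis adm : admissible V W v0 a b.
Hypothesis beta_gt0 : forall N, 0 < beta N.
Hypothesis beta_large : forall A : R, \forall N \near \oo, A * N%:R <= beta N.
Local Notation Vt := (shiftV V v0).
Local Notation G := (kernel V W b).
Local Notation E := (energy G).

Lemma ZPN_lower_dominated (nu : M1 R d) (K : R) (A : set (M1 R d)) (r e : R) :
  1 <= K -> (forall B, measurable B -> (nu B <= K%:E * leb_d R d B)%E) ->
  wnbhs nu A -> E nu = r%:E -> 0 < e ->
  \forall N \near \oo, ((expR (beta N * - ((r + b) / 2 + e)))%:E <= ZPN V W beta N A)%E.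
Proof.
move=> K1 dom nuA Er e0.
have e20 : 0 < e / 2 by rewrite divr_gt0.
have [th th0 Hth] := typical_configurations adm nuA Er e20.
have lnK0 : 0 <= ln K by exact: ln_ge0.
have K0 : 0 < K by exact: lt_le_trans K1.
(* Error budget: [e / 2] for the energy of typical configurations, [e / 8] each for [K ^+ N] and
   [th], [e / 4] for the terms in [1 / N]. *)
have near1 := beta_large (8 * ln K / e).
have near2 := beta_large (8 * `|ln th| / e).
have near3 := near_ge_nat (4 * (`|b| + `|v0|) / e).
near=> N.
have N0 : (0 < N)%N by near: N; exists 1%N.
have NR : 0 < N%:R :> R by rewrite ltr0n.
have N1 : 1 <= N%:R :> R by rewrite ler1n.
have b1 : 8 * ln K / e * N%:R <= beta N by near: N.
have b2 : 8 * `|ln th| / e * N%:R <= beta N by near: N.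
have b3 : 4 * (`|b| + `|v0|) / e <= N%:R by near: N.
have [B [mB BA BE Bth]] : exists B : set (N.-tuple Rd), [/\ measurable B,
        forall x, B x -> A (empN x),
        forall x, B x -> (pair_energy V W v0 b x <= (N%:R ^+ 2 * (r / 2 + e / 2))%:E)%E &
        (th%:E <= tint (fun g : Rd -> \bar R => (\int[nu]_x g x)%E) (fun x => (\1_B x)%:E))%E].
  by near: N.
have bN := beta_gt0 N.
pose c := b * (N%:R - 1) / (2 * N%:R) - v0 / N%:R.
pose w := expR (- (beta N * (r / 2 + e / 2 + c))).
have w0 : 0 < w by exact: expR_gt0.
have KN0 : 0 < K ^+ N by exact: exprn_gt0.
have mI : measurable_fun setT (fun x : N.-tuple Rd => (\1_B x : R)%:E).
  by apply/measurable_EFinP; exact: measurable_indic.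
have I0 (x : N.-tuple Rd) : (0 <= (\1_B x : R)%:E)%E by rewrite lee_fin indicE.
have step1 : (w%:E * conf_int (fun x : N.-tuple Rd => (\1_B x)%:E) <= ZPN V W beta N A)%E.
  rewrite conf_intE// -ge0_integralZl_EFin//; last exact: ltW.
  rewrite -conf_intE; [|exact: measurable_funeM|by move=> x; rewrite mule_ge0// lee_fin ltW].
  apply: le_conf_int => x; first by rewrite mule_ge0// lee_fin ltW.
  rewrite !indicE; have [xB|_] := boolP (x \in B); last first.
    by rewrite mule0; apply: mule_ge0; [rewrite lee_fin|exact: expeR_ge0].
  have Bx : B x by exact: set_mem.
  rewrite (mem_set (BA x Bx : (@empN R d N @^-1` A) x)) mule1 mul1e /weight.
  rewrite (_ : w%:E = expeR (- (beta N * (r / 2 + e / 2 + c))%:E))//.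
  rewrite lee_expeR leeN2 EFinM; apply: lee_wpmul2l; first by rewrite lee_fin ltW.
  rewrite (HN_pair_energy V W v0 b x N0) -/c (EFinD _ c); apply: leeD => //.
  apply: (@le_trans _ _ ((N%:R ^- 2)%:E * (N%:R ^+ 2 * (r / 2 + e / 2))%:E)%E).
    by apply: lee_wpmul2l; [rewrite lee_fin invr_ge0 exprn_ge0// ltW|exact: BE].
  by rewrite -EFinM lee_fin mulKf// expf_neq0// gt_eqF.
have step2 : (th%:E <= (K ^+ N)%:E * conf_int (fun x : N.-tuple Rd => (\1_B x)%:E))%E.
  by apply: le_trans Bth _; apply: tint_le_conf_int => //; exact: ltW.
apply: le_trans step1.
have step3 : ((th / K ^+ N)%:E <= conf_int (fun x : N.-tuple Rd => (\1_B x)%:E))%E.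
  by rewrite mulrC EFinM lee_pdivrMl.
apply: (@le_trans _ _ (w%:E * (th / K ^+ N)%:E)%E); last first.
  by apply: lee_wpmul2l => //; rewrite lee_fin ltW.
rewrite -EFinM lee_fin.
have -> : th / K ^+ N = expR (ln th - N%:R * ln K).
  by rewrite expRB expRM_natl !lnK ?posrE.
rewrite /w -expRD ler_expR.
have h1 : N%:R * ln K <= beta N * (e / 8).
  move: b1; rewrite mulrAC ler_pdivrMr// => h.
  by rewrite mulrA ler_pdivlMr// mulrC mulrA (mulrAC 8).
have h2 : - ln th <= beta N * (e / 8).
  apply: le_trans (ler_norm _) _; rewrite normrN.
  apply: (@le_trans _ _ (N%:R * `|ln th|)); first by rewrite ler_peMl.
  move: b2; rewrite mulrAC ler_pdivrMr// => h.
  by rewrite mulrA ler_pdivlMr// mulrC mulrA (mulrAC 8).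
have h3 : (`|b| + `|v0|) / N%:R <= e / 4.
  move: b3; rewrite ler_pdivrMr// => h.
  by rewrite ler_pdivrMr// mulrAC ler_pdivlMr// mulrC (mulrC e).
have h4 : c <= b / 2 + e / 4.
  have Ni : 0 < N%:R^-1 :> R by rewrite invr_gt0.
  have -> : c = b / 2 - b * N%:R^-1 / 2 - v0 * N%:R^-1.
    by rewrite /c; field; exact: lt0r_neq0.
  move: h3; move: (N%:R^-1 : R) Ni => q q0; rewrite mulrDl => h3.
  have q2 : - (b * q) <= `|b| * q by rewrite -mulNr ler_wpM2r ?(ltW q0)// -normrN ler_norm.
  have q3 : - (v0 * q) <= `|v0| * q by rewrite -mulNr ler_wpM2r ?(ltW q0)// -normrN ler_norm.
  have q6 : 0 <= `|b| * q by rewrite mulr_ge0// ltW.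
  lra.
have h5 : beta N * (r / 2 + e / 2 + c) <= beta N * ((r + b) / 2 + 3 / 4 * e).
  by rewrite ler_pM2l//; lra.
have : beta N * ((r + b) / 2 + 3 / 4 * e) = beta N * ((r + b) / 2 + e) - 2 * (beta N * (e / 8)).
  by field.
move: h1 h2 h5; rewrite mulrN; lra.
Unshelve. all: by end_near.
Qed.

Lemma ZPN_lower (mu : M1 R d) (A : set (M1 R d)) (r e : R) :
  abscont mu -> wnbhs mu A -> E mu = r%:E -> 0 < e ->
  \forall N \near \oo, ((expR (beta N * - ((r + b) / 2 + e)))%:E <= ZPN V W beta N A)%E.
Proof.
move=> ac [n [f [ep [bf ep0 fA]]]] Er e0.
have r0 : 0 <= r by rewrite -lee_fin -Er; exact: (energy_ge0 adm).
have [M HM] : exists M : R, forall i x, `|f i x| <= M.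
  have [m Hm] := choice (fun i => (bf i).2).
  exists (\sum_i `|m i|) => i x; apply: le_trans (Hm i x) _.
  apply: le_trans (ler_norm _) _; rewrite (bigD1 i)//= lerDl; exact: sumr_ge0.
pose M' := `|M| + 1.
have M'0 : 0 < M' by rewrite ltr_wpDl.
have HM' i x : `|f i x| <= M'.
  apply: le_trans (HM i x) _; apply: le_trans (ler_norm M) _; by rewrite lerDl.
(* With [p^-1 = 1 + tau], the first two bounds give an energy at most [(1 + tau) ^ 2 * r <= r + e];
   the last moves each test integral by at most [ep / 4], so that [A] is still a neighbourhood of
   [nu]. *)
pose tau := Num.min 1 (Num.min (e / (3 * (r + 1))) (ep / (8 * M'))).
have r1 : 0 < r + 1 by rewrite ltr_wpDl.
have tau0 : 0 < tau by rewrite !lt_min ltr01 !divr_gt0// mulr_gt0.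
have tau1 : tau <= 1 by rewrite ge_min lexx.
have tau2 : tau <= e / (3 * (r + 1)) by rewrite !ge_min lexx orbT.
have tau3 : tau <= ep / (8 * M') by rewrite !ge_min lexx !orbT.
pose p := (1 + tau)^-1.
have p01 : 0 < p < 1 by rewrite invr_gt0 addr_gt0//= invf_lt1 ?addr_gt0// ltrDl.
have [nu [K [K1 dmu dleb]]] := abscont_truncation ac p01.
have pinv : p^-1 = 1 + tau by rewrite invrK.
have p01' : 0 < p <= 1 by have /andP[-> /ltW] := p01.
have nuA : wnbhs nu A.
  exists n, f, (ep / 2); split => //; first by rewrite divr_gt0.
  move=> m /= Hm; apply: fA => i /=.
  have h := pint_domination p01' dmu (bcont_bmeas (bf i)) (HM' i).
  have h' : 2 * M' * (p^-1 - 1) <= ep / 4.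
    rewrite pinv addrAC subrr add0r.
    apply: (@le_trans _ _ (2 * M' * (ep / (8 * M')))).
      by rewrite ler_wpM2l// mulr_ge0// ltW.
    rewrite le_eqVlt; apply/orP; left; apply/eqP; field; exact: lt0r_neq0.
  have := ler_distD (pint nu (f i)) (pint m (f i)) (pint mu (f i)).
  have := Hm i; lra.
have dE := energy_domination (andP p01).1 (kernel_ge0 adm) (kernel_lsc adm) dmu.
have [r' Er'] : exists r', E nu = r'%:E.
  move: dE; rewrite Er -EFinM; have := energy_ge0 adm nu.
  by case: (E nu) => [r'| |]// _ _; exists r'.
have rr' : r' <= r + e.
  move: dE; rewrite Er Er' -EFinM lee_fin pinv => h; apply: le_trans h _.
  have t2 : tau * (r + 1) <= e / 3.
    move: tau2; rewrite invfM mulrA ler_pdivlMr//.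
  have t3 : tau * r <= e / 3.
    by apply: le_trans t2; rewrite ler_wpM2l ?(ltW tau0)// lerDl.
  have t4 : tau * (tau * r) <= tau * r by rewrite ler_piMl// mulr_ge0// ltW.
  have -> : (1 + tau) ^+ 2 * r = r + 2 * (tau * r) + tau * (tau * r) by ring.
  lra.
have e2 : 0 < e / 2 by rewrite divr_gt0.
apply: filterS (ZPN_lower_dominated K1 dleb nuA Er' e2) => N; apply: le_trans.
rewrite lee_fin ler_expR ler_wpM2l ?(ltW (beta_gt0 N))// lerN2; lra.
Qed.

End lower_bound.

(** * Finiteness of the infimum *)

Section translation_invariance.
Context (R : realType).
Local Open Scope ereal_scope.

Let sh (s : R) : measurableTypeR R -> measurableTypeR R := fun t => (t - s)%R.

Let measurable_shift s : measurable_fun setT (sh s).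
Proof.
have mR : measurable_fun setT (fun t : R => (t - s)%R) by exact: measurable_funB.
by move=> mT A mA; exact: mR.
Qed.

(** The translated measure gives half-open intervals their length, which determines Lebesgue
    measure. *)
Lemma lebesgue_measure_shift (s : R) (A : set (measurableTypeR R)) : measurable A ->
  lebesgue_measure A = lebesgue_measure ((fun t : R => t - s)%R @^-1` A).
Proof.
have msh := measurable_shift s.
move=> mA.
apply: (@lebesgue_measure_unique R
  (measure_function_pushforward__canonical__measure_function_Measure lebesgue_measure msh)) => //.
move=> _ [[x y] _ <-] /=; rewrite /pushforward.
have -> : sh s @^-1` `]x, y] = `](x + s)%R, (y + s)%R]%classic.
  by apply/seteqP; split => t /=; rewrite !in_itv/= /sh ltrBrDr lerBlDr.
by rewrite !lebesgue_measure_itv/= !lte_fin ltrD2r -!EFinB opprD addrACA subrr addr0.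
Qed.

Lemma integral_shift (s : R) (g : R -> \bar R) : measurable_fun setT g -> (forall x, 0 <= g x) ->
  \int[lebesgue_measure]_t g (t - s)%R = \int[lebesgue_measure]_t g t.
Proof.
move=> mg g0.
have msh := measurable_shift s.
have g0' : {in setT, forall y, 0 <= g y} by move=> ? _.
have := ge0_integral_pushforward msh lebesgue_measure measurableT (mg : measurable_fun (setT : set (measurableTypeR R)) g) g0'.
rewrite preimage_setT => <-.
apply: eq_measure_integral => A mA _; apply/esym; exact: lebesgue_measure_shift.
Qed.

Definition tsub n (y x : n.-tuple R) : n.-tuple R := [tuple (tnth y i - tnth x i)%R | i < n].

Lemma tint_shift n (x : n.-tuple R) (f : n.-tuple R -> \bar R) :
  measurable_fun setT f -> (forall t, 0 <= f t) ->
  tint (fun g : R -> \bar R => \int[lebesgue_measure]_t g t) (fun y => f (tsub y x)) =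
  tint (fun g : R -> \bar R => \int[lebesgue_measure]_t g t) f.
Proof.
elim: n x f => [|n IH] x f mf f0 /=; first by congr f; exact: tuple0.
have mft s : measurable_fun setT (fun t : n.-tuple R => f (cons_tuple s t)).
  exact: (measurableT_comp mf (@measurable_cons_tuple _ R n s)).
transitivity (\int[lebesgue_measure]_s
    tint (fun g : R -> \bar R => \int[lebesgue_measure]_t g t)
      (fun t => f (cons_tuple (s - thead x)%R t))).
  apply: eq_integral => s _; rewrite -(IH [tuple of behead x])//.
  congr (tint _ _); apply/funext => t; congr f; apply: eq_from_tnth => i.
  rewrite tnth_mktuple; case: (unliftP ord0 i) => [j|] ->.
    rewrite !tnthS tnth_mktuple tnth_behead; congr (_ - tnth x _)%R.
    by apply: val_inj; rewrite /= inordK// ltnS.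
  by rewrite !tnth0.
pose P (s : R) : \bar R := tint (fun g : R -> \bar R => \int[lebesgue_measure]_t g t)
  (fun t : n.-tuple R => f (cons_tuple s t)).
rewrite -/P (integral_shift (thead x) (g := P))//.
  rewrite (_ : P = fun s => \int[tuple_power (@leb1 R) n]_t f (cons_tuple s t)).
    have mc : measurable_fun setT (fun z : R * n.-tuple R => f (cons_tuple z.1 z.2)).
      exact: (measurableT_comp mf (measurable_cons measurable_fst measurable_snd)).
    exact: (measurable_fun_fubini_tonelli_F (m2 := tuple_power (@leb1 R) n) _ mc (fun=> f0 _)).
  apply/funext => s; apply: tint_tuple_power => //; exact: integral_leb1.
by move=> s; apply: tint_ge0 => // g g0; exact: integral_ge0.
Qed.

End translation_invariance.

Lemma le_integral_add_cst d (T : measurableType d) (R : realType)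
    (m : {measure set T -> \bar R}) (D : set T) (c : R) (f : T -> \bar R) :
  measurable D -> m D = 1%E -> 0 <= c -> measurable_fun setT f -> (forall x, (0 <= f x)%E) ->
  (\int[m]_(x in D) (c%:E + f x) <= c%:E + \int[m]_x f x)%E.
Proof.
move=> mD D1 c0 mf f0.
have mfD : measurable_fun D f by exact: (measurable_funS measurableT).
rewrite ge0_integralD//.
rewrite integral_cst// D1 mule1; apply: leeD => //.
exact: ge0_subset_integral.
Qed.

(** * The uniform law on the unit cube *)

Section finite_energy.
Context (R : realType) (d : nat).
Local Notation Rd := (d.-tuple R).

(** For [r = 1] it contains the unit cube and all differences of its points, so it plays both
    compact sets of (H1). *)
Definition cube (r : R) : set Rd := [set x : Rd | forall i, `|tnth x i| <= r].
Definition unit_cube : set Rd := [set x : Rd | forall i, 0 <= tnth x i <= 1].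

Let measurable_coord_le (i : 'I_d) (s t : R) : measurable [set x : Rd | s <= tnth x i <= t].
Proof.
rewrite (_ : [set x | _] = (fun x : Rd => tnth x i) @^-1` `[s, t]%classic).
  rewrite -[X in measurable X]setTI; apply: measurable_tnth => //; exact: measurable_itv.
by apply/seteqP; split=> x /=; rewrite in_itv.
Qed.

Lemma measurable_cube r : measurable (cube r).
Proof.
rewrite (_ : cube r = \bigcap_(i in [set: 'I_d]) [set x : Rd | - r <= tnth x i <= r]).
  by apply: fin_bigcap_measurable => //; exact: finite_finset.
apply/seteqP; split=> x H i; first by move=> _ /=; rewrite -ler_norml; exact: H.
by rewrite ler_norml; exact: H.
Qed.

Lemma measurable_unit_cube : measurable unit_cube.
Proof.
rewrite (_ : unit_cube = \bigcap_(i in [set: 'I_d]) [set x : Rd | 0 <= tnth x i <= 1]).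
  by apply: fin_bigcap_measurable => //; exact: finite_finset.
by apply/seteqP; split=> x H i; [move=> _; exact: H|exact: H].
Qed.

Lemma unit_cube_sub : unit_cube `<=` cube 1.
Proof.
by move=> x H i; have /andP[x0 x1] := H i; rewrite ger0_norm.
Qed.

Lemma leb_d_unit_cube : leb_d R d unit_cube = 1%E.
Proof.
rewrite -lebRdE; last exact: measurable_unit_cube.
pose u (t : R) : R := \1_(`[0, 1]%classic : set R) t.
have u0 t : 0 <= u t by rewrite /u indicE.
rewrite /lebRd /Rd_int (_ : (fun x => _) = fun x : Rd => (1 * \prod_(i < d) u (tnth x i))%:E).
  rewrite (@tint_prod R R _ _ d u 1 1)//; first by rewrite expr1n mulr1.
    by move=> f f0; exact: integral_ge0.
  move=> k k0.
  under eq_fun do rewrite EFinM.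
  rewrite ge0_integralZl_EFin//; last 2 first.
    by move=> x _; rewrite lee_fin.
    by apply/measurable_EFinP; exact: measurable_indic.
  have -> : (\int[lebesgue_measure]_x (u x)%:E = 1)%E.
    rewrite /u (@integral_indic _ _ R lebesgue_measure setT measurableT `[0, 1]%classic)//.
    rewrite setIT; have := @lebesgue_measure_itv R `[0, 1]; rewrite /= lte_fin ltr01 oppr0 adde0.
    by apply.
  by rewrite EFinM.
apply/funext => x; rewrite mul1r; congr EFin; rewrite indicE.
have [xQ|xQ] := boolP (x \in unit_cube).
  rewrite big1// => i _; rewrite /u indicE mem_set//= in_itv/=.
  by move/set_mem : xQ; exact.
have [i hi] : exists i, ~~ (0 <= tnth x i <= 1).
  apply/existsP; rewrite -negb_forall; apply/negP => /forallP h.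
  by move/negP : xQ; apply; rewrite inE.
rewrite (bigD1 i)//= /u indicE memNset ?mul0r//= in_itv/=.
exact/negP.
Qed.

Lemma uniform_probability_exists : exists mu : M1 R d,
  forall A, measurable A -> mu A = leb_d R d (A `&` unit_cube).
Proof.
pose m := mrestr (leb_d R d) measurable_unit_cube.
have mT : m setT = 1%E by rewrite /m /mrestr setTI leb_d_unit_cube.
exists (mnormalize m (@dirac _ Rd (Defs.x0 R d) R)) => A mA.
change (mnormalize m (@dirac _ Rd (Defs.x0 R d) R) A = m A).
rewrite /mnormalize; set k := fine _.
have -> : k = 1 by rewrite /k [X in fine X]mT.
rewrite [X in if (X == _) || _ then _ else _]mT [X in if _ || (X == _) then _ else _]mT.
by rewrite eqe oner_eq0/= invr1 mule1.
Qed.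

Lemma integral_uniform (mu : M1 R d) (g : Rd -> \bar R) :
  (forall A, measurable A -> mu A = leb_d R d (A `&` unit_cube)) ->
  measurable_fun setT g -> (forall x, (0 <= g x)%E) ->
  (\int[mu]_x g x = \int[leb_d R d]_(x in unit_cube) g x)%E.
Proof.
move=> muE mg g0.
have mQ := measurable_unit_cube.
rewrite (@ge0_negligible_integral _ _ _ mu setT (~` unit_cube))//.
- rewrite setTD setCK; apply: eq_measure_integral => A mA AQ.
  have AE : A `&` unit_cube = A by apply/seteqP; split=> [z []//|z Az]; split=> //; exact: AQ.
  have := muE A mA; rewrite AE => e.
  exact: e.
- exact: measurableC mQ.
- by have := muE _ (measurableC mQ); rewrite setICl measure0.
Qed.

Variables (V : Rd -> R) (W : Rd -> Rd -> \bar R) (v0 a b : R).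
Hypothesis adm : admissible V W v0 a b.
Hypothesis W_int : forall K, @Rcompact R d K -> forall C, @Rcompact R d C ->
  (Rd_int (fun z : Rd => (\1_C z)%:E *
    maxe (ereal_sup [set W p.1 p.2 | p in
      [set p : Rd * Rd | [/\ K p.1, K p.2 & (enorm z <= edist p.1 p.2)%R]]]) 0) < +oo)%E.
Local Notation G := (kernel V W b).

Let psi (t : R) : \bar R := maxe (ereal_sup [set W p.1 p.2 | p in
      [set p : Rd * Rd | [/\ cube 1 p.1, cube 1 p.2 & (t <= edist p.1 p.2)%R]]]) 0.
Let phi (z : Rd) : \bar R := ((\1_(cube 1) z)%:E * psi (enorm z))%E.

Let psi_ge0 t : (0 <= psi t)%E. Proof. by rewrite /psi le_max lexx orbT. Qed.

Let phi_ge0 z : (0 <= phi z)%E.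
Proof. by apply: mule_ge0 => //; rewrite lee_fin indicE. Qed.

(** [psi] is nonincreasing, so its superlevel sets are intervals. *)
Let measurable_psi : measurable_fun setT psi.
Proof.
apply: (measurability _ (ErealGenOInfty.measurableE R)) => _ [_ [c ->] <-].
rewrite setTI; apply: is_interval_measurable => s t /= _ + u /andP[_ ut].
rewrite !in_itv/= !andbT => /lt_le_trans; apply; rewrite /psi.
rewrite ge_max; apply/andP; split; last by rewrite le_max lexx orbT.
rewrite le_max; apply/orP; left; apply: ereal_sup_le => _ [p [Kp Kq tp] <-].
by exists p => //; split=> //; exact: le_trans tp.
Qed.

Let measurable_phi : measurable_fun setT phi.
Proof.
apply: emeasurable_funM; first by apply/measurable_EFinP; exact: measurable_indic (measurable_cube 1).
apply: (measurableT_comp measurable_psi).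
rewrite (_ : @enorm R d = edist (Defs.x0 R d)).
  exact: measurable_edist.
by apply/funext => x; rewrite edistC edist0.
Qed.

(** On the unit cube [W x y] is one of the values whose supremum defines [psi] at the distance of
    [x] and [y], so [G x y] is at most a constant plus [phi] at the difference. By translation
    invariance the integral in [y] is bounded independently of [x]. *)
Lemma finite_energy_exists : exists mu : M1 R d, (energy G mu < +oo)%E.
Proof.
have [mu muE] := uniform_probability_exists.
exists mu.
have phi_fin : (\int[leb_d R d]_z phi z < +oo)%E.
  rewrite -Rd_intE//; exact: (W_int (@cube_compact R d 1) (@cube_compact R d 1)).
have [M HM] : exists M : R, forall x, unit_cube x -> V x <= M.
  have [||J /finite_index_bound[m Jm] HJ] :=
      @cube_compact R d 1 nat (fun n => [set x | V x < n%:R]).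
  - move=> n; have := @Ropen_preimage R d V `]-oo, n%:R[%classic (adm_V_cont adm) (@interval_open _ _ _ _ _).
    rewrite (_ : V @^-1` _ = [set x | V x < n%:R]); first by apply.
    by apply/seteqP; split=> x /=; rewrite in_itv.
  - move=> x _; exists (Num.bound (V x)) => //=.
    have [h|h] := leP 0 (V x); first exact: archi_boundP.
    by apply: lt_le_trans h _.
  exists m%:R => x Qx; have [j Jj /= h] := HJ x (unit_cube_sub Qx).
  by apply: le_trans (ltW h) _; rewrite ler_nat; exact: Jm.
pose C0 := Num.max 0 (2 * M - b).
have C00 : 0 <= C0 by rewrite le_max lexx.
have C01 : 2 * M - b <= C0 by rewrite le_max lexx orbT.
have key x y : unit_cube x -> unit_cube y -> (G x y <= C0%:E + phi (tsub y x))%E.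
  move=> Qx Qy; rewrite /kernel; apply: leeD.
    by rewrite lee_fin; apply: le_trans C01; rewrite mulr2n mulrDl !mul1r lerD2r lerD// HM.
  have en : enorm (tsub y x) = edist x y.
    rewrite edistC /enorm /edist; congr Num.sqrt; apply: eq_bigr => i _.
    by rewrite tnth_mktuple.
  rewrite /phi indicE mem_set ?mul1e; last first.
    move=> i; rewrite tnth_mktuple; have /andP[x0 x1] := Qx i; have /andP[y0 y1] := Qy i.
    by rewrite ler_norml; apply/andP; split; lra.
  rewrite /psi le_max; apply/orP; left; apply: ereal_sup_ubound.
  by exists (x, y) => //; split=> /=; [exact: unit_cube_sub|exact: unit_cube_sub|rewrite en].
have mtsub x : measurable_fun setT (fun y : Rd => phi (tsub y x)).
  apply: (measurableT_comp measurable_phi); apply/measurable_fun_tnthP => i.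
  rewrite (_ : _ \o _ = fun y : Rd => tnth y i - tnth x i); last first.
    by apply/funext => y /=; rewrite tnth_mktuple.
  by apply: measurable_funB => //; exact: measurable_tnth.
have shift x : (\int[leb_d R d]_y phi (tsub y x) = \int[leb_d R d]_z phi z)%E.
  rewrite -!Rd_intE//; exact: tint_shift.
have mQ := measurable_unit_cube.
have inner x : unit_cube x -> (\int[mu]_y G x y <= C0%:E + \int[leb_d R d]_z phi z)%E.
  move=> Qx; rewrite (integral_uniform muE); [|exact: (kernel_measurable (kernel_lsc adm))|exact: (kernel_ge0 adm)].
  apply: (@le_trans _ _ (\int[leb_d R d]_(y in unit_cube) (C0%:E + phi (tsub y x)))%E).
    apply: ge0_le_integral => //.
    - by move=> y _; exact: (kernel_ge0 adm).
    - apply: (measurable_funS measurableT) => //; exact: (kernel_measurable (kernel_lsc adm)).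
    - by apply: (measurable_funS measurableT) => //; apply: emeasurable_funD.
    - by move=> y Qy; exact: key.
  rewrite -(shift x); apply: le_integral_add_cst => //; exact: leb_d_unit_cube.
rewrite /energy (integral_uniform muE); last 2 first.
- exact: (kernel_section_measurable (kernel_ge0 adm) (kernel_lsc adm)).
- by move=> x; apply: integral_ge0 => y _; exact: (kernel_ge0 adm).
apply: (@le_lt_trans _ _ (\int[leb_d R d]_(x in unit_cube) (C0%:E + \int[leb_d R d]_z phi z))%E).
  apply: ge0_le_integral => //.
  - by move=> x _; apply: integral_ge0 => y _; exact: (kernel_ge0 adm).
  - apply: (measurable_funS measurableT) => //.
    exact: (kernel_section_measurable (kernel_ge0 adm) (kernel_lsc adm)).
rewrite (integral_cst _ mQ).
have := leb_d_unit_cube => /= ->.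
by rewrite mule1 lte_add_pinfty ?ltry.
Qed.

End finite_energy.

(** * Large deviations *)

Lemma superlinear_of_nlogn (R : realType) (beta : nat -> R) :
  (fun N : nat => beta N / (N%:R * ln N%:R)) @ \oo --> +oo ->
  forall A : R, \forall N \near \oo, A * N%:R <= beta N.
Proof.
move=> /cvgryPge h A.
(* The maximum makes the bound nonnegative, so that it can be multiplied by [ln N >= 1], valid once
   [N >= e]. *)
have hA := h (Num.max A 0).
have hN := near_ge_nat (expR 1 : R).
near=> N.
have N1 : expR 1 <= N%:R :> R by near: N.
have N0 : 0 < N%:R :> R by apply: lt_le_trans N1; exact: expR_gt0.
have l1 : 1 <= ln N%:R :> R by rewrite -ler_expR lnK// posrE.
have l0 : 0 < ln N%:R :> R by apply: lt_le_trans l1.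
have : Num.max A 0 <= beta N / (N%:R * ln N%:R) by near: N.
rewrite ler_pdivlMr ?mulr_gt0//; apply: le_trans.
apply: (@le_trans _ _ (Num.max A 0 * N%:R)); first by rewrite ler_pM2r// le_max lexx.
by rewrite mulrA ler_peMr// mulr_ge0 ?(ltW N0)// le_max lexx orbT.
Unshelve. all: by end_near. Qed.

Lemma admissible_exists (R : realType) (d : nat) (V : d.-tuple R -> R)
    (W : d.-tuple R -> d.-tuple R -> \bar R) :
  H1 W -> H2 V -> H3 V W -> exists v0 a b, admissible V W v0 a b.
Proof.
move=> [Wc Ws Wn _ _] [Vc Vy _] [c [eps [/andP[e0 e1] HW]]].
have [v0 Hv] := coercive_lower_bound Vc Vy.
(* (H3) leaves the fraction [1 - eps] of the confinement; writing it with [V + v0] twice shifts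
   [c]. *)
exists v0, (1 - eps), (c - 2 * (1 - eps) * v0); split=> //; first by rewrite subr_gt0.
move=> x y; apply: le_trans (leeD (lexx _) (HW x y)); rewrite -EFinD lee_fin.
by rewrite le_eqVlt; apply/orP; left; apply/eqP; ring.
Qed.

Section rate_function.
Context (R : realType) (d : nat).
Local Notation Rd := (d.-tuple R).
Variables (V : Rd -> R) (W : Rd -> Rd -> \bar R) (v0 a b : R) (beta : nat -> R).
Hypothesis adm : admissible V W v0 a b.
Local Notation G := (kernel V W b).
Local Notation E := (energy G).
Local Notation I := (Ifun V W).
Implicit Types (mu nu : M1 R d) (S A : set (M1 R d)).
Local Open Scope ereal_scope.

Lemma Ifun_le mu (r : R) : (I mu <= r%:E) = (E mu <= (2 * r - b)%:E).
Proof.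
rewrite (Ifun_energy adm).
have := energy_ge0 adm mu; case: (E mu) => [s| |]//= _.
- by rewrite -EFinD -EFinM !lee_fin; apply/idP/idP => ?; lra.
- by rewrite addye// gt0_muley ?lte_fin ?invr_gt0// !leye_eq.
Qed.

Lemma Ifun_gt mu (r : R) : (r%:E < I mu) = ((2 * r - b)%:E < E mu).
Proof. by rewrite !ltNge Ifun_le. Qed.

Lemma Ifun_finE mu (r : R) : I mu = r%:E -> E mu = (2 * r - b)%:E.
Proof.
rewrite (Ifun_energy adm).
have := energy_ge0 adm mu; case: (E mu) => [s| |]//= _.
- by rewrite -EFinD -EFinM => -[<-]; congr EFin; lra.
- by rewrite addye// gt0_muley ?lte_fin ?invr_gt0.
Qed.

Lemma Ifun_lb mu : (2^-1 * b)%:E <= I mu.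
Proof.
rewrite (Ifun_energy adm) EFinM; apply: lee_wpmul2l; first by rewrite lee_fin invr_ge0.
by rewrite leeDr// (energy_ge0 adm).
Qed.

Lemma Ifun_ninfty mu : I mu != -oo.
Proof. by rewrite -ltNye; apply: lt_le_trans (Ifun_lb mu); exact: ltNyr. Qed.

Lemma le_Ifun mu nu : E mu <= E nu -> I mu <= I nu.
Proof.
move=> h; rewrite !(Ifun_energy adm); apply: lee_wpmul2l; first by rewrite lee_fin invr_ge0.
by rewrite leeD2r.
Qed.

Lemma Ifun_min_attained S : wclosed S -> S !=set0 ->
  exists2 mu, S mu & forall nu, S nu -> I mu <= I nu.
Proof.
move=> cS S0; have [mu Smu Hmu] := energy_min_attained adm cS S0.
by exists mu => // nu /Hmu; exact: le_Ifun.
Qed.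

Lemma Iinf_le mu : Iinf V W <= I mu.
Proof. by apply: ereal_inf_lbound; exists mu. Qed.

Lemma Iinf_gt : -oo < Iinf V W.
Proof.
apply: (@lt_le_trans _ _ (2^-1 * b)%:E); first exact: ltNyr.
by apply: le_ereal_inf_tmp => _ [mu _ <-]; exact: Ifun_lb.
Qed.

Lemma Ifun_sublevel (r : R) : wcompact [set mu | I mu <= r%:E] /\ wclosed [set mu | I mu <= r%:E].
Proof.
rewrite (_ : [set mu | I mu <= r%:E] = [set mu | E mu <= (2 * r - b)%:E]); last first.
  by apply/seteqP; split=> mu /=; rewrite Ifun_le.
split; last exact: (wclosed_energy_le (kernel_ge0 adm) (kernel_lsc adm)).
have cT : wclosed [set: M1 R d] by rewrite /wclosed setCT => mu [].
by have := energy_wcompact adm (r := (2 * r - b)%R) cT; rewrite setIT.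
Qed.

Hypothesis H1W : H1 W.

Lemma Ifun_fin_exists : exists mu, I mu < +oo.
Proof.
have [_ _ _ _ Wint] := H1W.
have [mu Emu] := finite_energy_exists adm Wint; exists mu.
rewrite (Ifun_energy adm); have := energy_ge0 adm mu.
by case: (E mu) Emu => [s| |]//= _ _; rewrite -EFinD -EFinM ltry.
Qed.

Lemma Iinf_fin : Iinf V W \is a fin_num.
Proof.
rewrite fin_numElt Iinf_gt/=.
have [mu h] := Ifun_fin_exists; exact: le_lt_trans (Iinf_le mu) h.
Qed.

Lemma Imin_IfunE : Imin V W = [set mu | I mu = Iinf V W].
Proof.
apply/seteqP; split=> mu; rewrite /Imin /Istar /=.
  case: (I mu) (Iinf V W) Iinf_fin => [s| |] [t| |]//= _.
  by rewrite -EFinB => -[/eqP]; rewrite subr_eq0 => /eqP ->.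
by move=> ->; rewrite subee// Iinf_fin.
Qed.

Lemma Imin_neq0 : Imin V W !=set0.
Proof.
have cT : wclosed [set: M1 R d] by rewrite /wclosed setCT => mu [].
have [mu0 _] := Ifun_fin_exists.
have [mu _ Hmu] := Ifun_min_attained cT (ex_intro _ mu0 Logic.I).
exists mu; rewrite Imin_IfunE /=; apply/eqP; rewrite eq_le Iinf_le andbT.
by apply: le_ereal_inf_tmp => _ [nu _ <-]; exact: Hmu.
Qed.

Hypothesis V_int : Rd_int (fun x => (expR (- V x))%:E) < +oo.
Hypothesis beta_gt0 : forall N, (0 < beta N)%R.
Hypothesis beta_large : forall A : R, \forall N \near \oo, (A * N%:R <= beta N)%R.

Lemma ZPN_upperI S (l e : R) : wclosed S -> (forall mu, S mu -> l%:E < I mu) -> (0 < e)%R ->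
  \forall N \near \oo, ZPN V W beta N S <= (expR (beta N * - (l - e)))%:E.
Proof.
move=> cS Sl e0.
have h mu : S mu -> (2 * l - b)%:E < E mu by move=> /Sl; rewrite Ifun_gt.
have := ZPN_upper adm V_int beta_gt0 beta_large cS h e0.
by rewrite (_ : (2 * l - b + b) / 2 = l)%R//; lra.
Qed.

Lemma ZPN_lowerI mu A (r e : R) : abscont mu -> wnbhs mu A -> I mu = r%:E -> (0 < e)%R ->
  \forall N \near \oo, (expR (beta N * - (r + e)))%:E <= ZPN V W beta N A.
Proof.
move=> ac hA /Ifun_finE Er e0.
have := ZPN_lower adm beta_gt0 beta_large ac hA Er e0.
by rewrite (_ : (2 * r - b + b) / 2 = r)%R//; lra.
Qed.

(** Monotonicity of iterated integrals on all nonnegative functions; it reduces the upper bound for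
    [A] to its closure. *)
Lemma le_ZPN N A B : A `<=` B -> ZPN V W beta N A <= ZPN V W beta N B.
Proof.
move=> AB; apply: le_conf_int => x; first by rewrite mule_ge0 ?expeR_ge0 ?lee_fin ?indicE.
apply: lee_wpmul2r; first by rewrite /weight expeR_ge0.
rewrite lee_fin !indicE ler_nat; have [/set_mem Ax|//] := boolP (x \in @empN R d N @^-1` A).
by rewrite mem_set//; exact: AB.
Qed.

Lemma limn_esup_ZPN A :
  limn_esup (fun N => ((beta N)^-1)%:E * lne (ZPN V W beta N A)) <= - ereal_inf (I @` wclosure A).
Proof.
apply: lee_oppr_dense => l lI.
apply/lee_addgt0Pr => e e0; rewrite -EFinD.
apply: limn_esup_le_near.
have Sl mu : wclosure A mu -> l%:E < I mu.
  by move=> Amu; apply: lt_le_trans lI _; apply: ereal_inf_lbound; exists mu.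
apply: filterS (ZPN_upperI (@wclosed_wclosure _ _ A) Sl e0) => N hN.
apply: scaled_lne_le => //; first exact: ZPN_ge0.
apply: le_trans (le_ZPN _ (@subset_wclosure _ _ A)) _.
by rewrite (_ : - l + e = - (l - e))%R//; lra.
Qed.

Lemma limn_einf_ZPN A :
  - ereal_inf (I @` [set mu | winterior A mu /\ abscont mu])
    <= limn_einf (fun N => ((beta N)^-1)%:E * lne (ZPN V W beta N A)).
Proof.
rewrite leeNl; apply: le_ereal_inf_tmp => _ [mu [Amu ac] <-]; rewrite leeNl.
have := Ifun_ninfty mu; case Ir : (I mu) => [r| |]//= _; last by rewrite leNye.
apply/lee_subgt0Pr => e e0; rewrite -EFinN -EFinB.
apply: limn_einf_ge_near.
apply: filterS (ZPN_lowerI ac (winterior_wnbhs Amu) Ir e0) => N hN.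
by apply: le_scaled_lne => //; rewrite -opprD.
Qed.

End rate_function.

Lemma cvg_ereal_near (R : realType) (u : nat -> \bar R) (l : R) :
  (forall e, 0 < e -> \forall N \near \oo, ((l - e)%:E <= u N)%E) ->
  (forall e, 0 < e -> \forall N \near \oo, (u N <= (l + e)%:E)%E) ->
  u @ \oo --> l%:E.
Proof.
move=> hl hu.
have hfin (e : R) : 0 < e -> \forall N \near \oo, u N \is a fin_num /\ `|l - fine (u N)| <= e.
  move=> e0; apply: filterS2 (hl e e0) (hu e e0) => N.
  case: (u N) => [s| |]//=; rewrite !lee_fin => h1 h2; split=> //.
  by rewrite ler_norml; apply/andP; split; lra.
apply/fine_cvgP; split; first by apply: filterS (hfin 1 ltr01) => N [].
by apply/cvgrPdist_le => e e0; apply: filterS (hfin e e0) => N [].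
Qed.

(** * Bounds for the normalized laws under (H4) *)

Section normalized.
Context (R : realType) (d : nat).
Local Notation Rd := (d.-tuple R).
Variables (V : Rd -> R) (W : Rd -> Rd -> \bar R) (v0 a b : R) (beta : nat -> R).
Hypothesis adm : admissible V W v0 a b.
Hypothesis H1W : H1 W.
Hypothesis V_int : (Rd_int (fun x => (expR (- V x))%:E) < +oo)%E.
Hypothesis beta_gt0 : forall N, 0 < beta N.
Hypothesis beta_large : forall A : R, \forall N \near \oo, A * N%:R <= beta N.
Hypothesis approx : H4 V W.
Local Notation I := (Ifun V W).
Local Notation i0 := (fine (Iinf V W)).
Local Notation Z := (ZN V W beta).
Implicit Types (mu nu : M1 R d) (S A : set (M1 R d)).

Lemma Iinf_fine : Iinf V W = i0%:E.
Proof. by rewrite fineK// (Iinf_fin adm). Qed.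

Lemma Istar_gt mu (l : R) : (l%:E < Istar V W mu)%E = ((l + i0)%:E < I mu)%E.
Proof.
rewrite /Istar Iinf_fine; have := Ifun_ninfty adm mu; case: (I mu) => [s| |]//= _.
- by rewrite -EFinB !lte_fin ltrBrDr.
- by rewrite addye// !ltry.
Qed.

(** The approximating sequence of (H4) ends up in any weak neighbourhood of [mu], since finitely
    many test functions define it, with energies close to that of [mu]. *)
Lemma winterior_recovery mu A (r e : R) : winterior A mu -> I mu = r%:E -> 0 < e ->
  exists nu (s : R), [/\ abscont nu, winterior A nu, I nu = s%:E & s < r + e].
Proof.
move=> [U [oU Umu UA]] Ir e0.
have [|nus [ac cv Icv]] := approx (nu := mu); first by rewrite Ir ltry.
have [n [f [ep [bf ep0 HU]]]] := oU mu Umu.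
have near1 : \forall k \near \oo, U (nus k).
  have : \forall k \near \oo, forall i : 'I_n, `|pint (nus k) (f i) - pint mu (f i)| < ep.
    apply: filter_forall => i.
    have /cvgr_dist_lt/(_ ep ep0) := cv (f i) (bf i).
    by apply: filterS => k; rewrite distrC.
  by apply: filterS => k; exact: HU.
rewrite Ir in Icv; have /fine_cvgP[near2 /cvgr_lt near3] := Icv.
have near3' := near3 (r + e) (ltr_pwDr e0 (lexx r)).
near \oo => k.
exists (nus k), (fine (I (nus k))); split.
- exact: ac.
- by exists U; split=> //; near: k.
- by rewrite fineK//; near: k.
- by near: k.
Unshelve. all: by end_near. Qed.

Lemma ZPN_lowerH4 mu A (r e : R) : winterior A mu -> I mu = r%:E -> 0 < e ->
  \forall N \near \oo, ((expR (beta N * - (r + e)))%:E <= ZPN V W beta N A)%E.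
Proof.
move=> Amu Ir e0; have e20 : 0 < e / 2 by rewrite divr_gt0.
have [nu [s [ac Anu Is sr]]] := winterior_recovery Amu Ir e20.
apply: filterS (ZPN_lowerI adm beta_gt0 beta_large ac (winterior_wnbhs Anu) Is e20) => N.
apply: le_trans; rewrite lee_fin ler_expR ler_pM2l//; lra.
Qed.

Lemma ZN_ZPN N : Z N = ZPN V W beta N setT.
Proof.
rewrite /ZN /ZPN; congr conf_int; apply/funext => x.
by rewrite preimage_setT indicT mul1e.
Qed.

Let wclosedT : wclosed [set: M1 R d]. Proof. by rewrite /wclosed setCT => mu []. Qed.

Lemma ZN_upper (e : R) : 0 < e -> \forall N \near \oo, (Z N <= (expR (beta N * - (i0 - e)))%:E)%E.
Proof.
move=> e0; have e20 : 0 < e / 2 by rewrite divr_gt0.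
have h mu : [set: M1 R d] mu -> ((i0 - e / 2)%:E < I mu)%E.
  by move=> _; apply: lt_le_trans (Iinf_le _ _ mu); rewrite Iinf_fine lte_fin; lra.
apply: filterS (ZPN_upperI adm V_int beta_gt0 beta_large wclosedT h e20) => N.
by rewrite ZN_ZPN -addrA -opprD -splitr.
Qed.

Lemma ZN_lower (e : R) : 0 < e -> \forall N \near \oo, ((expR (beta N * - (i0 + e)))%:E <= Z N)%E.
Proof.
(* The infimum is attained, so the lower bound is applied at a minimizer. *)
move=> e0; have [mu] := Imin_neq0 adm H1W; rewrite (Imin_IfunE adm)//= Iinf_fine => Imu.
have h : winterior setT mu by exists setT; split=> // nu _; exists 0, (fun=> cst 0), 1; split=> // -[].
by apply: filterS (ZPN_lowerH4 h Imu e0) => N; rewrite ZN_ZPN.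
Qed.

(** Makes the factor [(fine Z)^-1] in [PN] a genuine normalization for large [N]. *)
Lemma ZN_fin : \forall N \near \oo, (0 < Z N < +oo)%E.
Proof.
apply: filterS2 (ZN_upper ltr01) (ZN_lower ltr01) => N h1 h2; apply/andP; split.
  by apply: lt_le_trans h2; rewrite lte_fin expR_gt0.
by apply: le_lt_trans h1 _; rewrite ltry.
Qed.

Lemma PN_ge0 N A : (0 <= PN V W beta N A)%E.
Proof.
apply: mule_ge0; first exact: ZPN_ge0.
by rewrite lee_fin invr_ge0 fine_ge0// ZN_ZPN ZPN_ge0.
Qed.

Lemma PN_upper S (l e : R) : wclosed S -> (forall mu, S mu -> (l%:E < Istar V W mu)%E) -> 0 < e ->
  \forall N \near \oo, (PN V W beta N S <= (expR (beta N * - (l - e)))%:E)%E.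
Proof.
move=> cS Sl e0; have e20 : 0 < e / 2 by rewrite divr_gt0.
have h mu : S mu -> ((l + i0)%:E < I mu)%E by move=> /Sl; rewrite Istar_gt.
near=> N.
have h1 : (ZPN V W beta N S <= (expR (beta N * - (l + i0 - e / 2)))%:E)%E.
  by near: N; exact: (ZPN_upperI adm V_int beta_gt0 beta_large cS h e20).
have h2 : ((expR (beta N * - (i0 + e / 2)))%:E <= Z N)%E by near: N; exact: ZN_lower.
have h3 : (0 < Z N < +oo)%E by near: N; exact: ZN_fin.
rewrite /PN; move: h2 h3; case: (Z N) => [z| |]//=; rewrite ?ltxx ?andbF// lee_fin !lte_fin => h2 /andP[z0 _].
apply: (@le_trans _ _ ((expR (beta N * - (l + i0 - e / 2)))%:E * (z^-1)%:E)%E).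
  by apply: lee_wpmul2r => //; rewrite lee_fin invr_ge0 ltW.
rewrite -EFinM lee_fin ler_pdivrMr//.
apply: (@le_trans _ _ (expR (beta N * - (l - e)) * expR (beta N * - (i0 + e / 2)))).
  rewrite -expRD -mulrDr ler_expR ler_pM2l//; lra.
by rewrite ler_pM2l// expR_gt0.
Unshelve. all: by end_near. Qed.

Lemma PN_lower mu A (r e : R) : winterior A mu -> Istar V W mu = r%:E -> 0 < e ->
  \forall N \near \oo, ((expR (beta N * - (r + e)))%:E <= PN V W beta N A)%E.
Proof.
move=> Amu Ir e0; have e20 : 0 < e / 2 by rewrite divr_gt0.
have Ir' : I mu = (r + i0)%:E.
  move: Ir; rewrite /Istar Iinf_fine; have := Ifun_ninfty adm mu; case: (I mu) => [s| |]//= _.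
    by rewrite -EFinB => -[<-]; rewrite subrK.
near=> N.
have h1 : ((expR (beta N * - (r + i0 + e / 2)))%:E <= ZPN V W beta N A)%E.
  by near: N; exact: (ZPN_lowerH4 Amu Ir' e20).
have h2 : (Z N <= (expR (beta N * - (i0 - e / 2)))%:E)%E by near: N; exact: ZN_upper.
have h3 : (0 < Z N < +oo)%E by near: N; exact: ZN_fin.
rewrite /PN; move: h2 h3; case: (Z N) => [z| |]//=; rewrite ?ltxx ?andbF// lee_fin !lte_fin => h2 /andP[z0 _].
apply: (@le_trans _ _ ((expR (beta N * - (r + i0 + e / 2)))%:E * (z^-1)%:E)%E); last first.
  by apply: lee_wpmul2r => //; rewrite lee_fin invr_ge0 ltW.
rewrite -EFinM lee_fin ler_pdivlMr//.
apply: (@le_trans _ _ (expR (beta N * - (r + e)) * expR (beta N * - (i0 - e / 2)))).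
  by rewrite ler_pM2l// expR_gt0.
rewrite -expRD -mulrDr ler_expR ler_pM2l//; lra.
Unshelve. all: by end_near. Qed.

Local Open Scope ereal_scope.

Lemma limn_esup_PN A :
  limn_esup (fun N => ((beta N)^-1)%:E * lne (PN V W beta N A)) <=
  - ereal_inf (Istar V W @` wclosure A).
Proof.
apply: lee_oppr_dense => l lI.
apply/lee_addgt0Pr => e e0; rewrite -EFinD.
apply: limn_esup_le_near.
have Sl mu : wclosure A mu -> l%:E < Istar V W mu.
  by move=> Amu; apply: lt_le_trans lI _; apply: ereal_inf_lbound; exists mu.
apply: filterS (PN_upper (@wclosed_wclosure _ _ A) Sl e0) => N hN.
apply: scaled_lne_le => //; first exact: PN_ge0.
apply: le_trans (_ : _ <= PN V W beta N (wclosure A)) _.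
  apply: lee_wpmul2r; last exact: le_ZPN (@subset_wclosure _ _ A).
  by rewrite lee_fin invr_ge0 fine_ge0// ZN_ZPN ZPN_ge0.
by rewrite (_ : - l + e = - (l - e))%R//; lra.
Qed.

Lemma limn_einf_PN A : - ereal_inf (Istar V W @` winterior A) <=
  limn_einf (fun N => ((beta N)^-1)%:E * lne (PN V W beta N A)).
Proof.
rewrite leeNl; apply: le_ereal_inf_tmp => _ [mu Amu <-]; rewrite leeNl.
case Ir : (Istar V W mu) => [r| |].
- apply/lee_subgt0Pr => e e0; rewrite -EFinN -EFinB.
  apply: limn_einf_ge_near.
  apply: filterS (PN_lower Amu Ir e0) => N hN.
  by apply: le_scaled_lne => //; rewrite -opprD.
- by rewrite leNye.
- exfalso; move: Ir; rewrite /Istar Iinf_fine.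
  by have := Ifun_ninfty adm mu; case: (I mu).
Qed.

(** [Z N] is of order [exp (- beta_N inf I)], whence the sign and the presence of [I] rather than
    [Istar]. *)
Lemma cvg_ZN : (fun N => ((beta N)^-1)%:E * lne (Z N)) @ \oo --> - Iinf V W.
Proof.
rewrite Iinf_fine -EFinN; apply: cvg_ereal_near => e e0.
- apply: filterS (ZN_lower e0) => N h; apply: le_scaled_lne => //.
  by rewrite -opprD.
- apply: filterS (ZN_upper e0) => N h; apply: scaled_lne_le => //.
    by rewrite ZN_ZPN ZPN_ge0.
  by rewrite (_ : - i0 + e = - (i0 - e))%R//; lra.
Qed.

End normalized.

(** * Almost sure convergence *)

Section fortet_mourier.
Context (R : realType) (d : nat).
Local Notation Rd := (d.-tuple R).
Implicit Types (mu nu : M1 R d) (S : set (M1 R d)) (f : Rd -> R).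

Lemma FMclass0 : FMclass (fun _ : Rd => 0 : R).
Proof. by split=> [x|x y]; rewrite ?subrr normr0 ?edist_ge0. Qed.

Lemma FMclass_bmeas f : FMclass f -> bmeas f.
Proof. by move=> /FMclass_bcont/bcont_bmeas. Qed.

Lemma le_dFM mu nu f : FMclass f -> pint mu f - pint nu f <= dFM mu nu.
Proof.
move=> Ff; apply: ub_le_sup; last by exists f.
exists 2 => _ [g Fg <-]; have bg := FMclass_bmeas Fg.
apply: le_trans (ler_norm _) _; apply: le_trans (ler_normB _ _) _.
by rewrite mulr2n lerD//; apply: pint_norm_le => //; exact: Fg.1.
Qed.

Lemma dFM_le mu nu (c : R) : (forall f, FMclass f -> pint mu f - pint nu f <= c) -> dFM mu nu <= c.
Proof.
move=> h; apply: ge_sup; last by move=> _ [f Ff <-]; exact: h.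
by exists (pint mu (fun=> 0) - pint nu (fun=> 0)); exists (fun=> 0) => //; exact: FMclass0.
Qed.

Lemma dFM_ge0 mu nu : 0 <= dFM mu nu.
Proof. by apply: le_trans (le_dFM mu nu FMclass0); rewrite !pint_cst subrr. Qed.

Lemma dFMset_has_lbound mu S : has_lbound [set dFM mu nu | nu in S].
Proof. by exists 0 => _ [nu _ <-]; exact: dFM_ge0. Qed.

Lemma dFMset_le mu nu S : S nu -> dFMset mu S <= dFM mu nu.
Proof. by move=> Snu; apply: ge_inf; [exact: dFMset_has_lbound|exists nu]. Qed.

Lemma dFMset_ge0 mu S : S !=set0 -> 0 <= dFMset mu S.
Proof.
move=> [nu Snu]; apply: lb_le_inf; first by exists (dFM mu nu); exists nu.
by move=> _ [xi _ <-]; exact: dFM_ge0.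
Qed.

Lemma dFMset_mem mu S : S mu -> dFMset mu S = 0.
Proof.
move=> Smu; apply/eqP; rewrite eq_le dFMset_ge0 ?andbT; last by exists mu.
apply: le_trans (dFMset_le _ Smu) _; apply: dFM_le => f _; by rewrite subrr.
Qed.

(** If some [nu] in [S] is closer to [mu] than [del], it remains so when [mu] moves by half the gap
    in Fortet-Mourier distance, and [wnbhs_FM] says that such moves fill a weak neighbourhood. *)
Lemma wclosed_dFMset_ge S (del : R) : S !=set0 -> wclosed [set mu | del <= dFMset mu S].
Proof.
move=> [nu0 Snu0]; apply/wopenP => mu /= /negP; rewrite -ltNge => h.
have [|_ [nu Snu <-] hnu] := inf_lt _ h; first by exists (dFM mu nu0); exists nu0.
have e0 : 0 < (del - dFM mu nu) / 2 by rewrite divr_gt0// subr_gt0.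
apply: filterS (wnbhs_FM mu e0) => xi hxi; apply/negP; rewrite -ltNge.
apply: le_lt_trans (dFMset_le _ Snu) _.
apply: (@le_lt_trans _ _ (dFM mu nu + (del - dFM mu nu) / 2)); last by lra.
apply: dFM_le => f Ff; have := hxi f Ff; rewrite ler_norml => /andP[_ h1].
by have := le_dFM mu nu Ff; lra.
Qed.

End fortet_mourier.

(** * Measurability of events on empirical measures *)

Section empirical_measurability.
Context (R : realType) (d N : nat).
Local Notation Rd := (d.-tuple R).
Hypothesis N0 : (0 < N)%N.

Let dist (x y : N.-tuple Rd) : R := \sum_(i < N) edist (tnth x i) (tnth y i).

Let dist_coord x y i : edist (tnth x i) (tnth y i) <= dist x y.
Proof. by rewrite /dist (bigD1 i)//= lerDl sumr_ge0// => j _; exact: edist_ge0. Qed.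

(** Continuity of [empN]: finitely many test functions at the [N] points of [x] share one modulus
    [e]. *)
Let near_empN (x : N.-tuple Rd) (U : set (M1 R d)) : wnbhs (empN x) U ->
  exists2 e, 0 < e & forall y, dist x y < e -> U (empN y).
Proof.
move=> [n [f [ep [bf ep0 HU]]]].
have : \forall e \near (0:R)^'+, forall (i : 'I_n) (j : 'I_N),
    forall y, edist (tnth x j) y < e -> `|f i y - f i (tnth x j)| < ep.
  apply: filter_forall => i; apply: filter_forall => j.
  have [del del0 Hdel] := (bf i).1 (tnth x j) ep ep0.
  near=> e => y ye; apply: Hdel; apply: lt_trans ye _; near: e; exact: nbhs_right_lt.
move=> /(filterI (nbhs_right_gt (0:R))) /filter_ex[e [/= e0 He]].
exists e => // y xye; apply: HU => i /=.
have fm : bmeas (f i) by exact: bcont_bmeas.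
rewrite (pint_empN N0 y fm) (pint_empN N0 x fm) -mulrBr -sumrB normrM ger0_norm ?invr_ge0//.
rewrite mulrC ltr_pdivrMr ?ltr0n//; apply: le_lt_trans (ler_norm_sum _ _ _) _.
rewrite mulr_natr -[X in _ *+ X]card_ord -sumr_const.
apply: ltr_sum => [|j _]; last by apply: He; apply: le_lt_trans (dist_coord _ _ _) xye.
by apply/hasP; exists (Ordinal N0) => //; rewrite mem_index_enum.
Unshelve. all: by end_near. Qed.

Lemma measurable_empN_wopen (U : set (M1 R d)) : wopen U -> measurable (@empN R d N @^-1` U).
Proof.
move=> /wopenP oU.
apply: (@open_measurable _ _ R _ (fun q : N.-tuple (d.-tuple rat) => map_tuple (@ratpt R d) q) dist).
- move=> x e e0.
  have e0' : 0 < e / N%:R by rewrite divr_gt0// ltr0n.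
  have /choice[q Hq] : forall i : 'I_N, exists q, edist (@ratpt R d q) (tnth x i) < e / N%:R.
    by move=> i; exact: ratpt_dense.
  exists [tuple q i | i < N]; rewrite /dist.
  apply: (@lt_le_trans _ _ (\sum_(i < N) e / N%:R)).
    apply: ltr_sum => [|j _]; last by rewrite tnth_map tnth_mktuple.
    by apply/hasP; exists (Ordinal N0) => //; rewrite mem_index_enum.
  by rewrite sumr_const card_ord -(mulr_natr (e / N%:R)) divfK// pnatr_eq0 -lt0n.
- move=> q x y; rewrite /dist -big_split/=; apply: ler_sum => i _.
  by rewrite (edistC (tnth _ i) (tnth x i)); exact: edist_triangle.
- move=> q e; rewrite -[X in measurable X]setTI; apply: measurable_fun_ltr => //.
  apply: measurable_sum => i.
  by apply: (measurableT_comp (@measurable_edist R d _)); exact: measurable_tnth.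
- by move=> x Ux; apply: near_empN; exact: oU.
Qed.

Lemma measurable_empN_wclosed (S : set (M1 R d)) : wclosed S -> measurable (@empN R d N @^-1` S).
Proof.
by move=> /measurable_empN_wopen/measurableC; rewrite preimage_setC setCK.
Qed.

End empirical_measurability.

(** Borel-Cantelli, the bounds being summable since [exp (- (n + 1)) <= 2 ^ - (n + 1)]. Emptying the
    initial sets, where the bound or measurability may fail, does not change the upper limit. *)
Lemma negligible_lim_sup_set d (T : measurableType d) (R : realType)
    (P : {measure set T -> \bar R}) (A : nat -> set T) :
  (forall n, (0 < n)%N -> measurable (A n)) ->
  (\forall n \near \oo, (P (A n) <= (expR (- n.+1%:R))%:E)%E) ->
  P.-negligible (lim_sup_set A).
Proof.
move=> mA [n0 _ Hn0].
pose F n := if (maxn n0 1 <= n)%N then A n else set0.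
have mF n : measurable (F n).
  by rewrite /F; case: ifPn => //; rewrite geq_max => /andP[_]; exact: mA.
have : P (lim_sup_set F) = 0%E.
  apply: lim_sup_set_cvg0 => //.
  apply: (@le_lt_trans _ _ (\sum_(i <oo) (1 / (2 ^ i.+1)%:R)%:E)%E); last first.
    by apply: le_lt_trans (epsilon_trick0 _ ler01) _; rewrite ltry.
  apply: lee_nneseries => // n _; rewrite /F; case: ifPn => [|_]; last first.
    by rewrite measure0 lee_fin divr_ge0.
  rewrite geq_max => /andP[n0n _]; apply: le_trans (Hn0 n n0n) _.
  rewrite lee_fin expRN div1r lef_pV2 ?posrE ?expR_gt0 ?ltr0n ?expn_gt0//.
  rewrite -[n.+1%:R]mul1r expRM_natr natrX lerXn2r ?nnegrE ?expR_ge0//.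
  by have := expR_ge1Dx (1 : R); rewrite (_ : 1 + 1 = 2 :> R).
move=> h; exists (lim_sup_set F); split=> //.
  apply: bigcap_measurable; first by exists 0%N.
  by move=> k _; apply: bigcup_measurable.
move=> x Ax n _; have [j /= nj Aj] := Ax (maxn n (maxn n0 1)) Logic.I.
exists j; first by apply: leq_trans nj; exact: leq_maxl.
by rewrite /F (leq_trans _ nj)// leq_maxr.
Qed.

(** * Borel-Cantelli along the laws [PN] *)

Section almost_sure_convergence.
Context (R : realType) (d : nat).
Local Notation Rd := (d.-tuple R).
Variables (V : Rd -> R) (W : Rd -> Rd -> \bar R) (v0 a b : R) (beta : nat -> R).
Hypothesis adm : admissible V W v0 a b.
Hypothesis H1W : H1 W.
Hypothesis V_int : (Rd_int (fun x => (expR (- V x))%:E) < +oo)%E.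
Hypothesis beta_gt0 : forall N, 0 < beta N.
Hypothesis beta_large : forall A : R, \forall N \near \oo, A * N%:R <= beta N.
Hypothesis approx : H4 V W.

(** [I] attains its minimum on a nonempty closed set, and off [Imin] that minimum exceeds the global
    one. *)
Lemma Istar_gt_away (S : set (M1 R d)) : wclosed S -> S `&` Imin V W = set0 ->
  exists2 c : R, 0 < c & forall mu, S mu -> (c%:E < Istar V W mu)%E.
Proof.
move=> cS SI; have [S0|S0] := eqVneq S set0; first by exists 1 => // mu; rewrite S0.
have [mu Smu Hmu] := Ifun_min_attained adm cS ((set0P _).1 S0).
have Imu : (0%:E < Istar V W mu)%E.
  rewrite (Istar_gt adm H1W) add0r -(Iinf_fine adm H1W) lt_neqAle Iinf_le andbT.
  apply/eqP => e; suff : set0 mu by [].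
  by rewrite -SI; split=> //; rewrite (Imin_IfunE adm H1W).
have [c [c0 cI]] := ereal_dense_lt Imu.
exists c => // nu Snu; apply: lt_le_trans cI _.
by rewrite /Istar leeB// Hmu.
Qed.

Lemma PN_exp_small (S : set (M1 R d)) : wclosed S -> S `&` Imin V W = set0 ->
  \forall N \near \oo, (PN V W beta N S <= (expR (- N.+1%:R))%:E)%E.
Proof.
move=> cS SI; have [c c0 Hc] := Istar_gt_away cS SI.
have c20 : 0 < c / 2 by rewrite divr_gt0.
have hP := PN_upper adm H1W V_int beta_gt0 beta_large approx cS Hc c20.
near=> N.
(* The exponent [beta N * c / 2] is then at least [2 * N], hence at least [N + 1]. *)
have h1 : 4 / c * N%:R <= beta N by near: N; exact: beta_large.
have N1 : 1 <= N%:R :> R by near: N; exact: near_ge_nat.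
have h2 : (PN V W beta N S <= (expR (beta N * - (c - c / 2)))%:E)%E by near: N.
apply: le_trans h2 _; rewrite lee_fin ler_expR mulrN lerN2.
have -> : c - c / 2 = c / 2 by lra.
apply: (@le_trans _ _ (4 / c * N%:R * (c / 2))); last by rewrite ler_pM2r.
rewrite (_ : 4 / c * N%:R * (c / 2) = 2 * N%:R); last by field; rewrite gt_eqF.
by rewrite -natr1; lra.
Unshelve. all: by end_near. Qed.

(** Only the marginal laws are prescribed: the convergence half of Borel-Cantelli holds for any
    coupling of the configurations. Countably many distances [1 / (k + 1)] suffice. *)
Lemma cvg_dFMset_Imin (dO : measure_display) (Omega : measurableType dO)
    (P : probability Omega R) (X : forall N : nat, Omega -> N.-tuple Rd) :
  (forall N, measurable_fun setT (X N)) ->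
  (forall N, (ZN V W beta N < +oo)%E ->
     forall B, measurable B ->
       P (X N @^-1` B) = (ZlawN V W beta B * ((fine (ZN V W beta N))^-1)%:E)%E) ->
  {ae P, forall w, (fun N => dFMset (empN (X N w)) (Imin V W)) @ \oo --> (0 : R)}.
Proof.
move=> mX law.
have I0 := Imin_neq0 adm H1W.
pose S (k : nat) : set (M1 R d) := [set mu | k.+1%:R^-1 <= dFMset mu (Imin V W)].
have cS k : wclosed (S k) by exact: wclosed_dFMset_ge.
have SI k : S k `&` Imin V W = set0.
  apply/seteqP; split=> mu //= -[]; rewrite /S /= => + Imu.
  by rewrite (dFMset_mem Imu) leNgt invr_gt0 ltr0n.
pose A (k N : nat) : set Omega := X N @^-1` (@empN R d N @^-1` S k).
have mE k N : (0 < N)%N -> measurable (@empN R d N @^-1` S k).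
  by move=> N0; exact: measurable_empN_wclosed.
have nA k : P.-negligible (lim_sup_set (A k)).
  apply: negligible_lim_sup_set => [N N0|].
    by rewrite /A -[X in measurable X]setTI; apply: mX => //; exact: mE.
  have hZ := ZN_fin adm H1W V_int beta_gt0 beta_large approx.
  have hP := PN_exp_small (cS k) (SI k).
  near=> N.
  have N0 : (0 < N)%N by near: N; exact: nbhs_infty_gt.
  (* The law of [X N] is prescribed only when [Z_N] is finite, which holds for large [N]. *)
  have /andP[_ ZNy] : (0 < ZN V W beta N < +oo)%E by near: N.
  apply: (@le_trans _ _ (PN V W beta N (S k))); last by near: N.
  rewrite le_eqVlt; apply/orP; left; apply/eqP; exact: (law N ZNy _ (mE k N N0)).
apply: negligibleS (negligible_bigcup nA) => w /=.
apply: contra_notP => hw.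
apply/cvgrPdist_lt => e e0.
have [k ke] : exists k, (k.+1%:R^-1 : R) < e.
  exists (Num.bound e^-1); rewrite invf_plt ?posrE ?ltr0n//.
  apply: lt_trans (archi_boundP _) _; rewrite ?invr_ge0 ?(ltW e0)//.
  by rewrite ltr_nat.
have [n Hn] : exists n, forall j, (n <= j)%N -> ~ A k j w.
  apply: contrapT => h; apply: hw; exists k => // n _.
  apply: contrapT => h'; apply: h; exists n => j nj Aj; apply: h'; by exists j.
exists n => // j /= nj; rewrite sub0r normrN ger0_norm ?dFMset_ge0//.
apply: le_lt_trans ke; have /negP := Hn j nj; rewrite -ltNge => /ltW; exact.
Unshelve. all: by end_near. Qed.

End almost_sure_convergence.

Theorem theorem1p1 (R : realType) (d : nat) (hd : (1 <= d)%N)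
  (V : d.-tuple R -> R) (W : d.-tuple R -> d.-tuple R -> \bar R)
  (beta : nat -> R) :
  H1 W -> H2 V -> H3 V W ->
  (forall N, 0 < beta N) ->
  (fun N : nat => beta N / (N%:R * ln N%:R)) @ \oo --> +oo ->
  [/\
   (* (1) compact (and closed) level sets, finite infimum *)
   (forall r : R, wcompact [set mu | (Ifun V W mu <= r%:E)%E] /\
                  wclosed [set mu | (Ifun V W mu <= r%:E)%E]) /\
   (-oo < Iinf V W)%E,
   (* (2) upper and lower bounds for Z_N P_N(mu_N in A) *)
   (forall A : set (M1 R d), wborel A ->
      (limn_esup (fun N => ((beta N)^-1)%:E * lne (ZPN V W beta N A))
         <= - ereal_inf (Ifun V W @` wclosure A))%E /\
      (- ereal_inf (Ifun V W @` [set mu | winterior A mu /\ abscont mu])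
         <= limn_einf (fun N => ((beta N)^-1)%:E * lne (ZPN V W beta N A)))%E),
   (* (3) full LDP under (H4) *)
   (H4 V W ->
      (forall A : set (M1 R d), wborel A ->
        [/\ (- ereal_inf (Istar V W @` winterior A)
               <= limn_einf (fun N => ((beta N)^-1)%:E * lne (PN V W beta N A)))%E,
            (limn_einf (fun N => ((beta N)^-1)%:E * lne (PN V W beta N A))
               <= limn_esup (fun N => ((beta N)^-1)%:E * lne (PN V W beta N A)))%E &
            (limn_esup (fun N => ((beta N)^-1)%:E * lne (PN V W beta N A))
               <= - ereal_inf (Istar V W @` wclosure A))%E]) /\
      (fun N => ((beta N)^-1)%:E * lne (ZN V W beta N))%E @ \oo --> (- Iinf V W)%E),
   (* (4) I_min nonempty ... *)
   Imin V W !=set0 &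
   (* ... and a.s. convergence of mu_N to I_min under (H4) *)
   (H4 V W ->
    forall (dO : measure_display) (Omega : measurableType dO)
           (P : probability Omega R)
           (X : forall N : nat, Omega -> N.-tuple (d.-tuple R)),
      (forall N, measurable_fun setT (X N)) ->
      (forall N, (ZN V W beta N < +oo)%E ->
         forall B, measurable B ->
           P (X N @^-1` B) = (ZlawN V W beta B * ((fine (ZN V W beta N))^-1)%:E)%E) ->
      {ae P, forall w, (fun N => dFMset (empN (X N w)) (Imin V W)) @ \oo --> (0 : R)})].
Proof.
move=> h1 h2 h3 beta_gt0 hbeta.
have [v0 [a [b adm]]] := admissible_exists h1 h2 h3.
have beta_large := superlinear_of_nlogn hbeta.
have [_ _ V_int] := h2.
split.
- split; last exact: (Iinf_gt adm).
  by move=> r; exact: (Ifun_sublevel adm).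
- move=> A _; split.
    exact: (limn_esup_ZPN adm V_int beta_gt0 beta_large).
  exact: (limn_einf_ZPN adm beta_gt0 beta_large).
- move=> approx; split; last exact: (cvg_ZN adm h1 V_int beta_gt0 beta_large approx).
  move=> A _; split.
  + exact: (limn_einf_PN adm h1 V_int beta_gt0 beta_large approx).
  + exact: limn_einf_sup.
  + exact: (limn_esup_PN adm h1 V_int beta_gt0 beta_large approx).
- exact: (Imin_neq0 adm h1).
- move=> approx dO Omega P X mX law.
  exact: (cvg_dFMset_Imin adm h1 V_int beta_gt0 beta_large approx mX law).
Qed.
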